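(* Let $n \geq 3$. There are no non-trivial cases of equality in the inequality \[ (\mathbf{R}_{n} + n-1)^2\left\|\frac{f}{|x|^2}\right\|_{2}^2 \leq \|\Delta f\|_{2}^2, \qquad f\in H^2(\mathbb{R}^n),\ Pf=0; \] that is, if $f\in H^2(\mathbb{R}^n)$ satisfies $Pf=0$ and $(\mathbf{R}_{n} + n-1)^2\left\|\frac{f}{|x|^2}\right\|_{2}^2 = \|\Delta f\|_{2}^2$, then $f=0$.
   Context: $\|\cdot\|_2$ denotes the norm of $L^2(\mathbb{R}^n)$ (Lebesgue measure). $\Delta$ is the standard Laplacian on $\mathbb{R}^n$. $\mathbf{R}_n = \frac{n(n-4)}{4}$. $H^2(\mathbb{R}^n)$ is the Sobolev space with norm $\|f\|_{H^2} = \|(1-\Delta)f\|_2$. $P$ is the orthogonal projection of $L^2(\mathbb{R}^n)$ onto radially symmetric functions, given by $Pf(x) = \frac{1}{\sigma(\mathbb{S}^{n-1})} \int_{\mathbb{S}^{n-1}} f(|x|\omega)\, \mathrm{d}\sigma(\omega)$, where $\sigma$ is the surface measure on $\mathbb{S}^{n-1}$. *)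

(* Defs.v *)
From HB Require Import structures.
From mathcomp Require Import all_boot all_order all_algebra.
From mathcomp Require Import complex.
From mathcomp Require Import all_classical all_reals all_analysis.
From mathcomp Require Import measurable_realfun.

Set Implicit Arguments.
Unset Strict Implicit.
Unset Printing Implicit Defensive.
Import Order.TTheory GRing.Theory Num.Theory.
Import numFieldNormedType.Exports.

Local Open Scope classical_set_scope.
Local Open Scope ring_scope.

(* Borel sigma-algebra of R^n = 'rV[R]_n, generated by the coordinates exactly
   as for the library's n.-tuple R. *)
Definition rV_coor (R : realType) n (i : 'I_n) (x : 'rV[R]_n) : R := x 0 i.

Definition rV_measure_display : measure_display -> measure_display.
Proof. exact. Qed.

Section rV_measurable.
Variables (R : realType) (n : nat).

Let rV_set0 : g_sigma_preimage (@rV_coor R n) set0.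
Proof. exact: sigma_algebra0. Qed.

Let rV_setC A :
  g_sigma_preimage (@rV_coor R n) A -> g_sigma_preimage (@rV_coor R n) (~` A).
Proof. exact: sigma_algebraC. Qed.

Let rV_bigcup (F : _^nat) : (forall i, g_sigma_preimage (@rV_coor R n) (F i)) ->
  g_sigma_preimage (@rV_coor R n) (\bigcup_i (F i)).
Proof. exact: sigma_algebra_bigcup. Qed.

HB.instance Definition _ := @isMeasurable.Build
  (rV_measure_display default_measure_display) 'rV[R]_n
  (g_sigma_preimage (@rV_coor R n)) rV_set0 rV_setC rV_bigcup.

End rV_measurable.

Lemma measurable_rV_coor (R : realType) n (i : 'I_n) :
  measurable_fun [set: 'rV[R]_n] (rV_coor i).
Proof.
move=> _ Y mY; rewrite setTI; apply: sub_sigma_algebra => /=.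
rewrite -bigcup_seq/=; exists i => /=; first by rewrite mem_index_enum.
by exists Y => //; rewrite setTI.
Qed.

Lemma measurable_fun_rVP d (T : measurableType d) (R : realType) n
    (f : T -> 'rV[R]_n) :
  (forall i, measurable_fun [set: T] (rV_coor i \o f)) ->
  measurable_fun [set: T] f.
Proof.
move=> mf _ A mA; rewrite setTI.
suff : g_sigma_preimage (fun i => rV_coor i \o f) `<=` measurable.
  apply; rewrite g_sigma_preimage_comp; exists A => //.
  by rewrite setTI.
apply: smallest_sub; first exact: sigma_algebra_measurable.
case: n => [|n] in f mf A mA *; first by rewrite big_ord0.
rewrite -bigcup_mkord_ord; apply: bigcup_sub => i Ii.
by move=> B [C mC <-]; exact: mf.
Qed.

Section lebesgue_rV.
Variable R : realType.

Definition rV_cons n (p : measurableTypeR R * 'rV[R]_n) : 'rV[R]_n.+1 :=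
  \row_i oapp (p.2 0) p.1 (unlift 0 i).

Lemma measurable_rV_cons n : measurable_fun [set: _] (@rV_cons n).
Proof.
apply: measurable_fun_rVP => i.
case: (unliftP 0 i) => [j ->|->].
- rewrite (_ : _ \o _ = rV_coor j \o snd); last first.
    by apply/funext => p; rewrite /rV_coor/= mxE liftK.
  by apply: measurableT_comp; [exact: measurable_rV_coor|exact: measurable_snd].
- rewrite (_ : _ \o _ = fst); first exact: measurable_fst.
  by apply/funext => p; rewrite /rV_coor/= mxE unlift_none.
Qed.

Section next.
Variables (n : nat) (mu : {sigma_finite_measure set 'rV[R]_n -> \bar R}).

Definition lebesgue_rV_next (A : set 'rV[R]_n.+1) : \bar R :=
  pushforward (@lebesgue_measure R \x mu)%E (@rV_cons n) A.

Let next0 : lebesgue_rV_next set0 = 0%E.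
Proof. by rewrite /lebesgue_rV_next/pushforward preimage_set0 measure0. Qed.

Let next_ge0 A : (0 <= lebesgue_rV_next A)%E.
Proof. by rewrite /lebesgue_rV_next /pushforward measure_ge0. Qed.

Let next_sigma_additive : semi_sigma_additive lebesgue_rV_next.
Proof.
move=> F mF tF mUF; rewrite /lebesgue_rV_next /pushforward preimage_bigcup.
apply: measure_semi_sigma_additive.
- by move=> k; rewrite -[X in measurable X]setTI; exact: measurable_rV_cons.
- apply/trivIsetP => /= i j _ _ ij; rewrite -preimage_setI.
  by move/trivIsetP : tF => /(_ _ _ _ _ ij) ->//; rewrite preimage_set0.
- by rewrite -preimage_bigcup -[X in measurable X]setTI;
    exact: measurable_rV_cons.
Qed.

HB.instance Definition _ := isMeasure.Build _ _ _ lebesgue_rV_next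
  next0 next_ge0 next_sigma_additive.

Let next_sigma_finite : sigma_finite setT lebesgue_rV_next.
Proof.
have /sigma_finiteP[F [FT ndF Foo]] := sigma_finiteT (@lebesgue_measure R).
have /sigma_finiteP[G [GT ndG Goo]] := sigma_finiteT mu.
pose g (x : 'rV[R]_n.+1) : measurableTypeR R * 'rV[R]_n :=
  (x 0 0, \row_i x 0 (lift 0 i)).
have gK p : g (rV_cons p) = p.
  case: p => t x; rewrite /g; congr pair; first by rewrite mxE unlift_none.
  by apply/rowP => i; rewrite !mxE liftK.
have mg : measurable_fun setT g.
  apply/measurable_fun_pair; first exact: (@measurable_rV_coor R n.+1 0).
  apply: measurable_fun_rVP => i.
  rewrite (_ : _ \o _ = rV_coor (lift ord0 i)); first exact: measurable_rV_coor.
  by apply/funext => x; rewrite /rV_coor/= mxE.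
exists (fun k => g @^-1` (F k `*` G k)).
  apply/esym; rewrite -subTset => x _.
  have [i _ Fi] : (\bigcup_i F i) (g x).1 by rewrite -FT.
  have [j _ Gj] : (\bigcup_i G i) (g x).2 by rewrite -GT.
  exists (maxn i j) => //; split.
    by move: Fi; exact/subsetPset/ndF/leq_maxl.
  by move: Gj; exact/subsetPset/ndG/leq_maxr.
move=> k; have [mFk Fk] := Foo k; have [mGk Gk] := Goo k; split.
  by rewrite -[X in measurable X]setTI; apply: mg => //; exact: measurableX.
rewrite /lebesgue_rV_next /pushforward -comp_preimage.
rewrite (_ : g \o _ = id); last by apply/funext => p; rewrite /= gK.
by rewrite preimage_id product_measure1E// lte_mul_pinfty// ge0_fin_numE.
Qed.

HB.instance Definition _ := Measure_isSigmaFinite.Build _ _ _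
  lebesgue_rV_next next_sigma_finite.

End next.

(* n-dimensional Lebesgue measure, as the n-fold product of the library's
   one-dimensional lebesgue_measure. *)
Fixpoint lebesgue_rV n : {sigma_finite_measure set 'rV[R]_n -> \bar R} :=
  match n with
  | 0 => (\d_ (0 : 'rV[R]_0) : {measure set 'rV[R]_0 -> \bar R})
  | m.+1 => lebesgue_rV_next (lebesgue_rV m)
  end.

Lemma lebesgue_rV_rect n (A : 'I_n -> set (measurableTypeR R)) :
  (forall i, measurable (A i)) ->
  lebesgue_rV n [set x | forall i, A i (x 0 i)] =
  (\prod_(i < n) lebesgue_measure (A i))%E.
Proof.
elim: n => [|n IHn] in A * => mA.
  rewrite big_ord0 /= diracE mem_set//=.
  by case.
rewrite big_ord_recl -IHn//= /lebesgue_rV_next /pushforward.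
have mB : measurable [set x : 'rV[R]_n | forall i, A (lift ord0 i) (x 0 i)].
  rewrite (_ : mkset _ = \bigcap_i (rV_coor i @^-1` A (lift ord0 i))).
    apply: fin_bigcap_measurable => // i _; rewrite -[X in measurable X]setTI.
    by apply: measurable_rV_coor => //; exact: mA.
  by apply/seteqP; split => x /= Ax i; [move=> _|]; exact: Ax.
rewrite -product_measure1E//; congr product_measure1.
apply/seteqP; split => -[t x] /=.
  move=> Atx; split; first by have := Atx 0; rewrite mxE unlift_none.
  by move=> i; have := Atx (lift 0 i); rewrite mxE liftK.
move=> [At Ax] i; rewrite mxE.
by case: (unliftP 0 i) => [j|] ->; [exact: Ax|exact: At].
Qed.

End lebesgue_rV.

Section euclidean.
Variables (R : realType) (n : nat).
Implicit Types (x : 'rV[R]_n) (phi : 'rV[R]_n -> R) (f g : 'rV[R]_n -> R[i]).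

Local Notation mu := (lebesgue_rV R n).

(* The library's norm `|x| on 'rV[R]_n is the sup norm. *)
Definition enorm x : R := Num.sqrt (\sum_i x 0 i ^+ 2).

Lemma measurable_enorm : measurable_fun setT enorm.
Proof.
apply: measurableT_comp.
  apply: continuous_measurable_fun.
  exact: sqrt_continuous.
apply: measurable_sum => i; apply: measurable_funX.
exact: (@measurable_rV_coor R n i).
Qed.

(* C^infty: all iterated partial derivatives exist and are continuous. *)
Definition partial phi (i : 'I_n) : 'rV[R]_n -> R := 'D_(delta_mx 0 i) phi.

Definition smooth phi := forall s : seq 'I_n,
  continuous (foldl partial phi s) /\
  forall (i : 'I_n) x, derivable (foldl partial phi s) x (delta_mx 0 i).

Definition test_function phi :=
  smooth phi /\ compact (closure [set x | phi x != 0]).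

Definition laplacian phi x : R := \sum_i partial (partial phi i) i x.

Definition cintegral (nu : {measure set 'rV[R]_n -> \bar R}) (D : set 'rV[R]_n)
    (f : 'rV[R]_n -> R[i]) : R[i] :=
  Complex (\int[nu]_(x in D) complex.Re (f x))
          (\int[nu]_(x in D) complex.Im (f x)).

Definition L2norm f : \bar R := ('N[mu]_2%:E[(fun x => (Normc.normc (f x))%:E)])%E.

(* Elements of L^2 are represented by Borel functions; equality in L^2 is
   equality almost everywhere. *)
Definition inL2 f := [/\ measurable_fun setT (fun x => complex.Re (f x)),
  measurable_fun setT (fun x => complex.Im (f x)) & (L2norm f < +oo)%E].

(* g = Delta f in L^2, in the sense of distributions. By linearity real-valued
   test functions suffice. *)
Definition is_laplacian f g := inL2 g /\
  forall phi, test_function phi ->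
    cintegral mu setT (fun x => f x * (laplacian phi x)%:C%C) =
    cintegral mu setT (fun x => g x * (phi x)%:C%C).

(* The domain of the norm f |-> ||(1 - Delta) f||_2: as f is in L^2, requiring
   (1 - Delta) f in L^2 amounts to requiring Delta f in L^2. *)
Definition inH2 f := inL2 f /\ exists g, is_laplacian f g.

Definition esphere : set 'rV[R]_n := [set w | enorm w = 1].

Definition punctured_ball : set 'rV[R]_n := [set x | 0 < enorm x <= 1].

Definition direction x : 'rV[R]_n := (enorm x)^-1 *: x.

(* The surface measure of the unit sphere, as determined by polar coordinates:
   sigma(A) = n * |{r w : 0 < r <= 1, w in A}|. *)
Definition sphere_measure (A : set 'rV[R]_n) : \bar R :=
  (n%:R%:E * mu (punctured_ball `&` direction @^-1` A))%E.

Lemma measurable_punctured_ball : measurable punctured_ball.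
Proof.
rewrite (_ : punctured_ball = setT `&` enorm @^-1` `]0, 1]).
  by apply: measurable_enorm => //; exact: measurable_itv.
by rewrite setTI; apply/seteqP; split => x /=; rewrite in_itv.
Qed.

Lemma measurable_direction : measurable_fun setT direction.
Proof.
apply: measurable_fun_rVP => i.
rewrite (_ : _ \o _ = (fun x => enorm x `^ (-1)) \* rV_coor i); last first.
  by apply/funext => x /=; rewrite /rV_coor mxE powR_inv1// sqrtr_ge0.
apply: measurable_funM; last exact: measurable_rV_coor.
apply: (measurableT_comp (f := fun y => y `^ (-1))).
  exact: measurable_powR.
exact: measurable_enorm.
Qed.

Let nu : {measure set 'rV[R]_n -> \bar R} :=
  mscale n%:R%:nng (mrestr mu measurable_punctured_ball).

Let sphere_measureE A : sphere_measure A = nu (direction @^-1` A).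
Proof. by rewrite /sphere_measure setIC. Qed.

Let sphere_measure0 : sphere_measure set0 = 0%E.
Proof. by rewrite sphere_measureE preimage_set0 measure0. Qed.

Let sphere_measure_ge0 A : (0 <= sphere_measure A)%E.
Proof. by rewrite sphere_measureE measure_ge0. Qed.

Let sphere_measure_sigma_additive : semi_sigma_additive sphere_measure.
Proof.
have mdir B : measurable B -> measurable (direction @^-1` B).
  by move=> mB; rewrite -[X in measurable X]setTI; exact: measurable_direction.
move=> F mF tF mUF; rewrite sphere_measureE preimage_bigcup.
rewrite (_ : (fun k => _) = fun k => (\sum_(0 <= i < k) nu (direction @^-1` F i))%E);
  last by apply/funext => k; apply: eq_bigr => i _; rewrite sphere_measureE.
apply: measure_semi_sigma_additive.
- by move=> k; exact: mdir.
- apply/trivIsetP => /= i j _ _ ij; rewrite -preimage_setI.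
  by move/trivIsetP : tF => /(_ _ _ _ _ ij) ->//; rewrite preimage_set0.
- by rewrite -preimage_bigcup; exact: mdir.
Qed.

HB.instance Definition _ := isMeasure.Build _ _ _ sphere_measure
  sphere_measure0 sphere_measure_ge0 sphere_measure_sigma_additive.

(* P f. For f in L^2 the integral converges for almost every x; elsewhere the
   value is irrelevant. *)
Definition radial_proj f x : R[i] :=
  ((fine (sphere_measure esphere))^-1)%:C%C *
  cintegral sphere_measure esphere (fun w => f (enorm x *: w)).

End euclidean.

Definition R_const (R : realType) (n : nat) : R := n%:R * (n%:R - 4) / 4.

(* Main.v *)
Require Import Defs.
From HB Require Import structures.
From mathcomp Require Import all_boot all_order all_algebra.
From mathcomp Require Import complex ring lra.
From mathcomp Require Import all_classical all_reals all_analysis.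
From mathcomp Require Import measurable_realfun.

Set Implicit Arguments.
Unset Strict Implicit.
Unset Printing Implicit Defensive.
Import Order.TTheory GRing.Theory Num.Theory.
Import numFieldNormedType.Exports.

Local Open Scope classical_set_scope.
Local Open Scope ring_scope.

(* Real and imaginary parts are treated separately. Let u be one of them, g its
   distributional Laplacian, q = |x|^2 and E = x . grad. For a mollification phi of u and
   a radial cutoff theta(q), the divergence of D_i phi phi V + x_i phi^2 U, with
   V = theta / q and U = b V / q - V', integrates to zero. Completing the square
   (E phi + b phi)^2 leaves the tangential part |grad phi|^2 - (E phi)^2 / q, which is at
   least (n - 1) phi^2 / q on every sphere up to the square of the spherical mean of phi.
   The spherical means of phi tend to those of u, which vanish. Taking
   b = (n - 4) / 2 + lam q / (1 + q) and removing mollification and cutoff, one gets, with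
   c = R_n + n - 1,
     2 lam \int (u / q)^2 q / (1 + q)^2 <=
       lam^2 \int (u / q)^2 + (1 / 2c) (\int g^2 - c^2 \int (u / q)^2).
   In the equality case the last bracket vanishes after summing over both parts, and
   letting lam tend to 0 gives u = 0.
   The Poincare inequality on spheres comes from the tensorized Gaussian one, applied to
   the 1-homogeneous extension |x| phi(r x / |x|). *)

(** * Fubini and affine changes of variables for Lebesgue measure on R^n *)

Section lebesgue_rV_theory.
Context {R : realType}.
Local Notation leb := (@lebesgue_measure R).

(** The square is stationary in [b] at the constant [(n - 4) / 2]. A perturbation [kap(q)] of [b]
    therefore enters only through [- kap^2] and its derivative [2 kap'], up to terms with
    derivatives of the cutoff. A bounded increasing [kap] of size [lam] gains at first order and
    loses at second order. The formal extremal, [|x|^(-(n-4)/2)] times a harmonic of degree one,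
    just fails to have a finite weighted norm. The function is only in L^2 with a distributional
    Laplacian, so calculus is done on mollifications. Their spherical means are not claimed to
    vanish; the squared mean is carried along as an error. The constant [n - 1] on spheres is the
    Gaussian second moment [n] of the norm minus the 1 contributed by the radial derivative of the
    1-homogeneous extension. Nothing is lost: harmonics of degree one extend to linear functions,
    the equality case of the Gaussian inequality. Finiteness of the norm of [f / |x|^2] is not
    assumed; it follows from the equality, whose right-hand side is finite. *)

Lemma lebesgue_measure_affine (l b : R) (A : set R) : 0 < l -> measurable A ->
  leb ((fun t => l * t + b) @^-1` A) = (l^-1%:E * leb A)%E.
Proof.
move=> l0 mA; pose phi : measurableTypeR R -> measurableTypeR R := fun t => l * t + b.
have mphi : measurable_fun [set: measurableTypeR R] phi.
  by apply: measurable_funD => //; exact: measurable_funM.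
have l0' : 0 <= l by exact: ltW.
(* [l] times the image measure agrees with Lebesgue measure on half-open intervals, and these
   determine it. *)
have U := @lebesgue_measure_unique R (mscale (NngNum l0') (pushforward leb phi)).
rewrite (U mphi _ A mA).
  by rewrite /mscale/= /pushforward muleA -EFinM mulVf ?mul1e// gt_eqF.
move=> {A mA} _ [[u v]] _ <-.
rewrite /pushforward.
pose I : set R := `](u - b) / l, (v - b) / l]%classic.
transitivity (l%:E * leb I)%E; last first.
  congr (_ * leb _)%E; apply/seteqP; split => x; rewrite /I/= /phi !in_itv/=;
  by rewrite ltr_pdivrMr// ler_pdivlMr// ltrBlDr lerBrDr (mulrC x).
rewrite /I !lebesgue_measure_itv/= !lte_fin.
rewrite ltr_pM2r ?invr_gt0// ltrD2r.
case: ifPn => _; last by rewrite mule0.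
rewrite -!EFinD -EFinM; congr EFin; field; exact: lt0r_neq0.
Qed.

Lemma ge0_integral_affine (l b : R) (h : R -> \bar R) : 0 < l ->
  measurable_fun setT h -> (forall t, 0 <= h t)%E ->
  (\int[leb]_t h (l * t + b)%R = l^-1%:E * \int[leb]_t h t)%E.
Proof.
move=> l0 mh h0; pose phi : measurableTypeR R -> measurableTypeR R := fun t => l * t + b.
have mphi : measurable_fun [set: measurableTypeR R] phi.
  by apply: measurable_funD => //; exact: measurable_funM.
have l0' : 0 <= l^-1 by rewrite invr_ge0 ltW.
transitivity (\int[pushforward leb phi]_t h t)%E.
  by rewrite ge0_integral_pushforward.
rewrite -(ge0_integral_mscale leb measurableT (NngNum l0'))//.
apply: eq_measure_integral => A mA _ /=; rewrite /mscale/=.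
exact: lebesgue_measure_affine.
Qed.

Lemma rV_cons0 n (t : R) (x : 'rV[R]_n) : rV_cons (t, x) 0 0 = t.
Proof. by rewrite mxE unlift_none. Qed.

Lemma rV_consS n (t : R) (x : 'rV[R]_n) i : rV_cons (t, x) 0 (lift 0 i) = x 0 i.
Proof. by rewrite mxE liftK. Qed.

(** By construction Lebesgue measure on R^(n+1) is the image under [rV_cons] of a product measure,
    so this is Tonelli's theorem. The variants below treat the other order of integration and
    integrable functions. *)
Lemma ge0_integral_rVS n (f : 'rV[R]_n.+1 -> \bar R) :
  measurable_fun setT f -> (forall x, 0 <= f x)%E ->
  (\int[lebesgue_rV R n.+1]_x f x =
   \int[leb]_t \int[lebesgue_rV R n]_x f (rV_cons (t, x)))%E.
Proof.
move=> mf f0; transitivity (\int[pushforward (leb \x lebesgue_rV R n) (@rV_cons R n)]_x f x)%E.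
  by [].
rewrite ge0_integral_pushforward//; last exact: measurable_rV_cons.
rewrite preimage_setT fubini_tonelli1//.
  by apply: measurableT_comp => //; exact: measurable_rV_cons.
by move=> p; exact: f0.
Qed.

Lemma ge0_integral_rVS2 n (f : 'rV[R]_n.+1 -> \bar R) :
  measurable_fun setT f -> (forall x, 0 <= f x)%E ->
  (\int[lebesgue_rV R n.+1]_x f x =
   \int[lebesgue_rV R n]_x \int[leb]_t f (rV_cons (t, x)))%E.
Proof.
move=> mf f0; transitivity (\int[pushforward (leb \x lebesgue_rV R n) (@rV_cons R n)]_x f x)%E.
  by [].
rewrite ge0_integral_pushforward//; last exact: measurable_rV_cons.
rewrite preimage_setT fubini_tonelli2//.
  by apply: measurableT_comp => //; exact: measurable_rV_cons.
by move=> p; exact: f0.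
Qed.

Lemma integral_rVS n (f : 'rV[R]_n.+1 -> \bar R) :
  (lebesgue_rV R n.+1).-integrable setT f ->
  (\int[lebesgue_rV R n.+1]_x f x =
   \int[leb]_t \int[lebesgue_rV R n]_x f (rV_cons (t, x)))%E.
Proof.
move=> intf; have mf := measurable_int _ intf.
have intf' : (leb \x lebesgue_rV R n)%E.-integrable setT (f \o (@rV_cons R n)).
  apply/integrableP; split.
    by apply: measurableT_comp => //; exact: measurable_rV_cons.
  have /integrableP[_] := intf.
  apply: le_lt_trans; rewrite le_eqVlt; apply/orP; left; apply/eqP.
  transitivity (\int[pushforward (leb \x lebesgue_rV R n) (@rV_cons R n)]_x `|f x|)%E => //.
  rewrite ge0_integral_pushforward//; first exact: measurable_rV_cons.
  exact: measurableT_comp.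
transitivity (\int[pushforward (leb \x lebesgue_rV R n) (@rV_cons R n)]_x f x)%E => //.
rewrite integral_pushforward//; last exact: measurable_rV_cons.
by rewrite preimage_setT -integral12_prod_meas1.
Qed.

Lemma integral_rVS2 n (f : 'rV[R]_n.+1 -> \bar R) :
  (lebesgue_rV R n.+1).-integrable setT f ->
  (\int[lebesgue_rV R n.+1]_x f x =
   \int[lebesgue_rV R n]_x \int[leb]_t f (rV_cons (t, x)))%E.
Proof.
move=> intf; have mf := measurable_int _ intf.
have intf' : (leb \x lebesgue_rV R n)%E.-integrable setT (f \o (@rV_cons R n)).
  apply/integrableP; split.
    by apply: measurableT_comp => //; exact: measurable_rV_cons.
  have /integrableP[_] := intf.
  apply: le_lt_trans; rewrite le_eqVlt; apply/orP; left; apply/eqP.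
  transitivity (\int[pushforward (leb \x lebesgue_rV R n) (@rV_cons R n)]_x `|f x|)%E => //.
  rewrite ge0_integral_pushforward//; first exact: measurable_rV_cons.
  exact: measurableT_comp.
transitivity (\int[pushforward (leb \x lebesgue_rV R n) (@rV_cons R n)]_x f x)%E => //.
rewrite integral_pushforward//; last exact: measurable_rV_cons.
by rewrite preimage_setT -integral21_prod_meas1.
Qed.

Lemma measurable_affine_rV n (l : R) (v : 'rV[R]_n) :
  measurable_fun [set: 'rV[R]_n] (fun x => l *: x + v).
Proof.
apply: measurable_fun_rVP => i.
rewrite (_ : _ \o _ = fun x => l * rV_coor i x + v 0 i); last first.
  by apply/funext => x; rewrite /rV_coor/= !mxE.
apply: measurable_funD => //; apply: measurable_funM => //.
exact: measurable_rV_coor.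
Qed.

(** Coordinates are peeled off one at a time, each contributing a factor [l^-1]. The case [l = 1] is
    translation invariance; the case [v = 0] is the scaling behind polar coordinates. *)
Lemma ge0_integral_affine_rV n (l : R) (v : 'rV[R]_n) (h : 'rV[R]_n -> \bar R) :
  0 < l -> measurable_fun setT h -> (forall t, 0 <= h t)%E ->
  (\int[lebesgue_rV R n]_x h (l *: x + v)%R =
   (l ^- n)%:E * \int[lebesgue_rV R n]_x h x)%E.
Proof.
move=> l0; elim: n => [|n IH] in v h *; move=> mh h0.
  rewrite expr0 invr1 mul1e; apply: eq_integral => x _.
  by congr h; apply/rowP => -[].
rewrite ge0_integral_rVS//; last first.
  by apply: measurableT_comp => //; exact: measurable_affine_rV.
rewrite ge0_integral_rVS//.
pose v' : 'rV[R]_n := \row_i v 0 (lift 0 i).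
pose H t := (\int[lebesgue_rV R n]_x h (rV_cons (t, x)))%E.
have mh2 : measurable_fun setT (h \o @rV_cons R n).
  by apply: measurableT_comp => //; exact: measurable_rV_cons.
have mH : measurable_fun setT H.
  by apply: (measurable_fun_fubini_tonelli_F (h \o @rV_cons R n)) => // p; exact: h0.
have mh1 t : measurable_fun setT (fun x => h (rV_cons (t, x))).
  exact: (measurableT_comp mh2 (pair1_measurable t)).
transitivity (\int[leb]_t ((l ^- n)%:E * H (l * t + v 0 0)%R))%E.
  apply: eq_integral => t _.
  rewrite /H -(IH v')//; apply: eq_integral => x _; congr h.
  apply/rowP => i; rewrite !mxE; case: (unliftP 0 i) => [j ->|->] /=.
    by rewrite !mxE.
  by [].
rewrite ge0_integralZl//; last 3 first.
- by apply: (measurableT_comp mH); apply: measurable_funD => //; exact: measurable_funM.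
- by move=> t _; apply: integral_ge0.
- by rewrite lee_fin invr_ge0 exprn_ge0// ltW.
rewrite ge0_integral_affine//; last by move=> t; apply: integral_ge0.
by rewrite muleA -EFinM; congr (_%:E * _)%E; rewrite exprSr invfM mulrC.
Qed.

End lebesgue_rV_theory.

(** * Continuity, measurability and boxes in R^n *)

Section rV_topology.
Context {R : realType}.

Lemma rV_nearP n (x : 'rV[R]_n) (P : set 'rV[R]_n) :
  (\forall y \near x, P y) <->
  (exists2 d, 0 < d & forall y : 'rV[R]_n, (forall i, `|x 0 i - y 0 i| < d) -> P y).
Proof.
split.
  move=> /nbhs_ballP[d /= d0 dP]; exists d => // y xy; apply: dP.
  by split => // i j; rewrite ord1; exact: xy.
move=> [d d0 dP]; apply/nbhs_ballP; exists d => //= y [_ xy]; apply: dP => i.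
exact: xy.
Qed.

Lemma rV_continuousP n (f : 'rV[R]_n -> R) :
  continuous f <->
  (forall (x : 'rV[R]_n) (e : R), 0 < e -> exists2 d, 0 < d &
    forall y : 'rV[R]_n, (forall i, `|x 0 i - y 0 i| < d) -> `|f x - f y| < e).
Proof.
split=> [cf x e e0|H x].
  have /cvgrPdist_lt/(_ _ e0) := cf x.
  by move/rV_nearP.
move=> A /nbhs_ballP[e /= e0 eA]; apply/rV_nearP.
by have [d d0 dP] := H x e e0; exists d => // y /dP /eA.
Qed.

Lemma rV_continuous_cst n (a : R) : continuous (fun _ : 'rV[R]_n => a).
Proof. by apply/rV_continuousP => x e e0; exists 1 => // y _; rewrite subrr normr0. Qed.

Lemma rV_continuousD n (f g : 'rV[R]_n -> R) :
  continuous f -> continuous g -> continuous (fun x => f x + g x).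
Proof. move=> cf cg x; exact: (continuousD (cf x) (cg x)). Qed.

Lemma rV_continuousM n (f g : 'rV[R]_n -> R) :
  continuous f -> continuous g -> continuous (fun x => f x * g x).
Proof. move=> cf cg x; exact: (continuousM (cf x) (cg x)). Qed.

Lemma rV_continuous_comp n (f : R -> R) (g : 'rV[R]_n -> R) :
  continuous f -> continuous g -> continuous (fun x => f (g x)).
Proof. move=> cf cg x; exact: (continuous_comp (cg x) (cf (g x))). Qed.

Lemma rV_continuous_sum n m (f : 'I_m -> 'rV[R]_n -> R) :
  (forall i, continuous (f i)) -> continuous (fun x => \sum_i f i x).
Proof.
move=> cf; apply: continuous_big => [|i _]; first exact: add_continuous.
exact: cf.
Qed.

Lemma rV_coor_continuous n (i : 'I_n) : continuous (fun x : 'rV[R]_n => x 0 i).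
Proof. by apply/rV_continuousP => x e e0; exists e. Qed.

Let discr n k (x : 'rV[R]_n) : 'rV[int]_n := \row_i Num.floor (k.+1%:R * x 0 i).

Let undiscr n k (z : 'rV[int]_n) : 'rV[R]_n := \row_i ((z 0 i)%:~R / k.+1%:R).

Let undiscrE n k (x : 'rV[R]_n) i :
  `|x 0 i - undiscr k (discr k x) 0 i| <= k.+1%:R^-1.
Proof.
rewrite /undiscr /discr !mxE.
have k0 : 0 < k.+1%:R :> R by rewrite ltr0n.
have -> : x 0 i = (k.+1%:R * x 0 i) / k.+1%:R by rewrite mulrAC mulfV ?mul1r// gt_eqF.
rewrite mulrCA mulfV ?gt_eqF// mulr1 -mulrBl normrM.
rewrite [X in _ * X]ger0_norm ?invr_ge0 ?(ltW k0)//.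
rewrite -[leRHS]mul1r ler_wpM2r ?invr_ge0 ?(ltW k0)// ger0_norm ?subr_ge0 ?floor_le//.
by rewrite lerBlDl; apply/ltW; rewrite -intrD1 floorD1_gt.
Qed.

(** The sigma-algebra is generated by the coordinates, not by the open sets. So [f] is written as
    the pointwise limit of its composites with rounding to the lattice of mesh [k.+1^-1]; each
    composite takes countably many values, on measurable cells. *)
Lemma continuous_rV_measurable n (f : 'rV[R]_n -> R) :
  continuous f -> measurable_fun setT f.
Proof.
move=> cf; apply: (@measurable_fun_cvg _ _ _ _ (fun k x => f (undiscr k (discr k x)))).
  move=> k _ Y mY; rewrite setTI.
  pose E (z : 'rV[int]_n) := \bigcap_(i in [set: 'I_n])
    [set x : 'rV[R]_n | Num.floor (k.+1%:R * x 0 i) = z 0 i].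
  suff : measurable (\bigcup_(z in [set z : 'rV[int]_n | Y (f (undiscr k z))]) E z).
    congr measurable; apply/seteqP; split => x /=.
      move=> [z /= Yz zx]; suff -> : discr k x = z by [].
      by apply/rowP => i; rewrite mxE; exact: zx.
    by move=> Yx; exists (discr k x) => //= i _; rewrite /= mxE.
  rewrite bigcup_mkcond; apply: countable_bigcupT_measurable => [|z].
    exact: countableP.
  case: ifPn => // _.
  apply: fin_bigcap_measurable => // i _.
  have : measurable_fun setT (fun x : 'rV[R]_n => k.+1%:R * x 0 i).
    by apply: measurable_funM => //; exact: measurable_rV_coor.
  move=> /(_ measurableT `[(z 0 i)%:~R, (z 0 i + 1)%:~R[%classic (measurable_itv _)).
  rewrite setTI; congr measurable; apply/seteqP; split => x /=; rewrite in_itv/=.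
    by rewrite -floor_eq => /eqP.
  by move=> /eqP; rewrite floor_eq.
move=> x _; apply/cvgrPdist_lt => e e0.
have [d d0 dP] := (rV_continuousP f).1 cf x e e0.
near=> k; apply: dP => i; apply: le_lt_trans (undiscrE k x i) _.
near: k; exact: near_infty_natSinv_lt (PosNum d0).
Unshelve. all: end_near. Qed.

Definition rV_box n (M : R) : set 'rV[R]_n := [set x | forall i, `|x 0 i| <= M].
Arguments rV_box n M x : clear implicits.

Lemma measurable_rV_box n M : measurable (rV_box n M).
Proof.
rewrite (_ : rV_box n M = \bigcap_(i in setT) [set x | `|x 0 i| <= M]); last first.
  by apply/seteqP; split => x /= h i; [move=> _|]; exact: h.
apply: fin_bigcap_measurable => // i _.
have : measurable_fun setT (fun x : 'rV[R]_n => `|x 0 i|).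
  by apply: measurableT_comp => //; exact: measurable_rV_coor.
move=> /(_ measurableT `]-oo, M]%classic (measurable_itv _)); rewrite setTI.
by congr measurable; apply/seteqP; split => x /=; rewrite in_itv/=.
Qed.

Lemma lebesgue_rV_box_lty n M : (lebesgue_rV R n (rV_box n M) < +oo)%E.
Proof.
rewrite (_ : rV_box n M = [set x | forall i, `[-M, M]%classic (x 0 i)]); last first.
  by apply/seteqP; split => x /= h i; have := h i; rewrite in_itv/= ler_norml.
rewrite (lebesgue_rV_rect (A := fun=> `[-M, M]%classic))//.
set I := `[-M, M]%classic.
suff /andP[_ +] : (0 <= \prod_(i < n) lebesgue_measure I < +oo)%E by [].
elim/big_ind : _ => [|x y /andP[x0 xoo] /andP[y0 yoo]|i _].
- by rewrite lee_fin ler01 ltry.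
- by rewrite mule_ge0//= lte_mul_pinfty// ge0_fin_numE.
- by rewrite measure_ge0/= /I lebesgue_measure_itv/=; case: ifPn => // _; rewrite ltry.
Qed.

Lemma continuous_box_bounded n (f : 'rV[R]_n -> R) M : continuous f ->
  exists2 C, 0 <= C & forall x, rV_box n M x -> `|f x| <= C.
Proof.
move=> cf.
have cB : compact (rV_box n M).
  have := @rV_compact R n (fun=> `[-M, M]%classic) (fun=> @segment_compact _ _ _).
  congr compact; apply/seteqP; split => x /= h i; have := h i; rewrite ?in_itv/= ler_norml//.
have /compact_bounded[N [_ NP]] : compact (f @` rV_box n M).
  apply: continuous_compact => //; exact: continuous_subspaceT.
exists (Num.max 0 N + 1); first by rewrite addr_ge0// le_max lexx.
move=> x xM; apply: (NP (Num.max 0 N + 1)); last by exists x.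
by rewrite ltr_pwDr// le_max lexx orbT.
Qed.

End rV_topology.
Arguments rV_box {R} n M x.

(** * One-variable and directional derivatives *)

Section derivative_lemmas.
Context {R : realType}.

Lemma is_deriveP (V W : normedModType R) (f : V -> W) (x v : V) (d : W) :
  is_derive x v f d <->
  (h^-1 *: (f (h *: v + x) - f x)) @[h --> (0:R)^'] --> d.
Proof.
split=> [[df <-]|H]; first exact: df.
split; last exact/cvg_lim.
by apply/cvg_ex; exists d.
Qed.

Lemma is_derive_lineP (V W : normedModType R) (f : V -> W) (x v : V) (s : R) (d : W) :
  is_derive s 1 (fun t : R => f (x + t *: v)) d <-> is_derive (x + s *: v) v f d.
Proof.
rewrite !is_deriveP.
suff -> : (fun h : R => h^-1 *: (f (h *: v + (x + s *: v)) - f (x + s *: v))) =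
  (fun h => h^-1 *: ((fun t : R => f (x + t *: v)) (h *: (1:R) + s) - f (x + s *: v))) by [].
by apply/funext => h /=; rewrite scalerDl addrCA /GRing.scale/= mulr1.
Qed.

Lemma is_derive_mul (V : normedModType R) (f g : V -> R) (x v : V) (df dg : R) :
  is_derive x v f df -> is_derive x v g dg ->
  is_derive x v (fun t => f t * g t) (df * g x + f x * dg).
Proof.
move=> Df Dg; rewrite addrC [df * _]mulrC; exact: is_deriveM.
Qed.

Lemma is_derive_add (V : normedModType R) (f g : V -> R) (x v : V) (df dg : R) :
  is_derive x v f df -> is_derive x v g dg ->
  is_derive x v (fun t => f t + g t) (df + dg).
Proof. by move=> Df Dg; exact: is_deriveD. Qed.

Lemma is_derive_sumr (V : normedModType R) n (f : 'I_n -> V -> R) (x v : V) (df : 'I_n -> R) :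
  (forall i, is_derive x v (f i) (df i)) ->
  is_derive x v (fun t => \sum_i f i t) (\sum_i df i).
Proof.
move=> Df; rewrite (_ : (fun t => _) = \sum_i f i); first exact: is_derive_sum.
by apply/funext => t; rewrite fct_sumE.
Qed.

Lemma is_derive_cst_mul (V : normedModType R) (f : V -> R) (c : R) (x v : V) (df : R) :
  is_derive x v f df -> is_derive x v (fun t => c * f t) (c * df).
Proof. by move=> Df; exact: is_deriveZ. Qed.

Lemma is_derive_comp1 (f g : R -> R) (x a b : R) :
  is_derive (g x) 1 f a -> is_derive x 1 g b ->
  is_derive x 1 (fun t => f (g t)) (a * b).
Proof. exact: is_derive1_comp. Qed.

Lemma is_derive_inv (f : R -> R) (x df : R) : f x != 0 ->
  is_derive x 1 f df -> is_derive x 1 (fun t => (f t)^-1) (- (f x) ^- 2 * df).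
Proof. by move=> fx0 Df; exact: is_deriveV. Qed.

Lemma is_derive_continuous (V : normedModType R) (f : R -> V) (x : R) (d : V) :
  is_derive x 1 f d -> {for x, continuous f}.
Proof. by move=> [/derivable1_diffP/differentiable_continuous]. Qed.

End derivative_lemmas.

(** * The flat smooth functions Q(1/t) exp(-1/t) *)

Section exp_inv_bump.
Context {R : realType}.
Implicit Types (P Q : {poly R}) (s t : R).

(** The polynomial factor in [1/t] is there to make the family closed under differentiation. *)
Definition bump_poly Q (t : R) : R :=
  if 0 < t then Q.[t^-1] * expR (- t^-1) else 0.

(** With [s = 1/t], the derivative in [t] of [Q(s) exp(-s)] is [s^2 (Q - Q')(s) exp(-s)]. *)
Definition bump_deriv Q : {poly R} := 'X^2 * (Q - Q^`()).

Lemma horner_norm_le Q s : 1 <= s ->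
  `|Q.[s]| <= (\sum_(i < size Q) `|Q`_i|) * s ^+ (size Q).
Proof.
move=> s1; rewrite horner_coef; apply: le_trans (ler_norm_sum _ _ _) _.
rewrite mulr_suml; apply: ler_sum => i _; rewrite normrM ler_wpM2l//.
rewrite normrX ger0_norm ?(le_trans _ s1)//.
by rewrite ler_weXn2l// ltnW.
Qed.

(** Write [exp(-s)] as the power [m.+1] of [exp(-s / m.+1)] and use [x <= exp x]. *)
Lemma expRN_le_pow m s : 0 < s -> expR (- s) <= (m.+1%:R / s) ^+ m.+1.
Proof.
move=> s0; have m0 : 0 < m.+1%:R :> R by rewrite ltr0n.
have -> : - s = m.+1%:R * - (s / m.+1%:R).
  by rewrite mulrN mulrCA mulfV ?mulr1// gt_eqF.
rewrite expRM_natl; apply: lerXn2r; rewrite ?nnegrE ?expR_ge0//.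
  by rewrite divr_ge0// ltW.
rewrite expRN -[leRHS]invf_div lef_pV2 ?posrE ?expR_gt0 ?divr_gt0//.
by apply: le_trans (expR_ge1Dx _); rewrite lerDr.
Qed.

(** [Q(s)] grows at most like [s^m] with [m = size Q], while [exp(-s)] decays like [s^-(m+2)]; the
    two spare powers leave [t^2], which makes the function differentiable at 0. *)
Lemma bump_poly_bound Q : exists2 C, 0 <= C &
  forall t, 0 < t -> t <= 1 -> `|bump_poly Q t| <= C * t ^+ 2.
Proof.
set m := size Q; set A := \sum_(i < m) `|Q`_i|.
have A0 : 0 <= A by apply: sumr_ge0.
exists (A * m.+2%:R ^+ m.+2); first by rewrite mulr_ge0// exprn_ge0.
move=> t t0 t1; rewrite /bump_poly t0 normrM.
rewrite [X in _ * X]ger0_norm ?expR_ge0//.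
have s1 : 1 <= t^-1 by rewrite invf_ge1.
have s0 : 0 < t^-1 by rewrite invr_gt0.
apply: le_trans (ler_pM (normr_ge0 _) (expR_ge0 _) (horner_norm_le Q s1) (expRN_le_pow m.+1 s0)) _.
rewrite invrK exprMn; set K : R := m.+2%:R ^+ m.+2.
have K0 : 0 <= K by rewrite exprn_ge0.
clearbody K.
rewrite -[leLHS]mulrA -[leRHS]mulrA ler_wpM2l// mulrCA ler_wpM2l//.
by rewrite -/m -addn2 exprD mulrA -exprMn mulVf ?gt_eqF// expr1n mul1r.
Qed.

Lemma is_derive_bump_poly Q t :
  is_derive t 1 (bump_poly Q) (bump_poly (bump_deriv Q) t).
Proof.
have [t0|t0|->] := ltgtP t 0.
- rewrite /(bump_poly (bump_deriv _)) ltNge (ltW t0)/=.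
  apply: (@near_eq_is_derive _ _ _ (cst 0)).
  near=> u; rewrite /bump_poly ifF//; apply/negbTE; rewrite -leNgt ltW//.
  near: u; exact: lt_nbhsl.
- rewrite /(bump_poly (bump_deriv _)) t0.
  apply: (@near_eq_is_derive _ _ _ (fun t => Q.[t^-1] * expR (- t^-1))).
    near=> u; rewrite /bump_poly ifT//.
    near: u; exact: lt_nbhsr.
  have tn0 : t != 0 by rewrite gt_eqF.
  have Di : is_derive t 1 (fun u : R => u^-1) (- t ^- 2 * 1).
    by apply: (is_derive_inv (f := id)).
  have D1 := is_derive_comp1 (is_derive_poly Q _) Di.
  have D2 : is_derive t 1 (fun u : R => expR (- u^-1)) (expR (- t^-1) * - (- t ^- 2 * 1)).
    by apply: (is_derive_comp1 (is_derive_expR _)); exact: is_deriveN.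
  apply: is_derive_eq (is_derive_mul D1 D2) _.
  rewrite /bump_deriv hornerM hornerXn hornerD hornerN -exprVn; ring.
- rewrite /(bump_poly (bump_deriv _)) ltxx.
  apply/is_deriveP.
  (* At the origin the difference quotient is at most [C h], by quadratic flatness. *)
  have [C C0 CP] := bump_poly_bound Q.
  have b0 : bump_poly Q 0 = 0 by rewrite /bump_poly ltxx.
  apply/cvgrPdist_le => e e0; near=> h.
  rewrite sub0r normrN b0 subr0 addr0 /GRing.scale/= mulr1.
  have h0 : h != 0 by near: h; exact: nbhs_dnbhs_neq.
  have [hp|hn] := ltP 0 h; last first.
    by rewrite {1}/bump_poly ltNge hn/= mulr0 normr0 ltW.
  have h1 : h <= Num.min 1 (e / (C + 1)).
    apply: le_trans (ler_norm _) _; near: h.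
    by apply: dnbhs0_le; rewrite lt_min ltr01 divr_gt0// ltr_wpDl.
  move: h1; rewrite le_min => /andP[h1 he].
  rewrite normrM normfV [`|h|]gtr0_norm//.
  rewrite ler_pdivrMl//; apply: le_trans (CP h hp h1) _.
  rewrite expr2 mulrA mulrC ler_wpM2l ?(ltW hp)//.
  move: he; rewrite ler_pdivlMr ?ltr_wpDl// mulrDr mulr1 mulrC.
  by apply: le_trans; rewrite lerDl ltW.
Unshelve. all: end_near. Qed.

Lemma continuous_bump_poly Q : continuous (bump_poly Q).
Proof. by move=> t; apply: is_derive_continuous (is_derive_bump_poly Q t). Qed.

End exp_inv_bump.

(** * Smooth kernels with compact support *)

Section bump_kernels.
Context {R : realType} (n : nat).
Implicit Types (k : 'rV[R]_n -> R) (x y z : 'rV[R]_n).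

(** The squared Euclidean norm: a polynomial, hence smooth also at the origin, where [enorm] is
    not. *)
Definition sqn z : R := \sum_i z 0 i ^+ 2.

Lemma sqn_ge0 z : 0 <= sqn z.
Proof. by apply: sumr_ge0 => i _; rewrite sqr_ge0. Qed.

Lemma enorm_sqr z : enorm z ^+ 2 = sqn z.
Proof. by rewrite sqr_sqrtr// sqn_ge0. Qed.

Lemma coor_sqr_le_sqn z i : z 0 i ^+ 2 <= sqn z.
Proof.
rewrite /sqn (bigD1 i)//= lerDl; apply: sumr_ge0 => j _; exact: sqr_ge0.
Qed.

Lemma sqn_eq0 z : (sqn z == 0) = (z == 0).
Proof.
apply/eqP/eqP => [z0|->]; last first.
  by rewrite /sqn big1// => i _; rewrite mxE expr0n.
apply/rowP => i; rewrite mxE; apply/eqP; rewrite -sqrf_eq0 eq_le sqr_ge0 andbT.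
by rewrite -z0 coor_sqr_le_sqn.
Qed.

Lemma continuous_sqn : continuous sqn.
Proof.
apply: rV_continuous_sum => i.
by apply: rV_continuousM; exact: rV_coor_continuous.
Qed.

Lemma is_derive_sqn (c : R -> 'rV[R]_n) (s : R) (c' : 'rV[R]_n) :
  (forall i, is_derive s 1 (fun t => c t 0 i) (c' 0 i)) ->
  is_derive s 1 (fun t => sqn (c t)) (\sum_i c' 0 i * (2 * c s 0 i)).
Proof.
move=> Dc; apply: is_derive_sumr => i.
apply: is_derive_eq (is_derive_mul (Dc i) (Dc i)) _; ring.
Qed.

(** A class containing the radial bumps and stable under partial derivatives, all of whose members
    vanish outside the ball of squared radius [r]. Smoothness then comes by induction on the number
    of derivatives. *)
Inductive bump_kernel (r : R) : ('rV[R]_n -> R) -> Prop :=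
| bump_kernel_base Q : bump_kernel r (fun z => bump_poly Q (r - sqn z))
| bump_kernel_coor i k : bump_kernel r k -> bump_kernel r (fun z => z 0 i * k z)
| bump_kernel_scale (a : R) k : bump_kernel r k -> bump_kernel r (fun z => a * k z)
| bump_kernel_add k1 k2 : bump_kernel r k1 -> bump_kernel r k2 ->
    bump_kernel r (fun z => k1 z + k2 z).

(** Differentiability phrased as the chain rule along all curves. Lines give partial derivatives,
    and the curves [r z / |z|] on a sphere are covered as well. *)
Definition is_grad k (dk : 'I_n -> 'rV[R]_n -> R) :=
  forall (c : R -> 'rV[R]_n) (s : R) (c' : 'rV[R]_n),
  (forall i, is_derive s 1 (fun t => c t 0 i) (c' 0 i)) ->
  is_derive s 1 (fun t => k (c t)) (\sum_i c' 0 i * dk i (c s)).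

Lemma bump_kernel_grad r k : bump_kernel r k ->
  exists2 dk, forall i, bump_kernel r (dk i) & is_grad k dk.
Proof.
elim=> {k} [Q|i k bk [dk bdk Dk]|a k bk [dk bdk Dk]|k1 k2 b1 [dk1 bdk1 Dk1] b2 [dk2 bdk2 Dk2]].
- exists (fun i z => (-2) * (z 0 i * bump_poly (bump_deriv Q) (r - sqn z))) => [i|c s c' Dc].
    by apply: bump_kernel_scale; apply: bump_kernel_coor; exact: bump_kernel_base.
  have D1 := is_derive_sqn Dc.
  have D2 : is_derive s 1 (fun t => r - sqn (c t)) (0 - \sum_i c' 0 i * (2 * c s 0 i)).
    exact: is_deriveB.
  apply: is_derive_eq (is_derive_comp1 (is_derive_bump_poly Q _) D2) _.
  rewrite sub0r mulrN mulr_sumr -sumrN; apply: eq_bigr => i _; ring.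
- exists (fun j z => (if j == i then 1 else 0) * k z + z 0 i * dk j z) => [j|c s c' Dc].
    apply: bump_kernel_add; last exact: bump_kernel_coor.
    by case: ifPn => _; exact: bump_kernel_scale.
  apply: is_derive_eq (is_derive_mul (Dc i) (Dk _ _ _ Dc)) _.
  rewrite mulr_sumr; under [RHS]eq_bigr do rewrite mulrDr.
  rewrite big_split/=; congr (_ + _); last by apply: eq_bigr => j _; ring.
  rewrite (bigD1 i)//= eqxx mul1r big1 ?addr0// => j /negPf ->.
  by rewrite mul0r mulr0.
- exists (fun i z => a * dk i z) => [i|c s c' Dc]; first exact: bump_kernel_scale.
  apply: is_derive_eq (is_derive_cst_mul a (Dk _ _ _ Dc)) _.
  by rewrite mulr_sumr; apply: eq_bigr => j _; ring.
- exists (fun i z => dk1 i z + dk2 i z) => [i|c s c' Dc]; first exact: bump_kernel_add.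
  apply: is_derive_eq (is_derive_add (Dk1 _ _ _ Dc) (Dk2 _ _ _ Dc)) _.
  by rewrite -big_split/=; apply: eq_bigr => j _; rewrite mulrDr.
Qed.

Lemma bump_kernel_continuous r k : bump_kernel r k -> continuous k.
Proof.
elim=> {k} [Q|i k bk ck|a k bk ck|k1 k2 b1 c1 b2 c2].
- apply: rV_continuous_comp; first exact: continuous_bump_poly.
  rewrite (_ : (fun z => _) = fun z => r + (-1) * sqn z); last first.
    by apply/funext => z; rewrite mulN1r.
  apply: rV_continuousD; first exact: rV_continuous_cst.
  apply: rV_continuousM; [exact: rV_continuous_cst|exact: continuous_sqn].
- by apply: rV_continuousM; [exact: rV_coor_continuous|exact: ck].
- by apply: rV_continuousM; [exact: rV_continuous_cst|exact: ck].
- by apply: rV_continuousD; [exact: c1|exact: c2].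
Qed.

Lemma bump_kernel_supp r k z : bump_kernel r k -> r <= sqn z -> k z = 0.
Proof.
move=> + rz; elim=> {k} [Q|i k bk ->|a k bk ->|k1 k2 b1 -> b2 ->].
- by rewrite /bump_poly ifF//; apply/negbTE; rewrite -leNgt subr_le0.
- by rewrite mulr0.
- by rewrite mulr0.
- by rewrite addr0.
Qed.

(** The bound [|r| + 1] avoids a square root: a coordinate [t] with [|t| > |r| + 1] satisfies
    [t^2 >= |t| >= r]. *)
Lemma bump_kernel_box r k z : bump_kernel r k -> k z != 0 -> rV_box n (`|r| + 1) z.
Proof.
move=> bk kz i; rewrite leNgt; apply/negP => rzi.
move/eqP: kz; apply; apply: bump_kernel_supp bk _.
apply: le_trans (coor_sqr_le_sqn z i).
rewrite -real_normK ?num_real//.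
have z1 : 1 <= `|z 0 i| by apply: ltW; apply: le_lt_trans rzi; rewrite lerDr.
rewrite expr2; apply: (@le_trans _ _ `|z 0 i|); last by rewrite ler_peMr.
apply: le_trans (ler_norm r) _; apply: ltW; apply: le_lt_trans rzi; by rewrite lerDl.
Qed.

Lemma bump_kernel_bounded r k : bump_kernel r k ->
  exists2 C, 0 <= C & forall z, `|k z| <= C.
Proof.
move=> bk; have [C C0 CP] := continuous_box_bounded (`|r| + 1) (bump_kernel_continuous bk).
exists C => // z; have [->|kz] := eqVneq (k z) 0; first by rewrite normr0.
by apply: CP; exact: bump_kernel_box bk kz.
Qed.

Lemma measurable_bump_kernel r k : bump_kernel r k -> measurable_fun setT k.
Proof. by move=> bk; apply: continuous_rV_measurable; exact: bump_kernel_continuous bk. Qed.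

Lemma is_grad_partial k dk x y i : is_grad k dk ->
  is_derive y (delta_mx 0 i) (fun z => k (z - x)) (dk i (y - x)).
Proof.
move=> Dk; rewrite -[y]addr0 -[X in y + X](scale0r (delta_mx 0 i)).
apply/is_derive_lineP; rewrite scale0r addr0.
have := Dk (fun t : R => y + t *: delta_mx 0 i - x) 0 (delta_mx 0 i) _.
rewrite scale0r addr0 (bigD1 i)//= mxE !eqxx mul1r big1 ?addr0; last first.
  by move=> j /negPf ji; rewrite mxE ji andbF mul0r.
apply=> j.
rewrite (_ : (fun t => _) = fun t => (y 0 j - x 0 j) + (delta_mx 0 i : 'rV[R]_n) 0 j * t); last first.
  by apply/funext => t; rewrite !mxE; ring.
apply: is_derive_eq (is_derive_add (is_derive_cst _ _ _) (is_derive_cst_mul _ (is_derive_id _ _))) _.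
by rewrite add0r mulr1.
Qed.

Lemma is_gradP k dk x i : is_grad k dk ->
  partial (fun z => k (z - x)) i = (fun z => dk i (z - x)).
Proof.
move=> Dk; apply/funext => y; rewrite /partial.
by apply: derive_val; exact: is_grad_partial.
Qed.

Lemma bump_kernel_smooth r k x : bump_kernel r k -> smooth (fun z => k (z - x)).
Proof.
(* The induction on [s] runs on the stronger claim that every iterated partial derivative is again a
   translated kernel. *)
move=> bk s; suff [k' bk' ->] : exists2 k', bump_kernel r k' &
    foldl (@partial R n) (fun z => k (z - x)) s = (fun z => k' (z - x)).
  split.
    apply/rV_continuousP => y e e0.
    have [d d0 dP] := (rV_continuousP k').1 (bump_kernel_continuous bk') (y - x) e e0.
    exists d => // y' yy'; apply: dP => j; rewrite !mxE opprB addrA subrK; exact: yy'.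
  move=> i y; have [dk _ Dk] := bump_kernel_grad bk'.
  by have [] := is_grad_partial x y i Dk.
elim: s k bk => [|i s IH] k bk /=; first by exists k.
have [dk bdk Dk] := bump_kernel_grad bk.
by rewrite (is_gradP x i Dk); exact: IH.
Qed.

(** These translates are the test functions put into the weak equation; they turn it into an
    identity between mollifications at [x]. *)
Lemma bump_kernel_test r k x : bump_kernel r k -> test_function (fun z => k (z - x)).
Proof.
move=> bk; split; first exact: bump_kernel_smooth bk.
set M := `|r| + 1.
have cB : compact [set y : 'rV[R]_n | forall i, `[x 0 i - M, x 0 i + M]%classic (y 0 i)].
  apply: (rV_compact (A := fun i => `[x 0 i - M, x 0 i + M]%classic)) => i.
  exact: segment_compact.
apply: (subclosed_compact _ cB); first exact: closed_closure.
have := @compact_closed 'rV[R]_n _ (@norm_hausdorff R 'rV[R]_n) cB.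
move=> /closure_id ->; apply: closure_subset => y /= ky i.
have := bump_kernel_box bk ky i.
rewrite in_itv/= !mxE ler_norml -/M => /andP[h1 h2]; apply/andP; split; lra.
Qed.

Lemma is_grad_laplacian k dk ddk x y : is_grad k dk ->
  (forall i, is_grad (dk i) (ddk i)) ->
  laplacian (fun z => k (z - x)) y = \sum_i ddk i i (y - x).
Proof.
move=> Dk Ddk; rewrite /laplacian; apply: eq_bigr => i _.
by rewrite (is_gradP x i Dk) (is_gradP x i (Ddk i)).
Qed.

End bump_kernels.

(** * Gradients with a quadratic remainder *)

Section gradients.
Context {R : realType} {n : nat}.
Implicit Types (F : 'rV[R]_n -> R) (g : 'I_n -> 'rV[R]_n -> R) (x h : 'rV[R]_n).

Definition l1norm h : R := \sum_i `|h 0 i|.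

Lemma l1norm_ge0 h : 0 <= l1norm h.
Proof. exact: sumr_ge0. Qed.

Lemma coor_le_l1norm h i : `|h 0 i| <= l1norm h.
Proof. by rewrite /l1norm (bigD1 i)//= lerDl sumr_ge0. Qed.

(* A quantitative form of Frechet differentiability, stable under integration
   against [f] in L^2. *)
Definition has_grad F g := forall x, exists2 C, 0 <= C &
  forall h, l1norm h <= 1 -> `|F (x + h) - F x - \sum_i h 0 i * g i x| <= C * l1norm h ^+ 2.

Lemma has_grad_is_grad F g : has_grad F g -> is_grad F g.
Proof.
move=> Fg c s c' Dc; have [C C0 CP] := Fg (c s).
pose q (t : R) : 'rV[R]_n := c (t + s) - c s.
pose u (t : R) : 'rV[R]_n := t^-1 *: q t.
have cu i : u t 0 i @[t --> (0:R)^'] --> c' 0 i.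
  have /is_deriveP := Dc i.
  rewrite (_ : (fun t => _) = (fun t => u t 0 i))//; apply/funext => t.
  by rewrite /u /q !mxE /GRing.scale/= mulr1.
have cl : l1norm (u t) @[t --> (0:R)^'] --> l1norm c'.
  by apply: cvg_big => [|i _]; [exact: add_continuous|exact: cvg_norm].
have c0 : l1norm (q t) @[t --> (0:R)^'] --> 0.
  have : `|t| * l1norm (u t) @[t --> (0:R)^'] --> `|0:R| * l1norm c'.
    have c1 : `|t| @[t --> (0:R)^'] --> `|0:R| by apply: cvg_norm; exact: cvg_within.
    exact: (cvgM c1 cl).
  rewrite normr0 mul0r; apply: cvg_trans; apply: near_eq_cvg; near=> t.
  rewrite /l1norm mulr_sumr; apply: eq_bigr => i _.
  have -> : u t 0 i = t^-1 * q t 0 i by rewrite /u mxE.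
  rewrite normrM normfV mulrA mulfV ?mul1r// normr_eq0.
  near: t; exact: nbhs_dnbhs_neq.
apply/is_deriveP.
have lim1 : \sum_i u t 0 i * g i (c s) @[t --> (0:R)^'] --> \sum_i c' 0 i * g i (c s).
  apply: cvg_big => [|i _]; first exact: add_continuous.
  apply: cvgMr_tmp; exact: cu.
(* The quadratic remainder divided by [t] is [C |u| |q|], where [u] converges and [q] tends to 0. *)
have lim2 : C * (l1norm (u t) * l1norm (q t)) @[t --> (0:R)^'] --> 0.
  have c1 := cvgM cl c0.
  have c2 : C * (l1norm (u t) * l1norm (q t)) @[t --> (0:R)^'] --> C * (l1norm c' * 0).
    by apply: cvgMl_tmp; exact: c1.
  by rewrite !mulr0 in c2.
apply/cvgrPdist_le => e e0.
have e20 : 0 < e / 2 by rewrite divr_gt0.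
have N1 := cvgr_dist_le _ _ lim1 _ e20.
have N2 := cvgr_le _ lim2 _ e20.
have N3 := cvgr_le _ c0 _ ltr01.
near=> t.
have t0 : t != 0 by near: t; exact: nbhs_dnbhs_neq.
have q1 : l1norm (q t) <= 1.
  by near: t; exact: N3.
have -> : c (t *: (1:R) + s) = c s + q t.
  by rewrite /q /GRing.scale/= mulr1 [RHS]addrC subrK.
have E : `|t^-1 *: (F (c s + q t) - F (c s)) - \sum_i u t 0 i * g i (c s)| <=
    C * (l1norm (u t) * l1norm (q t)).
  have -> : \sum_i u t 0 i * g i (c s) = t^-1 * \sum_i q t 0 i * g i (c s).
    by rewrite mulr_sumr; apply: eq_bigr => i _; rewrite /u mxE mulrA.
  rewrite /GRing.scale/= -mulrBr normrM.
  apply: (@le_trans _ _ (`|t^-1| * (C * l1norm (q t) ^+ 2))).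
    by rewrite ler_wpM2l//; exact: CP.
  rewrite mulrCA ler_wpM2l// expr2 mulrA ler_wpM2r ?l1norm_ge0//.
  rewrite /l1norm mulr_sumr; apply: ler_sum => i _.
  by rewrite -normrM le_eqVlt; apply/orP; left; apply/eqP; rewrite /u [in RHS]mxE.
have e1 : `|\sum_i c' 0 i * g i (c s) - \sum_i u t 0 i * g i (c s)| <= e / 2.
  by near: t; exact: N1.
have e2 : C * (l1norm (u t) * l1norm (q t)) <= e / 2.
  by near: t; exact: N2.
rewrite [leRHS]splitr; apply: le_trans (ler_distD (\sum_i u t 0 i * g i (c s)) _ _) _.
by apply: lerD => //; rewrite distrC; exact: le_trans E e2.
Unshelve. all: end_near. Qed.

Lemma has_grad_continuous F g : has_grad F g -> continuous F.
Proof.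
move=> Fg; apply/rV_continuousP => x e e0; have [C C0 CP] := Fg x.
set G := \sum_i `|g i x|.
have G0 : 0 <= G by exact: sumr_ge0.
pose K := (G + C + 1).
have K0 : 0 < K by rewrite /K -addrA ltr_wpDl// ltr_wpDl.
(* Dividing by [n.+1] instead of [n] keeps the bound on the sum of the [n] coordinates strict, and
   covers [n = 0]. *)
pose d := Num.min 1 (e / K) / n.+1%:R.
have d0 : 0 < d by rewrite divr_gt0// lt_min ltr01 divr_gt0.
exists d => // y xy.
have hl : l1norm (y - x) < Num.min 1 (e / K).
  apply: (@le_lt_trans _ _ (\sum_(i < n) d)).
    by apply: ler_sum => i _; rewrite !mxE distrC ltW.
  rewrite sumr_const card_ord -[d *+ n]mulr_natr /d -mulrA.
  rewrite gtr_pMr ?lt_min ?ltr01 ?divr_gt0//.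
  by rewrite mulrC ltr_pdivrMr// mul1r ltr_nat.
move: hl; rewrite lt_min => /andP[h1 h2].
have := CP (y - x) (ltW h1); rewrite [x + _]addrC subrK => Cy.
have hg : `|\sum_i (y - x) 0 i * g i x| <= l1norm (y - x) * G.
  apply: le_trans (ler_norm_sum _ _ _) _; rewrite /G mulr_sumr.
  by apply: ler_sum => i _; rewrite normrM ler_wpM2r// coor_le_l1norm.
have hs : C * l1norm (y - x) ^+ 2 <= C * l1norm (y - x).
  by rewrite ler_wpM2l// expr2 ler_piMr ?l1norm_ge0// ltW.
have hK : l1norm (y - x) * K < e by rewrite -ltr_pdivlMr.
rewrite distrC; apply: le_lt_trans hK.
have -> : F y - F x = (F y - F x - \sum_i (y - x) 0 i * g i x) + \sum_i (y - x) 0 i * g i x by ring.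
apply: le_trans (ler_normD _ _) _.
apply: le_trans (lerD (le_trans Cy hs) hg) _.
have := l1norm_ge0 (y - x); rewrite /K; nra.
Qed.

(** Taylor's formula of order two on the segment from [x] to [x + h], by two applications of the
    mean value theorem. The second derivatives are bounded kernels, so the constant is uniform in
    [x]. *)
Lemma bump_kernel_has_grad r k dk : bump_kernel r k -> is_grad k dk ->
  (forall i, bump_kernel r (dk i)) -> exists2 C, 0 <= C &
  forall x h, `|k (x + h) - k x - \sum_i h 0 i * dk i x| <= C * l1norm h ^+ 2.
Proof.
move=> bk Dk bdk.
have /choice[ddk ddkP] : forall i, exists ddk, (forall j, bump_kernel r (ddk j)) /\ is_grad (dk i) ddk.
  by move=> i; have [ddk b D] := bump_kernel_grad (bdk i); exists ddk.
have /choice[C CP] : forall p : 'I_n * 'I_n, exists C, forall z, `|ddk p.1 p.2 z| <= C.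
  move=> [i j]; have [C _ CP] := bump_kernel_bounded ((ddkP i).1 j).
  by exists C.
have C0 p : 0 <= C p by exact: le_trans (normr_ge0 _) (CP p 0).
pose S := \sum_i \sum_j C (i, j).
exists S; first by apply: sumr_ge0 => i _; exact: sumr_ge0.
move=> x h.
have Dline (t : R) i : is_derive t 1 (fun t : R => (x + t *: h) 0 i) (h 0 i).
  rewrite (_ : (fun t => _) = fun t : R => x 0 i + h 0 i * t); last first.
    by apply/funext => u; rewrite !mxE mulrC.
  apply: is_derive_eq (is_derive_add (is_derive_cst _ _ _) (is_derive_cst_mul _ (is_derive_id _ _))) _.
  by rewrite add0r mulr1.
pose phi (t : R) := k (x + t *: h).
pose phi1 (t : R) := \sum_i h 0 i * dk i (x + t *: h).
pose phi2 (t : R) := \sum_i h 0 i * \sum_j h 0 j * ddk i j (x + t *: h).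
have D1 (t : R) : is_derive t 1 phi (phi1 t) by apply: Dk => i; exact: Dline.
have D2 (t : R) : is_derive t 1 phi1 (phi2 t).
  apply: is_derive_sumr => i; apply: is_derive_cst_mul.
  by apply: (ddkP i).2 => j; exact: Dline.
have [xi xi01 Exi] : exists2 xi, xi \in `]0, 1[%R & phi 1 - phi 0 = phi1 xi * (1 - 0).
  apply: (MVT ltr01 (fun t _ => D1 t)); apply: continuous_subspaceT => t.
  exact: is_derive_continuous (D1 t).
have xi0 : 0 < xi by move: xi01; rewrite in_itv/= => /andP[].
have xi1 : xi < 1 by move: xi01; rewrite in_itv/= => /andP[].
have [eta _ Eeta] : exists2 eta, eta \in `]0, xi[%R & phi1 xi - phi1 0 = phi2 eta * (xi - 0).
  apply: (MVT xi0 (fun t _ => D2 t)); apply: continuous_subspaceT => t.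
  exact: is_derive_continuous (D2 t).
have E0 : phi1 0 = \sum_i h 0 i * dk i x.
  by apply: eq_bigr => i _; rewrite scale0r addr0.
have -> : k (x + h) - k x - \sum_i h 0 i * dk i x = phi2 eta * xi.
  rewrite -E0; have := Exi; rewrite /phi scale1r scale0r addr0 => ->.
  by rewrite subr0 mulr1 Eeta subr0.
rewrite normrM (gtr0_norm xi0); apply: (@le_trans _ _ `|phi2 eta|).
  by rewrite ler_piMr// ltW.
apply: le_trans (ler_norm_sum _ _ _) _; rewrite /S mulr_suml; apply: ler_sum => i _.
rewrite normrM mulr_suml; apply: (@le_trans _ _ (l1norm h * \sum_j (C (i, j) * l1norm h))).
  apply: ler_pM => //; first exact: coor_le_l1norm.
  apply: le_trans (ler_norm_sum _ _ _) _; apply: ler_sum => j _.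
  rewrite normrM mulrC; apply: ler_pM => //; last exact: coor_le_l1norm.
  exact: (CP (i, j)).
by rewrite mulr_sumr; apply: ler_sum => j _; rewrite mulrCA -expr2.
Qed.

End gradients.

(** * Linearity and domination for real integrals *)

Section real_integrals.
Context d (T : measurableType d) {R : realType} (mu : {measure set T -> \bar R}).
Implicit Types f g : T -> R.

Lemma integrableRD f g : mu.-integrable setT (EFin \o f) ->
  mu.-integrable setT (EFin \o g) -> mu.-integrable setT (EFin \o (fun x => f x + g x)).
Proof. by move=> fi gi; exact: (integrableD measurableT fi gi). Qed.

Lemma integrableRB f g : mu.-integrable setT (EFin \o f) ->
  mu.-integrable setT (EFin \o g) -> mu.-integrable setT (EFin \o (fun x => f x - g x)).
Proof. by move=> fi gi; exact: (integrableB measurableT fi gi). Qed.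

Lemma integrableRZ (c : R) f : mu.-integrable setT (EFin \o f) ->
  mu.-integrable setT (EFin \o (fun x => c * f x)).
Proof. by move=> fi; exact: (integrableZl measurableT c fi). Qed.

Lemma integrableR_sum n (f : 'I_n -> T -> R) :
  (forall i, mu.-integrable setT (EFin \o f i)) ->
  mu.-integrable setT (EFin \o (fun x => \sum_i f i x)).
Proof.
move=> fi; apply: (eq_integrable measurableT (fun x => \sum_i (f i x)%:E)%E).
  by move=> x _; rewrite sumEFin.
by apply: integrable_sum => // i _; exact: fi.
Qed.

Lemma le_integrableR f g : measurable_fun setT f -> (forall x, `|f x| <= g x) ->
  mu.-integrable setT (EFin \o g) -> mu.-integrable setT (EFin \o f).
Proof.
move=> mf fg; apply: le_integrable => //; first exact/measurable_EFinP.
move=> x _; rewrite lee_fin; apply: le_trans (fg x) _; exact: ler_norm.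
Qed.

Lemma Rintegral_sum n (f : 'I_n -> T -> R) :
  (forall i, mu.-integrable setT (EFin \o f i)) ->
  \int[mu]_x (\sum_i f i x) = \sum_i \int[mu]_x f i x.
Proof.
elim: n f => [|n IH] f fi.
  under eq_Rintegral do rewrite big_ord0.
  by rewrite big_ord0 Rintegral_cst// mul0r.
under eq_Rintegral do rewrite big_ord_recl.
rewrite RintegralD//; last by apply: integrableR_sum.
by rewrite big_ord_recl IH.
Qed.

Lemma integrableR_indic (A : set T) : measurable A -> (mu A < +oo)%E ->
  mu.-integrable setT (EFin \o \1_A).
Proof.
move=> mA Aoo; apply/integrableP; split; first exact/measurable_EFinP.
rewrite (eq_integral (fun x => (\1_A x)%:E)); last first.
  by move=> t _; rewrite gee0_abs// lee_fin.
by rewrite integral_indic// setIT.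
Qed.

Lemma integral_Rintegral f : mu.-integrable setT (EFin \o f) ->
  (\int[mu]_x (f x)%:E = (\int[mu]_x f x)%:E)%E.
Proof. by move=> fi; rewrite /Rintegral fineK//; exact: integrable_fin_num. Qed.

Lemma ge0_integrableR f : measurable_fun setT f -> (forall x, 0 <= f x) ->
  (\int[mu]_x (f x)%:E < +oo)%E -> mu.-integrable setT (EFin \o f).
Proof.
move=> mf f0 foo; apply/integrableP; split; first exact/measurable_EFinP.
by under eq_integral => x _ do rewrite /= ger0_norm//.
Qed.

End real_integrals.

(** * Mollifications of L^2 functions and their gradients *)

Section mollify.
Context {R : realType} {n : nat}.
Local Notation mu := (lebesgue_rV R n).
Implicit Types (f h k : 'rV[R]_n -> R) (x y z : 'rV[R]_n).

Definition sqint f := measurable_fun setT f /\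
  mu.-integrable setT (EFin \o (fun x => f x ^+ 2)).

Definition boxfun (M C : R) h := [/\ measurable_fun setT h, forall z, `|h z| <= C
  & forall z, h z != 0 -> rV_box n M z].

Lemma boxfun_integrable M C h : boxfun M C h -> mu.-integrable setT (EFin \o h).
Proof.
move=> [mh hC hM].
have iB : mu.-integrable setT (EFin \o (fun x => C * \1_(rV_box n M) x)).
  apply: integrableRZ; apply: integrableR_indic; first exact: measurable_rV_box.
  exact: lebesgue_rV_box_lty.
apply: le_integrableR mh _ iB => x; have [->|hx] := eqVneq (h x) 0.
  rewrite normr0 mulr_ge0//; exact: le_trans (normr_ge0 _) (hC x).
by rewrite indicE mem_set ?mulr1//; exact: hM.
Qed.

Lemma boxfun_sqr M C h : boxfun M C h -> boxfun M (C ^+ 2) (fun x => h x ^+ 2).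
Proof.
move=> [mh hC hM]; split.
- exact: measurable_funX.
- move=> z; rewrite normrX; apply: lerXn2r; rewrite ?nnegrE//.
  exact: le_trans (normr_ge0 _) (hC z).
- by move=> z; rewrite sqrf_eq0; exact: hM.
Qed.

Lemma boxfun_sqint M C h : boxfun M C h -> sqint h.
Proof. by move=> bh; split; [case: bh|apply: boxfun_integrable (boxfun_sqr bh)]. Qed.

Lemma measurable_subr x : measurable_fun [set: 'rV[R]_n] (fun y => y - x).
Proof.
have := measurable_affine_rV 1 (- x).
by under [X in measurable_fun _ X -> _]eq_fun do rewrite scale1r.
Qed.

Lemma boxfun_shift M C h x : boxfun M C h ->
  boxfun (M + l1norm x) C (fun y => h (y - x)).
Proof.
move=> [mh hC hM]; split => //.
  by apply: (measurableT_comp mh); exact: measurable_subr.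
move=> y /hM hy i; rewrite -(subrK x y) mxE; apply: le_trans (ler_normD _ _) _.
by apply: lerD; [exact: hy|exact: coor_le_l1norm].
Qed.

Lemma sqint_mul f h : sqint f -> sqint h ->
  mu.-integrable setT (EFin \o (fun x => f x * h x)).
Proof.
move=> [mf fi] [mh hi].
apply: le_integrableR (integrableRD fi hi); first exact: measurable_funM.
move=> x; rewrite normrM.
rewrite -(real_normK (num_real (f x))) -(real_normK (num_real (h x))).
have := normr_ge0 (f x); have := normr_ge0 (h x); nra.
Qed.

(** Pointwise [|ab| <= a^2 + b^2]. Both integrals on the right are translation invariant, so
    mollifications are bounded uniformly in [x]. *)
Lemma sqint_mul_le f h : sqint f -> sqint h ->
  `|\int[mu]_x (f x * h x)| <= \int[mu]_x (f x ^+ 2) + \int[mu]_x (h x ^+ 2).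
Proof.
move=> sf sh; have ifh := sqint_mul sf sh.
apply: le_trans (le_normr_Rintegral measurableT ifh) _.
rewrite -RintegralD//; [|exact: sf.2|exact: sh.2].
apply: le_Rintegral => //.
- exact: integrable_norm ifh.
- exact: integrableRD sf.2 sh.2.
move=> x _; rewrite normrM.
rewrite -(real_normK (num_real (f x))) -(real_normK (num_real (h x))).
have := normr_ge0 (f x); have := normr_ge0 (h x); nra.
Qed.

Lemma ge0_integral_shift (F : 'rV[R]_n -> \bar R) x :
  measurable_fun setT F -> (forall z, 0 <= F z)%E ->
  (\int[mu]_y F (y - x)%R = \int[mu]_y F y)%E.
Proof.
move=> mF F0; have := ge0_integral_affine_rV (- x) ltr01 mF F0.
rewrite expr1n invr1 mul1e => <-.
by apply: eq_integral => y _; rewrite scale1r.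
Qed.

(** A correlation: the kernel is taken at [y - x], so that it is a test function of [y] translated
    by [x]. Each derivative in [x] brings a minus sign. *)
Definition mollify k f x : R := \int[mu]_y (f y * k (y - x)).

Lemma mollify_integrable M C f h x : sqint f -> boxfun M C h ->
  mu.-integrable setT (EFin \o (fun y => f y * h (y - x))).
Proof.
move=> sf bh; apply: sqint_mul sf _; apply: boxfun_sqint; exact: boxfun_shift bh.
Qed.

Lemma mollify_bounded M C f h : sqint f -> boxfun M C h ->
  exists2 B, 0 <= B & forall x, `|mollify h f x| <= B.
Proof.
move=> sf bh; exists (\int[mu]_x (f x ^+ 2) + \int[mu]_x (h x ^+ 2)).
  by rewrite addr_ge0//; apply: Rintegral_ge0 => x _; exact: sqr_ge0.
move=> x; apply: le_trans (sqint_mul_le sf (boxfun_sqint (boxfun_shift x bh))) _.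
rewrite lerD2l /Rintegral le_eqVlt; apply/orP; left; apply/eqP; congr fine.
apply: (ge0_integral_shift (F := fun y => (h y ^+ 2)%:E)).
  by apply/measurable_EFinP/measurable_funX; case: bh.
by move=> z; rewrite lee_fin sqr_ge0.
Qed.

Lemma bump_kernel_boxfun r k : bump_kernel r k ->
  exists2 C, 0 <= C & boxfun (`|r| + 1) C k.
Proof.
move=> bk; have [C C0 CP] := bump_kernel_bounded bk; exists C => //; split => //.
  exact: measurable_bump_kernel bk.
move=> z; exact: bump_kernel_box bk.
Qed.

(** Differentiation under the integral sign: the uniform Taylor remainder of the kernel is
    multiplied by [|f|] and integrated. *)
Lemma mollify_has_grad r k dk f : sqint f -> bump_kernel r k -> is_grad k dk ->
  (forall i, bump_kernel r (dk i)) ->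
  has_grad (mollify k f) (fun i x => - mollify (dk i) f x).
Proof.
move=> sf bk Dk bdk x.
have [C0 C00 CP] := bump_kernel_has_grad bk Dk bdk.
have [Ck _ bok] := bump_kernel_boxfun bk.
set M := `|r| + 1 in bok.
(* For [l1norm h <= 1] every kernel in the remainder vanishes once [y - x] leaves the box of
   half-side [M + 1]. Localizing there matters because [f] is integrable only on bounded sets. *)
have b1 : boxfun (M + 1) 1 (\1_(rV_box n (M + 1))).
  split=> [|z|z]; first by apply: measurable_indic; exact: measurable_rV_box.
    by rewrite indicE; have [_|_] := boolP (z \in rV_box n (M + 1)); rewrite ?normr1// normr0.
  by rewrite indicE; have [/set_mem//|_] := boolP (z \in rV_box n (M + 1)); rewrite eqxx.
pose B := \int[mu]_y (`|f y| * \1_(rV_box n (M + 1)) (y - x)).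
have sfa : sqint (fun y => `|f y|).
  split; first by apply: measurableT_comp => //; case: sf.
  by under [X in _.-integrable _ X]eq_fun => y do rewrite /= real_normK ?num_real//; case: sf.
have iB := mollify_integrable x sfa b1.
exists (C0 * B).
  rewrite mulr_ge0//; apply: Rintegral_ge0 => y _; rewrite mulr_ge0// indicE ler0n//.
move=> h h1.
have ik := mollify_integrable x sf bok.
have idk i : mu.-integrable setT (EFin \o (fun y => f y * dk i (y - x))).
  have [C _ b] := bump_kernel_boxfun (bdk i); exact: mollify_integrable b.
have ikh := mollify_integrable (x + h) sf bok.
pose rem y := f y * (k (y - (x + h)) - k (y - x) + \sum_i h 0 i * dk i (y - x)).
have isum : mu.-integrable setT (EFin \o (fun y => \sum_i h 0 i * (f y * dk i (y - x)))).
  by apply: integrableR_sum => i; exact: integrableRZ.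
have remE : rem = fun y => f y * k (y - (x + h)) - f y * k (y - x) +
    \sum_i h 0 i * (f y * dk i (y - x)).
  apply/funext => y; rewrite /rem mulrDr mulrBr; congr (_ + _).
  by rewrite mulr_sumr; apply: eq_bigr => i _; rewrite mulrCA.
have irem : mu.-integrable setT (EFin \o rem).
  by rewrite remE; apply: integrableRD => //; exact: integrableRB.
have -> : mollify k f (x + h) - mollify k f x - \sum_i h 0 i * - mollify (dk i) f x =
    \int[mu]_y rem y.
  rewrite remE RintegralD//; last exact: integrableRB.
  rewrite RintegralB//; congr (_ + _).
  rewrite -sumrN.
  transitivity (\sum_i \int[mu]_y (h 0 i * (f y * dk i (y - x)))).
    by apply: eq_bigr => i _; rewrite RintegralZl// mulrN opprK.
  by rewrite Rintegral_sum// => i; exact: integrableRZ.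
apply: le_trans (le_normr_Rintegral measurableT irem) _.
rewrite mulrAC -RintegralZl//.
apply: le_Rintegral => //.
- exact: integrable_norm.
- exact: integrableRZ.
move=> y _; rewrite /rem normrM mulrCA ler_wpM2l//.
rewrite indicE; have [ybox|] := boolP (y - x \in rV_box n (M + 1)).
  rewrite mulr1; have := CP (y - x) (- h).
  rewrite (_ : l1norm (- h) = l1norm h); last first.
    by apply: eq_bigr => i _; rewrite mxE normrN.
  rewrite opprD addrA (_ : \sum_i (- h) 0 i * dk i (y - x) = - \sum_i h 0 i * dk i (y - x)) ?opprK//.
  by rewrite -sumrN; apply: eq_bigr => i _; rewrite mxE mulNr.
rewrite notin_setE => ybox; rewrite mulr0 normr_le0.
have far j : (forall z, bump_kernel r j -> (forall i, `|(y - x) 0 i - z 0 i| <= 1) -> j z = 0).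
  move=> z bj zy; apply/eqP/negPn/negP => /(bump_kernel_box bj) zb; apply: ybox => i.
  rewrite -(subrK (z 0 i) ((y - x) 0 i)); apply: le_trans (ler_normD _ _) _.
  by rewrite addrC lerD.
rewrite (far k)// ?subrr ?(far k _ bk)//; last 2 first.
- by move=> i; rewrite subrr normr0.
- move=> i; rewrite !mxE opprD opprK.
  rewrite (_ : _ + _ = h 0 i); last by ring.
  exact: le_trans (coor_le_l1norm h i) h1.
rewrite subr0 add0r big1// => i _; rewrite (far (dk i) _ (bdk i)) ?mulr0//.
by move=> j; rewrite subrr normr0.
Qed.

End mollify.

(** * The normalized mollifier and the mean square oscillation *)

Section mollifier.
Context {R : realType} {n : nat}.
Local Notation mu := (lebesgue_rV R n).
Implicit Types (f g h : 'rV[R]_n -> R) (x y z : 'rV[R]_n) (r : R).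

Definition bump0 (r : R) z : R := bump_poly 1 (r - sqn z).

Definition mollifier (r : R) z : R := (\int[mu]_z bump0 r z)^-1 * bump0 r z.

Lemma bump_kernel_bump0 r : bump_kernel r (bump0 r).
Proof. exact: bump_kernel_base. Qed.

Lemma bump_kernel_mollifier r : bump_kernel r (mollifier r).
Proof. by apply: bump_kernel_scale; exact: bump_kernel_bump0. Qed.

Lemma bump0_ge0 r z : 0 <= bump0 r z.
Proof.
rewrite /bump0 /bump_poly; case: ifPn => // _.
by rewrite hornerC mul1r expR_ge0.
Qed.

Lemma bump0N r z : bump0 r (- z) = bump0 r z.
Proof.
rewrite /bump0 (_ : sqn (- z) = sqn z)//.
by apply: eq_bigr => i _; rewrite mxE sqrrN.
Qed.

Lemma rV_box_gt0 (M : R) : 0 < M -> (0 < mu (rV_box n M))%E.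
Proof.
move=> M0; rewrite (_ : rV_box n M = [set x | forall i, `[-M, M]%classic (x 0 i)]); last first.
  by apply/seteqP; split => x /= h i; have := h i; rewrite in_itv/= ler_norml.
rewrite (lebesgue_rV_rect (A := fun=> `[-M, M]%classic))//.
set I := `[-M, M]%classic.
elim/big_ind : _ => [|x y x0 y0|i _]; first by rewrite lte01.
- exact: mule_gt0.
- by rewrite /I lebesgue_measure_itv/= lte_fin gtrN// -EFinB lte_fin opprK addr_gt0.
Qed.

Lemma bump0_integral_gt0 r : 0 < r -> 0 < \int[mu]_z bump0 r z.
Proof.
move=> r0; have [C _ bC] := bump_kernel_boxfun (bump_kernel_bump0 r).
(* [d <= 1] gives [d^2 <= d], and [n d <= r / 2]; so the box of half-side [d] lies where
   [|z|^2 <= r / 2], and there the bump is at least [c]. *)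
pose d := Num.min 1 (r / (2 * n.+1%:R)).
have d0 : 0 < d by rewrite lt_min ltr01/= divr_gt0// mulr_gt0.
pose c := expR (- (r / 2)^-1).
have icd : mu.-integrable setT (EFin \o (fun z => c * \1_(rV_box n d) z)).
  apply: integrableRZ; apply: integrableR_indic; first exact: measurable_rV_box.
  exact: lebesgue_rV_box_lty.
apply: (@lt_le_trans _ _ (\int[mu]_z (c * \1_(rV_box n d) z))).
  rewrite RintegralZl//; last first.
    by apply: integrableR_indic; [exact: measurable_rV_box|exact: lebesgue_rV_box_lty].
  rewrite mulr_gt0 ?expR_gt0// /Rintegral integral_indic ?setIT//; last exact: measurable_rV_box.
  by rewrite fine_gt0// rV_box_gt0//= lebesgue_rV_box_lty.
apply: le_Rintegral => //; first exact: boxfun_integrable bC.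
move=> z _; rewrite indicE; have [/set_mem zd|_] := boolP (z \in rV_box n d); last first.
  by rewrite mulr0 bump0_ge0.
have zr : sqn z <= r / 2.
  apply: (@le_trans _ _ (\sum_(i < n) d)).
    apply: ler_sum => i _; rewrite -real_normK ?num_real//.
    apply: (@le_trans _ _ (d ^+ 2)); first by apply: lerXn2r; rewrite ?nnegrE ?(ltW d0)//; exact: zd.
    by rewrite expr2 ler_piMr ?(ltW d0)// /d ge_min lexx.
  rewrite sumr_const card_ord -[d *+ n]mulr_natr.
  apply: (@le_trans _ _ (r / (2 * n.+1%:R) * n%:R)).
    by rewrite ler_wpM2r// /d ge_min lexx orbT.
  rewrite invfM mulrA -mulrA ler_piMr ?divr_ge0 ?(ltW r0)//.
  by rewrite mulrC ler_pdivrMr// mul1r ler_nat.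
have t0 : 0 < r - sqn z.
  by rewrite subr_gt0; apply: le_lt_trans zr _; rewrite ltr_pdivrMr// ltr_pMr// ltrDl.
rewrite mulr1 /bump0 /bump_poly t0 hornerC mul1r ler_expR lerN2.
rewrite lef_pV2 ?posrE ?divr_gt0//.
move: zr; lra.
Qed.

Lemma mollifier_ge0 r z : 0 < r -> 0 <= mollifier r z.
Proof.
by move=> r0; rewrite mulr_ge0 ?bump0_ge0// invr_ge0 ltW// bump0_integral_gt0.
Qed.

Lemma mollifierN r z : mollifier r (- z) = mollifier r z.
Proof. by rewrite /mollifier bump0N. Qed.

Lemma measurable_mollifier r : measurable_fun setT (mollifier r).
Proof. exact: measurable_bump_kernel (bump_kernel_mollifier r). Qed.

Lemma integral_mollifier r x : 0 < r -> (\int[mu]_y (mollifier r (y - x))%:E = 1)%E.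
Proof.
move=> r0; rewrite (ge0_integral_shift (F := fun y => (mollifier r y)%:E)); last 2 first.
- by apply/measurable_EFinP; exact: measurable_mollifier.
- by move=> z; rewrite lee_fin mollifier_ge0.
have [C _ bC] := bump_kernel_boxfun (bump_kernel_bump0 r).
have [C' _ bC'] := bump_kernel_boxfun (bump_kernel_mollifier r).
rewrite integral_Rintegral; last exact: boxfun_integrable bC'.
rewrite RintegralZl//; last exact: boxfun_integrable bC.
by rewrite mulVf// gt_eqF// bump0_integral_gt0.
Qed.

Lemma integral_mollifier_l r y : 0 < r -> (\int[mu]_x (mollifier r (y - x))%:E = 1)%E.
Proof.
move=> r0; rewrite -(integral_mollifier y r0); apply: eq_integral => x _.
by rewrite -mollifierN opprB.
Qed.

(** Jensen's inequality for the probability density [mollifier r (y - x)]: the integral of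
    [(f y - a)^2] against it is a quadratic function of [a] with minimum at the mean [m], and its
    value at [f x] exceeds the minimum by [(m - f x)^2]. *)
Lemma mollify_mollifier_sqr r f x : 0 < r -> sqint f ->
  (((mollify (mollifier r) f x - f x) ^+ 2)%:E <=
  \int[mu]_y ((f y - f x) ^+ 2 * mollifier r (y - x))%:E)%E.
Proof.
move=> r0 sf; set k := mollifier r; set m := mollify k f x.
have [C C0 bC] := bump_kernel_boxfun (bump_kernel_mollifier r).
have ik : mu.-integrable setT (EFin \o (fun y => k (y - x))).
  exact: boxfun_integrable (boxfun_shift x bC).
have ifk := mollify_integrable x sf bC.
have mk : measurable_fun setT (fun y => k (y - x)).
  by apply: (measurableT_comp (measurable_mollifier r)); exact: measurable_subr.
have if2k : mu.-integrable setT (EFin \o (fun y => f y ^+ 2 * k (y - x))).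
  apply: le_integrableR (integrableRZ C sf.2).
    by apply: measurable_funM => //; apply: measurable_funX; case: sf.
  move=> y; rewrite normrM mulrC [`|f y ^+ 2|]ger0_norm ?sqr_ge0// ler_wpM2r ?sqr_ge0//.
  by case: bC.
have I1 : \int[mu]_y k (y - x) = 1.
  by rewrite /Rintegral integral_mollifier.
have E a : (\int[mu]_y ((f y - a) ^+ 2 * k (y - x))) =
    \int[mu]_y (f y ^+ 2 * k (y - x)) - 2 * a * m + a ^+ 2.
  rewrite (_ : (fun y => _) = fun y => (f y ^+ 2 * k (y - x) - 2 * a * (f y * k (y - x))) + a ^+ 2 * k (y - x)); last first.
    by apply/funext => y; ring.
  rewrite RintegralD//; [|exact: integrableRB if2k (integrableRZ _ ifk)|exact: integrableRZ].
  rewrite RintegralB//; [|exact: integrableRZ].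
  by rewrite (RintegralZl _ measurableT ifk) (RintegralZl _ measurableT ik) I1 mulr1.
have iE a : mu.-integrable setT (EFin \o (fun y => (f y - a) ^+ 2 * k (y - x))).
  rewrite (_ : (fun y => _) = fun y => (f y ^+ 2 * k (y - x) - 2 * a * (f y * k (y - x))) + a ^+ 2 * k (y - x)); last first.
    by apply/funext => y; ring.
  by apply: integrableRD; [apply: integrableRB => //|]; exact: integrableRZ.
have := Rintegral_ge0 mu (D := setT) (f := fun y => (f y - m) ^+ 2 * k (y - x)).
rewrite E integral_Rintegral// E lee_fin => H.
have {}H := H (fun y _ => mulr_ge0 (sqr_ge0 _) (mollifier_ge0 _ r0)).
rewrite -subr_ge0; apply: le_trans H _; rewrite le_eqVlt; apply/orP; left; apply/eqP; ring.
Qed.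

(** Mean square oscillation at scale [r]. It dominates the squared L^2 distance from [f] to its
    mollification, and it depends on the differences [f y - f x] only, so pointwise bounds on
    differences carry over. *)
Definition osc r f : \bar R :=
  (\int[mu]_x \int[mu]_y ((f y - f x) ^+ 2 * mollifier r (y - x))%:E)%E.

Lemma measurable_rV_sub : measurable_fun setT
  (fun p : 'rV[R]_n * 'rV[R]_n => p.2 - p.1).
Proof.
apply: measurable_fun_rVP => i.
rewrite (_ : _ \o _ = fun p => rV_coor i p.2 - rV_coor i p.1); last first.
  by apply/funext => p; rewrite /rV_coor/= !mxE.
apply: measurable_funB; (apply: measurableT_comp; first exact: measurable_rV_coor).
- exact: measurable_snd.
- exact: measurable_fst.
Qed.

Lemma measurable_osc2 r f : measurable_fun setT f -> measurable_fun setT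
  (fun p : 'rV[R]_n * 'rV[R]_n => ((f p.2 - f p.1) ^+ 2 * mollifier r (p.2 - p.1))%:E).
Proof.
move=> mf; apply/measurable_EFinP; apply: measurable_funM.
  apply: measurable_funX; apply: measurable_funB.
    exact: (measurableT_comp mf measurable_snd).
  exact: (measurableT_comp mf measurable_fst).
exact: (measurableT_comp (measurable_mollifier r) measurable_rV_sub).
Qed.

Lemma measurable_osc1 r f : 0 < r -> measurable_fun setT f -> measurable_fun setT
  (fun x => \int[mu]_y ((f y - f x) ^+ 2 * mollifier r (y - x))%:E)%E.
Proof.
move=> r0 mf.
apply: (measurable_fun_fubini_tonelli_F (fun p : 'rV[R]_n * 'rV[R]_n =>
  ((f p.2 - f p.1) ^+ 2 * mollifier r (p.2 - p.1))%:E)).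
  exact: measurable_osc2.
by move=> p; rewrite lee_fin mulr_ge0 ?sqr_ge0 ?mollifier_ge0.
Qed.

Lemma measurable_osc0 r f x : measurable_fun setT f ->
  measurable_fun setT (fun y => ((f y - f x) ^+ 2 * mollifier r (y - x))%:E).
Proof.
move=> mf; apply/measurable_EFinP; apply: measurable_funM.
  by apply: measurable_funX; exact: measurable_funB.
by apply: (measurableT_comp (measurable_mollifier r)); exact: measurable_subr.
Qed.

Lemma osc_integrand_ge0 r f x y : 0 < r -> (0 <= ((f y - f x) ^+ 2 * mollifier r (y - x))%:E)%E.
Proof. by move=> r0; rewrite lee_fin mulr_ge0 ?sqr_ge0 ?mollifier_ge0. Qed.

Lemma osc_le r f g h (c : R) : 0 < r -> 0 <= c -> measurable_fun setT f ->
  measurable_fun setT g -> measurable_fun setT h ->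
  (forall x y, (h y - h x) ^+ 2 <= c * ((f y - f x) ^+ 2 + (g y - g x) ^+ 2)) ->
  (osc r h <= c%:E * (osc r f + osc r g))%E.
Proof.
move=> r0 c0 mf mg mh H; rewrite /osc.
have I0 (u : 'rV[R]_n -> R) x : (0 <= \int[mu]_y ((u y - u x) ^+ 2 * mollifier r (y - x))%:E)%E.
  by apply: integral_ge0 => y _; exact: osc_integrand_ge0.
rewrite -ge0_integralD//; try exact: measurable_osc1.
rewrite -ge0_integralZl//; last 2 first.
- by apply: emeasurable_funD; exact: measurable_osc1.
- by move=> x _; rewrite adde_ge0.
apply: ge0_le_integral => //.
- exact: measurable_osc1.
- by apply: measurable_funeM; apply: emeasurable_funD; exact: measurable_osc1.
move=> x _.
rewrite -ge0_integralD//; last 4 first.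
- by move=> y _; exact: osc_integrand_ge0.
- exact: measurable_osc0.
- by move=> y _; exact: osc_integrand_ge0.
- exact: measurable_osc0.
rewrite -ge0_integralZl//; last 2 first.
- by apply: emeasurable_funD; exact: measurable_osc0.
- by move=> y _; rewrite adde_ge0 ?osc_integrand_ge0.
apply: ge0_le_integral => //.
- by move=> y _; exact: osc_integrand_ge0.
- exact: measurable_osc0.
- by apply: measurable_funeM; apply: emeasurable_funD; exact: measurable_osc0.
move=> y _; rewrite -EFinD -EFinM lee_fin -mulrDl [leRHS]mulrA ler_wpM2r ?mollifier_ge0//.
Qed.

(** Use [(a - b)^2 <= 2 (a^2 + b^2)]. The kernel has mass 1 in each of its two variables, so each of
    the two terms integrates to the integral of [f^2]. *)
Lemma osc_le_sqr r f : 0 < r -> measurable_fun setT f ->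
  (osc r f <= 4%:E * \int[mu]_x (f x ^+ 2)%:E)%E.
Proof.
move=> r0 mf.
have mf2 : measurable_fun setT (fun x => (f x ^+ 2)%:E).
  by apply/measurable_EFinP; exact: measurable_funX.
have mk x : measurable_fun setT (fun y => (mollifier r (y - x))%:E).
  apply/measurable_EFinP; apply: (measurableT_comp (measurable_mollifier r)); exact: measurable_subr.
have k0 x y : (0 <= (mollifier r (y - x))%:E)%E by rewrite lee_fin mollifier_ge0.
have f0 x : (0 <= (f x ^+ 2)%:E)%E by rewrite lee_fin sqr_ge0.
pose A x := (\int[mu]_y ((f x ^+ 2)%:E * (mollifier r (y - x))%:E))%E.
pose B x := (\int[mu]_y ((f y ^+ 2)%:E * (mollifier r (y - x))%:E))%E.
have AE x : A x = (f x ^+ 2)%:E.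
  by rewrite /A ge0_integralZl// integral_mollifier// mule1.
have mA : measurable_fun setT A.
  by rewrite (_ : A = fun x => (f x ^+ 2)%:E)//; apply/funext => x; rewrite AE.
have mp : measurable_fun setT (fun p : 'rV[R]_n * 'rV[R]_n =>
    ((f p.2 ^+ 2)%:E * (mollifier r (p.2 - p.1))%:E)%E).
  apply: emeasurable_funM; first by apply: (measurableT_comp mf2); exact: measurable_snd.
  apply/measurable_EFinP; exact: (measurableT_comp (measurable_mollifier r) measurable_rV_sub).
have mB : measurable_fun setT B.
  apply: (measurable_fun_fubini_tonelli_F _ mp) => p; by rewrite mule_ge0.
have BE : (\int[mu]_x B x = \int[mu]_x (f x ^+ 2)%:E)%E.
  rewrite /B (fubini_tonelli (fun p : 'rV[R]_n * 'rV[R]_n =>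
    ((f p.2 ^+ 2)%:E * (mollifier r (p.2 - p.1))%:E)%E))//=; last by move=> p; rewrite mule_ge0.
  apply: eq_integral => y _; rewrite ge0_integralZl//.
    by rewrite integral_mollifier_l// mule1.
  apply/measurable_EFinP; rewrite (_ : (fun x => _) = fun x => mollifier r (x - y)); last first.
    by apply/funext => x; rewrite -mollifierN opprB.
  by apply: (measurableT_comp (measurable_mollifier r)); exact: measurable_subr.
apply: (@le_trans _ _ (\int[mu]_x (2%:E * (A x + B x)))%E).
  apply: ge0_le_integral => //.
  - by move=> x _; apply: integral_ge0 => y _; exact: osc_integrand_ge0.
  - exact: measurable_osc1.
  - by apply: measurable_funeM; exact: emeasurable_funD.
  move=> x _; rewrite /A /B -ge0_integralD//; last 4 first.
  - by move=> y _; rewrite mule_ge0.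
  - by apply: emeasurable_funM.
  - by move=> y _; rewrite mule_ge0.
  - by apply: emeasurable_funM.
  rewrite -ge0_integralZl//; last 2 first.
  - by apply: emeasurable_funD; apply: emeasurable_funM.
  - by move=> y _; rewrite adde_ge0// mule_ge0.
  apply: ge0_le_integral => //.
  - by move=> y _; exact: osc_integrand_ge0.
  - exact: measurable_osc0.
  - by apply: measurable_funeM; apply: emeasurable_funD; apply: emeasurable_funM.
  move=> y _; rewrite /= -!EFinM lee_fin -mulrDl [leRHS]mulrA ler_wpM2r ?mollifier_ge0//.
  have := sqr_ge0 (f x + f y); nra.
have A0 x : (0 <= A x)%E by rewrite AE.
have B0 x : (0 <= B x)%E by apply: integral_ge0 => y _; rewrite mule_ge0.
rewrite ge0_integralZl//; [|exact: emeasurable_funD|by move=> x _; rewrite adde_ge0].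
rewrite ge0_integralD//.
rewrite BE; under eq_integral do rewrite AE.
rewrite -[X in (_ * (X + X))%E]mul1e -ge0_muleDl// muleA -EFinD -EFinM.
by rewrite (_ : 2 * (1 + 1) = 4 :> R)//; ring.
Qed.

End mollifier.

(** * Functions whose oscillation vanishes at small scales *)

Section vanishing_oscillation.
Context {R : realType} {n : nat}.
Local Notation mu := (lebesgue_rV R n).
Implicit Types (f g h : 'rV[R]_n -> R) (x y z : 'rV[R]_n).

(** The squared support radius of the j-th mollifier. *)
Definition inv1 (j : nat) : R := j.+1%:R^-1.

Lemma inv1_gt0 j : 0 < inv1 j.
Proof. by rewrite invr_gt0 ltr0n. Qed.

(** This takes the place of continuity of translations in L^2. The class contains indicators of
    cells and is stable under linear combinations and dominated limits, so a monotone class argument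
    reaches all of L^2. *)
Definition vanishing f := measurable_fun setT f /\
  forall e : R, 0 < e -> exists N, forall j, (N <= j)%N -> (osc (inv1 j) f <= e%:E)%E.

Lemma vanishing_comb f g h c : 0 <= c -> vanishing f -> vanishing g ->
  measurable_fun setT h ->
  (forall x y, (h y - h x) ^+ 2 <= c * ((f y - f x) ^+ 2 + (g y - g x) ^+ 2)) ->
  vanishing h.
Proof.
move=> c0 [mf Vf] [mg Vg] mh H; split => // e e0.
have c1 : 0 < c + 1 by rewrite ltr_wpDl.
pose e' := e / (2 * (c + 1)).
have e'0 : 0 < e' by rewrite divr_gt0// mulr_gt0.
have [N1 P1] := Vf _ e'0; have [N2 P2] := Vg _ e'0.
exists (maxn N1 N2) => j; rewrite geq_max => /andP[/P1 h1 /P2 h2].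
apply: le_trans (osc_le (inv1_gt0 j) c0 mf mg mh H) _.
apply: (@le_trans _ _ (c%:E * (e'%:E + e'%:E))%E).
  by apply: lee_wpmul2l; [rewrite lee_fin|exact: leeD].
rewrite -EFinD -EFinM lee_fin.
have E : e' * (2 * (c + 1)) = e by rewrite /e' mulfVK// gt_eqF// mulr_gt0.
rewrite -[leRHS]E; nra.
Qed.

Lemma vanishing_approx f : measurable_fun setT f ->
  (forall e : R, 0 < e -> exists2 g, vanishing g &
     (\int[mu]_x ((f x - g x) ^+ 2)%:E <= e%:E)%E) ->
  vanishing f.
Proof.
move=> mf H; split => // e e0.
(* The shares add up as [2 (e/4 + 4 e/16) = e], the factor 4 coming from [osc_le_sqr]. *)
have [g [mg Vg] fg] := H (e / 16) (divr_gt0 e0 (ltr0Sn _ 15)).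
have [N P] := Vg (e / 4) (divr_gt0 e0 (ltr0Sn _ 3)).
exists N => j /P Pj.
have mfg : measurable_fun setT (fun x => f x - g x) by exact: measurable_funB.
have c2 : (0 : R) <= 2 by [].
apply: le_trans (osc_le (inv1_gt0 j) c2 mg mfg mf _) _.
  move=> x y; have := sqr_ge0 ((g y - g x) - ((f y - g y) - (f x - g x))); nra.
have := osc_le_sqr (inv1_gt0 j) mfg => h.
apply: (@le_trans _ _ (2%:E * ((e / 4)%:E + 4%:E * (e / 16)%:E))%E).
  apply: lee_wpmul2l => //; apply: leeD => //.
  by apply: le_trans h _; exact: lee_wpmul2l.
by rewrite -!EFinM lee_fin; lra.
Qed.

Lemma vanishing_dominated f (g : nat -> 'rV[R]_n -> R) G :
  (forall k, vanishing (g k)) -> (forall x, g k x @[k --> \oo] --> f x) ->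
  sqint G -> (forall k x, `|g k x| <= G x) -> vanishing f.
Proof.
move=> Vg gf [mG iG] gG.
have mg k : measurable_fun setT (g k) by case: (Vg k).
have mf : measurable_fun setT f by apply: (@measurable_fun_cvg _ _ _ _ g) => // x _.
have fG x : `|f x| <= G x.
  by apply: (cvgr_to_le (cvg_norm (gf x))); exact: nearW.
apply: vanishing_approx => // e e0.
have i4G : mu.-integrable setT (EFin \o (fun x => 4 * G x ^+ 2)) by exact: integrableRZ.
have [] := @dominated_convergence _ _ _ mu _ measurableT
  (fun k x => ((f x - g k x) ^+ 2)%:E) (cst 0%E) (fun x => (4 * G x ^+ 2)%:E).
- by move=> k; apply/measurable_EFinP; apply: measurable_funX; exact: measurable_funB.
- exact: measurable_cst.
- apply: aeW => x _; apply: cvg_EFin; first exact: nearW.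
  have h1 : f x - g k x @[k --> \oo] --> 0.
    apply/cvgrPdist_le => e1 e10; move/cvgrPdist_le : (gf x) => /(_ e1 e10).
    by apply: filterS => k; rewrite sub0r normrN.
  have := cvgM h1 h1; rewrite mul0r; exact.
- exact: i4G.
- apply: aeW => x k _; rewrite /= lee_fin ger0_norm ?sqr_ge0//.
  have := gG k x; have := fG x; rewrite !ler_norml => /andP[h1 h2] /andP[h3 h4]; nra.
move=> _ _; rewrite integral_cst// mul0e => /fine_cvgP[fin] /cvgrPdist_le/(_ _ e0) near0.
near \oo => k.
exists (g k) => //.
have fk : (\int[mu]_x ((f x - g k x) ^+ 2)%:E)%E \is a fin_num by near: k; exact: fin.
rewrite -(fineK fk) lee_fin.
have : `|0 - fine (\int[mu]_x ((f x - g k x) ^+ 2)%:E)%E| <= e by near: k; exact: near0.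
by rewrite sub0r normrN; apply: le_trans; exact: ler_norm.
Unshelve. all: end_near. Qed.

(** Here [c] is an end point of a half-open interval: membership in the interval is locally constant
    away from the end points. *)
Lemma lt_of_close (c u v : R) : `|u - v| < `|u - c| ->
  ((c < v) = (c < u)) * ((v <= c) = (u <= c)).
Proof.
have [uc|uc|uc] := ltgtP u c; last first.
- by rewrite uc subrr normr0 ltNge normr_ge0.
- rewrite (gtr0_norm (_ : 0 < u - c)) ?subr_gt0// ltr_norml => /andP[h1 h2].
  split; last by apply/negbTE; rewrite -ltNge; lra.
  by lra.
- rewrite (ltr0_norm (_ : u - c < 0)) ?subr_lt0// ltr_norml => /andP[h1 h2].
  by split; [apply/negbTE; rewrite -leNgt|]; lra.
Qed.

Definition rV_cell (a b : 'I_n -> R) : set 'rV[R]_n :=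
  [set x | forall i, `]a i, b i]%classic (x 0 i)].

Lemma measurable_rV_cell a b : measurable (rV_cell a b).
Proof.
rewrite (_ : rV_cell a b = \bigcap_(i in setT) [set x | `]a i, b i]%classic (x 0 i)]); last first.
  by apply/seteqP; split => x /= h i; [move=> _|]; exact: h.
apply: fin_bigcap_measurable => // i _.
by have := @measurable_rV_coor R n i measurableT _ (measurable_itv `]a i, b i]); rewrite setTI.
Qed.

Lemma lebesgue_rV_coor_eq0 (i : 'I_n) (a : R) : mu [set x | x 0 i = a] = 0%E.
Proof.
pose A (k : 'I_n) : set (measurableTypeR R) := if k == i then [set a] else setT.
rewrite (_ : mkset _ = [set x | forall k, A k (x 0 k)]); last first.
  apply/seteqP; split => x /= h; last by have := h i; rewrite /A eqxx.
  by move=> k; rewrite /A; case: eqP => // ->.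
rewrite lebesgue_rV_rect; last by move=> k; rewrite /A; case: ifP => // _; exact: measurable_set1.
by rewrite (bigD1 i)//= /A eqxx lebesgue_measure_set1 mul0e.
Qed.

Lemma rV_cell_box a b : rV_cell a b `<=` rV_box n (\sum_i (`|a i| + `|b i|)).
Proof.
move=> x h i; have := h i; rewrite /= in_itv/= => /andP[h1 h2].
apply: (@le_trans _ _ (`|a i| + `|b i|)); last first.
  by rewrite (bigD1 i)//= lerDl; apply: sumr_ge0 => j _; rewrite addr_ge0.
rewrite ler_norml; have h4 := ler_norm (b i).
have h5 : - a i <= `|a i| by rewrite -normrN ler_norm.
have := normr_ge0 (a i); have := normr_ge0 (b i).
by move=> h6 h7; apply/andP; split; lra.
Qed.

Lemma sqint_indic (A : set 'rV[R]_n) M : measurable A -> A `<=` rV_box n M -> sqint (\1_A).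
Proof.
move=> mA AM; apply: (@boxfun_sqint _ _ M 1); split.
- exact: measurable_indic.
- by move=> z; rewrite indicE; case: (z \in A); rewrite ?normr1// normr0.
- by move=> z; rewrite indicE; have [/set_mem/AM//|_] := boolP (z \in A); rewrite eqxx.
Qed.

(** Off the faces of the cell, which form a null set, the indicator is locally constant and the
    inner integral is eventually 0. Dominated convergence concludes. *)
Lemma vanishing_cell a b : vanishing (\1_(rV_cell a b)).
Proof.
set E := rV_cell a b; have mE := measurable_rV_cell a b.
split; first exact: measurable_indic.
set M := \sum_i (`|a i| + `|b i|).
pose F j x := (\int[mu]_y ((\1_E y - \1_E x) ^+ 2 * mollifier (inv1 j) (y - x))%:E)%E.
have locE x j : (forall y, (forall i, `|(y - x) 0 i| ^+ 2 < inv1 j) -> (y \in E) = (x \in E)) ->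
    F j x = 0%E.
  move=> H; apply: integral0_eq => y _.
  have [/eqP ->|k0] := boolP (mollifier (inv1 j) (y - x) == 0); first by rewrite mulr0.
  rewrite !indicE H ?subrr ?expr0n ?mul0r// => i.
  rewrite ltNge; apply/negP => ij; move/eqP: k0; apply.
  apply: bump_kernel_supp (bump_kernel_mollifier _) _; apply: le_trans ij _.
  by rewrite real_normK ?num_real// coor_sqr_le_sqn.
pose N := \bigcup_(i in [set: 'I_n]) ([set x : 'rV[R]_n | x 0 i = a i] `|` [set x | x 0 i = b i]).
have N0 : mu.-negligible N.
  have C i c : mu.-negligible [set x : 'rV[R]_n | x 0 i = c].
    exists [set x : 'rV[R]_n | x 0 i = c]; split => //; last exact: lebesgue_rV_coor_eq0.
    have := @measurable_rV_coor R n i measurableT _ (measurable_set1 c).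
    by rewrite setTI.
  suff -> : N = \bigcup_(k in [set: nat]) (if insub k is Some i then
      [set x : 'rV[R]_n | x 0 i = a i] `|` [set x | x 0 i = b i] else set0).
    apply: negligible_bigcup => k; case: insubP => [i _ _|_]; last exact: negligible_set0.
    by apply: negligibleU; exact: C.
  apply/seteqP; split => x /= [i _ xi]; last first.
    by move: xi; case: insubP => // k _ _ xk; exists k.
  by exists (val i) => //; rewrite valK.
have cv x : ~ N x -> F j x @[j --> \oo] --> 0%E.
  move=> Nx.
  have : nbhs x [set y : 'rV[R]_n | forall i, (y 0 i \in `]a i, b i]) = (x 0 i \in `]a i, b i])].
    apply: (@filter_forall _ _ (fun i (y : 'rV[R]_n) => (y 0 i \in `]a i, b i]) =
      (x 0 i \in `]a i, b i])) _ (nbhs_filter x)) => i; apply/rV_nearP.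
    have xa : x 0 i != a i by apply/eqP => xai; apply: Nx; exists i => //; left.
    have xb : x 0 i != b i by apply/eqP => xbi; apply: Nx; exists i => //; right.
    exists (Num.min `|x 0 i - a i| `|x 0 i - b i|).
      by rewrite lt_min !normr_gt0 !subr_eq0 xa.
    move=> y /(_ i); rewrite lt_min !in_itv/= => /andP[h1 h2].
    by rewrite (lt_of_close h1).1 (lt_of_close h2).2.
  move=> /rV_nearP[d d0 dP].
  apply: cvg_near_cst; near=> j; apply: locE => y yx.
  have yE : forall i, (y 0 i \in `]a i, b i]) = (x 0 i \in `]a i, b i]).
    apply: dP => i; rewrite distrC -ltr_sqr ?nnegrE ?(ltW d0)//.
    have := yx i; rewrite !mxE => h; apply: lt_trans h _.
    by near: j; apply: near_infty_natSinv_lt (PosNum (exprn_gt0 2 d0)).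
  apply/idP/idP => /set_mem h; apply/mem_set => i /=; have := h i => /=.
    by rewrite yE.
  by rewrite yE.
have F0 j x : (0 <= F j x)%E by apply: integral_ge0 => y _; apply: osc_integrand_ge0; exact: inv1_gt0.
have mF j : measurable_fun setT (F j).
  by apply: measurable_osc1; [exact: inv1_gt0|exact: measurable_indic].
(* The integrand is at most the kernel, of mass 1. Outside the enlarged box the inner integral is 0,
   because the kernel reaches less than distance 1 and the cell lies within [M]. *)
have Fle j x : (`|F j x| <= (\1_(rV_box n (M + 1)) x)%:E)%E.
  rewrite gee0_abs// indicE; have [xM|/negP xM] := boolP (x \in rV_box n (M + 1)).
    rewrite -(integral_mollifier x (inv1_gt0 j)); apply: ge0_le_integral => //.
    - by move=> y _; apply: osc_integrand_ge0; exact: inv1_gt0.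
    - by apply: measurable_osc0; exact: measurable_indic.
    - apply/measurable_EFinP; apply: (measurableT_comp (measurable_mollifier _)).
      exact: measurable_subr.
    move=> y _; rewrite lee_fin ler_piMl ?mollifier_ge0 ?inv1_gt0// !indicE.
  rewrite locE// => y yx.
  have far z : z \in E -> (forall i, `|(z - x) 0 i| <= 1) -> False.
    move=> /set_mem/rV_cell_box zM zx; apply: xM; apply/mem_set => i.
    rewrite -(subKr (z 0 i) (x 0 i)); apply: le_trans (ler_normB _ _) _.
    by rewrite lerD//; have := zx i; rewrite !mxE.
  have yx1 i : `|(y - x) 0 i| <= 1.
    have j1 : inv1 j <= 1 by rewrite invf_le1// ler1n.
    have := lt_le_trans (yx i) j1; rewrite leNgt => h1; apply/negP => h2.
    by have := normr_ge0 ((y - x) 0 i); nra.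
  transitivity false; last apply/esym; apply/negP => /far; apply => i //.
  by rewrite subrr mxE normr0.
have ib : mu.-integrable setT (EFin \o \1_(rV_box n (M + 1))).
  by apply: integrableR_indic; [exact: measurable_rV_box|exact: lebesgue_rV_box_lty].
have [] := @dominated_convergence _ _ _ mu _ measurableT F (cst 0%E) (fun x => (\1_(rV_box n (M + 1)) x)%:E).
- exact: mF.
- exact: measurable_cst.
- apply: negligibleS N0 => x /=; apply: contra_notP => Nx _; exact: cv.
- exact: ib.
- by apply: aeW => x j _.
move=> _ _; rewrite integral_cst// mul0e => /fine_cvgP[fin] /cvgrPdist_le near0 e e0.
have [N1 _ P1] := fin; have [N2 _ P2] := near0 e e0.
exists (maxn N1 N2) => j; rewrite geq_max => /andP[h1 h2].
have := P2 j h2; rewrite /= sub0r normrN => h3.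
have fj : osc (inv1 j) (\1_E) \is a fin_num by exact: P1.
rewrite -(fineK fj) lee_fin; apply: le_trans h3; exact: ler_norm.
Unshelve. all: end_near. Qed.

End vanishing_oscillation.

(** * Convergence of mollifications in L^2 *)

Section mollify_convergence.
Context {R : realType} {n : nat}.
Local Notation mu := (lebesgue_rV R n).
Implicit Types (f g h : 'rV[R]_n -> R) (x y z : 'rV[R]_n) (A B : set 'rV[R]_n).

Definition rV_cube (k : nat) : set 'rV[R]_n := rV_cell (fun=> - k%:R) (fun=> k%:R).

(** Truncation by cubes keeps the indicators square integrable, so that complements can be taken. *)
Definition vanishing_set A := measurable A /\
  forall k, vanishing (\1_(A `&` rV_cube k) : 'rV[R]_n -> R).

Lemma measurable_rV_cube k : measurable (rV_cube k).
Proof. exact: measurable_rV_cell. Qed.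

Lemma vanishing_setT : vanishing_set setT.
Proof. by split => // k; rewrite setTI; exact: vanishing_cell. Qed.

Lemma vanishing_setC A : vanishing_set A -> vanishing_set (~` A).
Proof.
move=> [mA VA]; split; first exact: measurableC.
move=> k; have c2 : (0 : R) <= 2 by [].
apply: (vanishing_comb c2 (VA k) (vanishing_cell _ _ : vanishing (\1_(rV_cube k)))).
  by apply: measurable_indic; apply: measurableI (measurable_rV_cube k); exact: measurableC.
move=> x y; rewrite !indicE !in_setI !in_setC.
by case: (y \in A); case: (x \in A); case: (y \in rV_cube k); case: (x \in rV_cube k); rewrite /=; lra.
Qed.

Lemma vanishing_setI A B : vanishing_set A -> vanishing_set B -> vanishing_set (A `&` B).
Proof.
move=> [mA VA] [mB VB]; split; first exact: measurableI.
move=> k; have c2 : (0 : R) <= 2 by [].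
apply: (vanishing_comb c2 (VA k) (VB k)).
  by apply: measurable_indic; apply: measurableI (measurable_rV_cube k); exact: measurableI.
move=> x y; rewrite !indicE !in_setI.
by case: (y \in A); case: (x \in A); case: (y \in B); case: (x \in B);
  case: (y \in rV_cube k); case: (x \in rV_cube k); rewrite /=; lra.
Qed.

Lemma vanishing_setU A B : vanishing_set A -> vanishing_set B -> vanishing_set (A `|` B).
Proof.
move=> VA VB; rewrite -(setCK (A `|` B)) setCU.
by apply: vanishing_setC; apply: vanishing_setI; exact: vanishing_setC.
Qed.

Lemma vanishing_set0 : vanishing_set set0.
Proof. by rewrite -setCT; apply: vanishing_setC; exact: vanishing_setT. Qed.

(** Finite unions increase to the countable one, dominated by the indicator of the cube. *)
Lemma vanishing_bigcup (F : (set 'rV[R]_n)^nat) :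
  (forall i, vanishing_set (F i)) -> vanishing_set (\bigcup_i F i).
Proof.
move=> VF; split; first by apply: bigcup_measurable => i _; case: (VF i).
move=> k.
have VU m : vanishing_set (\big[setU/set0]_(i < m) F i).
  elim/big_ind : _ => [|A B|i _]; [exact: vanishing_set0|exact: vanishing_setU|exact: VF].
apply: (@vanishing_dominated _ _ _ (fun m => \1_((\big[setU/set0]_(i < m) F i) `&` rV_cube k))
  (\1_(rV_cube k))).
- by move=> m; case: (VU m).
- move=> x; apply: cvg_near_cst.
  have [[i _ Fix]|nF] := pselect ((\bigcup_i F i) x).
    near=> m; rewrite !indicE !in_setI; congr ((_ && _)%:R).
    rewrite !mem_set//; first by exists i.
    have im : (i < m)%N by near: m; exact: nbhs_infty_gt.
    by rewrite -bigcup_mkord; exists i.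
  apply: nearW => m; rewrite !indicE !in_setI; congr ((_ && _)%:R).
  rewrite !memNset//.
  by rewrite -bigcup_mkord => -[i /= _ Fi]; apply: nF; exists i.
- exact: (sqint_indic (measurable_rV_cube k) (@rV_cell_box _ _ _ _)).
- move=> m x; rewrite !indicE in_setI; case: (x \in rV_cube k); rewrite ?andbF ?andbT ?normr0//.
  by case: (x \in _); rewrite ?normr1// normr0.
Unshelve. all: end_near. Qed.

Lemma vanishing_coor_ocitv (i : 'I_n) (a b : R) :
  vanishing_set [set x | `]a, b]%classic (x 0 i)].
Proof.
split.
  by have := @measurable_rV_coor R n i measurableT _ (measurable_itv `]a, b]); rewrite setTI.
move=> k; rewrite (_ : _ `&` _ = rV_cell (fun j => if j == i then Num.max a (- k%:R) else - k%:R)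
    (fun j => if j == i then Num.min b k%:R else k%:R)); first exact: vanishing_cell.
apply/seteqP; split => x /=.
  move=> [xi xk] j; have := xk j; case: eqP => [->|_] //.
  by move: xi; rewrite /= !in_itv/= gt_max le_min => /andP[-> ->] /andP[-> ->].
move=> h; split; first by have := h i; rewrite eqxx /= !in_itv/= gt_max le_min => /andP[/andP[-> _] /andP[-> _]].
move=> j; have := h j; case: eqP => [->|_] //.
by rewrite /= !in_itv/= gt_max le_min => /andP[/andP[_ ->] /andP[_ ->]].
Qed.

(** The vanishing sets form a sigma-algebra. It contains the slabs over half-open intervals, hence
    the slabs over all Borel sets of the line, and these generate. *)
Lemma measurable_vanishing A : measurable A -> vanishing_set A.
Proof.
have coorP (i : 'I_n) (Y : set (measurableTypeR R)) : measurable Y ->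
    vanishing_set [set x : 'rV[R]_n | Y (x 0 i)].
  move=> mY; suff : <<s (@ocitv R) >> `<=` [set Y | vanishing_set [set x : 'rV[R]_n | Y (x 0 i)]].
    by apply; exact: mY.
  apply: smallest_sub; last by move=> _ [[a b] _ <-]; exact: vanishing_coor_ocitv.
  split => /=.
  - exact: vanishing_set0.
  - move=> Y' VY; have := vanishing_setC VY; congr vanishing_set.
    by apply/seteqP; split => x /= => [h|[]//]; split.
  - by move=> F VF; apply: vanishing_bigcup.
move=> mA; suff : measurable `<=` vanishing_set by apply.
apply: smallest_sub.
  split => /=.
  - exact: vanishing_set0.
  - by move=> B VB; rewrite setTD; exact: vanishing_setC.
  - by move=> F VF; apply: vanishing_bigcup.
elim/big_ind : _ => [A' []|S T HS HT A' [/HS|/HT]|i _ B [Y mY <-]] //.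
by rewrite setTI; exact: coorP.
Qed.

Lemma rV_cube_cover x : \forall k \near \oo, rV_cube k x.
Proof.
have [N] : exists N : nat, forall i, `|x 0 i| < N%:R.
  exists (Num.trunc (l1norm x)).+1 => i; apply: le_lt_trans (coor_le_l1norm x i) _.
  exact: truncnS_gt.
move=> HN; near=> k => i; rewrite /= in_itv/=.
have Nk : (N%:R : R) <= k%:R by rewrite ler_nat; near: k; exact: nbhs_infty_ge.
have := HN i; rewrite ltr_norml => /andP[h1 h2]; apply/andP; split; lra.
Unshelve. all: end_near. Qed.

Import HBNNSimple.

Lemma vanishing_scale (c : R) f : vanishing f -> vanishing (fun x => c * f x).
Proof.
move=> Vf; apply: (vanishing_comb (sqr_ge0 c) Vf Vf).
  by apply: measurable_funM => //; case: Vf.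
move=> x y; rewrite -mulrBr exprMn; have := sqr_ge0 c.
by have := sqr_ge0 (f y - f x); nra.
Qed.

Lemma vanishing_add f g : vanishing f -> vanishing g -> vanishing (fun x => f x + g x).
Proof.
move=> Vf Vg; have c2 : (0 : R) <= 2 by [].
apply: (vanishing_comb c2 Vf Vg).
  by apply: measurable_funD; [case: Vf|case: Vg].
by move=> x y; have := sqr_ge0 ((f y - f x) - (g y - g x)); nra.
Qed.

Lemma vanishing_sum m (f : 'I_m -> 'rV[R]_n -> R) : (forall i, vanishing (f i)) ->
  vanishing (fun x => \sum_i f i x).
Proof.
elim: m f => [|m IH] f Vf.
  rewrite (_ : (fun x => _) = \1_(set0 `&` rV_cube 0)).
    by case: vanishing_set0.
  by apply/funext => x; rewrite big_ord0 set0I indicE in_set0.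
under eq_fun do rewrite big_ord_recl.
by apply: vanishing_add; [exact: Vf|exact: IH].
Qed.

(** The increasing simple approximations, truncated by cubes, are finite combinations of vanishing
    indicators and are dominated by [f] itself. *)
Lemma vanishing_ge0 f : sqint f -> (forall x, 0 <= f x) -> vanishing f.
Proof.
move=> sf f0; have [mf _] := sf.
have mf' : measurable_fun setT (EFin \o f) by exact/measurable_EFinP.
pose g := nnsfun_approx measurableT mf'.
have gx x : g k x @[k --> \oo] --> f x.
  have := @cvg_nnsfun_approx _ _ _ _ measurableT _ mf' (fun x _ => f0 x) x Logic.I.
  by move=> /fine_cvgP[].
have gf k x : g k x <= f x.
  rewrite -(cvg_lim (@Rhausdorff R) (gx x)); apply: nondecreasing_cvgn_le.
    by move=> a b ab; exact/lefP/nd_nnsfun_approx.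
  by apply/cvg_ex; exists (f x); exact: gx.
apply: (@vanishing_dominated _ _ _ (fun k x => g k x * \1_(rV_cube k) x) f) => //.
- move=> k.
  have [m [s gE]] : exists m (s : 'I_m -> R),
      forall x, g k x = \sum_(i < m) s i * \1_(g k @^-1` [set s i]) x.
    by eexists; eexists => x; exact: fimfunEord.
  rewrite (_ : (fun x => g k x * \1_(rV_cube k) x) = (fun x =>
      \sum_(i < m) s i * \1_(g k @^-1` [set s i] `&` rV_cube k) x)).
    apply: vanishing_sum => i; apply: vanishing_scale.
    suff [_ V] : vanishing_set (g k @^-1` [set s i]) by exact: V.
    exact: measurable_vanishing.
  apply/funext => x; rewrite gE mulr_suml; apply: eq_bigr => i _.
  rewrite !indicE in_setI -mulrA; congr (_ * _).
  by case: (x \in _); case: (x \in _); rewrite /= ?mulr1 ?mulr0 ?mul0r.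
- move=> x; apply: cvg_trans (gx x); apply: near_eq_cvg.
  near=> k; rewrite indicE mem_set ?mulr1//; near: k; exact: rV_cube_cover.
- move=> k x; have gk0 : 0 <= g k x by [].
  rewrite normrM indicE ger0_norm//.
  by case: (x \in _); rewrite ?normr1 ?mulr1// normr0 mulr0.
Unshelve. all: end_near. Qed.

Lemma sqint_vanishing f : sqint f -> vanishing f.
Proof.
move=> [mf fi].
have sp : sqint (fun x => Num.max (f x) 0).
  split; first exact: measurable_maxr.
  apply: le_integrableR fi; first by apply: measurable_funX; exact: measurable_maxr.
  move=> x; rewrite ger0_norm ?sqr_ge0//.
  by rewrite maxEle; case: ifPn => // _; rewrite expr0n sqr_ge0.
have sn : sqint (fun x => Num.max (- f x) 0).
  have mN : measurable_fun setT (fun x => - f x) by exact: measurableT_comp.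
  split; first exact: measurable_maxr.
  apply: le_integrableR fi; first by apply: measurable_funX; exact: measurable_maxr.
  move=> x; rewrite ger0_norm ?sqr_ge0//.
  by rewrite maxEle; case: ifPn => // _; rewrite ?sqrrN// expr0n sqr_ge0.
have p0 x : 0 <= Num.max (f x) 0 by rewrite le_max lexx orbT.
have n0 x : 0 <= Num.max (- f x) 0 by rewrite le_max lexx orbT.
have := vanishing_add (vanishing_ge0 sp p0) (vanishing_scale (-1) (vanishing_ge0 sn n0)).
congr vanishing; apply/funext => x; rewrite !maxEle.
by case: ifPn; case: ifPn; rewrite -?ltNge => h1 h2; lra.
Qed.

Lemma measurable_mollify f j : sqint f -> measurable_fun setT (mollify (mollifier (inv1 j)) f).
Proof.
move=> sf; apply: continuous_rV_measurable.
have bk := @bump_kernel_mollifier R n (inv1 j).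
have [dk bdk Dk] := bump_kernel_grad bk.
exact: has_grad_continuous (mollify_has_grad sf bk Dk bdk).
Qed.

(** Integrating Jensen's bound over [x], the error is at most the oscillation at scale [inv1 j]. *)
Theorem mollify_cvg f : sqint f -> forall e : R, 0 < e -> exists N, forall j, (N <= j)%N ->
  (\int[mu]_x ((mollify (mollifier (inv1 j)) f x - f x) ^+ 2)%:E <= e%:E)%E.
Proof.
move=> sf e e0; have [mf V] := sqint_vanishing sf.
have [N P] := V e e0; exists N => j /P; apply: le_trans.
apply: ge0_le_integral => //.
- by move=> x _; rewrite lee_fin sqr_ge0.
- apply/measurable_EFinP; apply: measurable_funX; apply: measurable_funB => //.
  exact: measurable_mollify.
- by apply: measurable_osc1 => //; exact: inv1_gt0.
by move=> x _; apply: mollify_mollifier_sqr => //; exact: inv1_gt0.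
Qed.

End mollify_convergence.

(** * Polar coordinates *)

Section polar_coordinates.
Context {R : realType} {n : nat}.
Hypothesis n0 : (0 < n)%N.
Local Notation mu := (lebesgue_rV R n).
Local Notation sigma := (@sphere_measure R n).
Implicit Types (x y z : 'rV[R]_n) (A : set 'rV[R]_n).

Lemma enorm_ge0 x : 0 <= enorm x.
Proof. exact: sqrtr_ge0. Qed.

Lemma enorm_eq0 x : (enorm x == 0) = (x == 0).
Proof. by rewrite -sqn_eq0 -enorm_sqr sqrf_eq0. Qed.

Lemma enorm_gt0 x : (0 < enorm x) = (x != 0).
Proof. by rewrite lt_neqAle enorm_ge0 andbT eq_sym enorm_eq0. Qed.

Lemma enormZ (a : R) x : enorm (a *: x) = `|a| * enorm x.
Proof.
apply/eqP; rewrite -(@eqrXn2 _ 2)// ?mulr_ge0 ?enorm_ge0//.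
rewrite exprMn real_normK ?num_real// !enorm_sqr /sqn mulr_sumr.
by apply/eqP; apply: eq_bigr => i _; rewrite mxE exprMn.
Qed.

Lemma enorm_direction x : enorm x *: direction x = x.
Proof.
have [->|x0] := eqVneq x 0; first by rewrite /direction !scaler0.
by rewrite /direction scalerA mulfV ?scale1r// enorm_eq0.
Qed.

Lemma direction_enorm1 x : x != 0 -> enorm (direction x) = 1.
Proof.
move=> x0; rewrite /direction enormZ ger0_norm ?invr_ge0 ?enorm_ge0//.
by rewrite mulVf// enorm_eq0.
Qed.

Lemma directionZ (b : R) x : 0 < b -> direction (b *: x) = direction x.
Proof.
move=> b0; rewrite /direction enormZ gtr0_norm// invfM scalerA.
by rewrite mulrAC mulVf ?mul1r// gt_eqF.
Qed.

Lemma coor_le_enorm x i : `|x 0 i| <= enorm x.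
Proof.
rewrite -(ler_pXn2r (n := 2)) ?nnegrE ?enorm_ge0// enorm_sqr.
by rewrite real_normK ?num_real// coor_sqr_le_sqn.
Qed.

Lemma measurable_direction_preimage A : measurable A -> measurable (@direction R n @^-1` A).
Proof. by move=> mA; rewrite -[X in measurable X]setTI; exact: measurable_direction. Qed.

Lemma measurable_ball_dir A b : measurable A -> measurable [set x | enorm x <= b /\ A (direction x)].
Proof.
move=> mA; apply: measurableI; last exact: measurable_direction_preimage.
rewrite -[X in measurable X]setTI.
have := @measurable_enorm R n measurableT _ (measurable_itv `]-oo, b]).
by congr measurable; apply/seteqP; split => x /=; rewrite in_itv/=.
Qed.

(** The volume of the sector of the unit ball over [A], that is [sphere_measure A] divided by
    [n]. *)
Definition dirw A : \bar R := mu (@punctured_ball R n `&` @direction R n @^-1` A).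

Lemma dirw_fin A : measurable A -> dirw A \is a fin_num.
Proof.
move=> mA; rewrite ge0_fin_numE; last exact: measure_ge0.
apply: le_lt_trans (lebesgue_rV_box_lty n 1); apply: le_measure; rewrite ?inE.
- by apply: measurableI; [exact: measurable_punctured_ball|exact: measurable_direction_preimage].
- exact: measurable_rV_box.
by move=> x [/= /andP[_ x1] _] i; apply: le_trans (coor_le_enorm x i) x1.
Qed.

Lemma lebesgue_rV_set0 : mu [set 0] = 0%E.
Proof.
apply/eqP; rewrite -measure_le0.
have mi := @measurable_rV_coor R n (Ordinal n0) measurableT _ (measurable_set1 0).
rewrite setTI in mi.
rewrite -(@lebesgue_rV_coor_eq0 R n (Ordinal n0) 0); apply: le_measure; rewrite ?inE.
- rewrite (_ : [set 0] = rV_box n 0); first exact: measurable_rV_box.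
  apply/seteqP; split => x /=; first by move=> -> i; rewrite mxE normr0.
  by move=> h; apply/rowP => i; rewrite mxE; apply/eqP; rewrite -normr_le0; exact: h.
- exact: mi.
by move=> x ->; rewrite /= mxE.
Qed.

Lemma measurable_rV0 : measurable [set 0 : 'rV[R]_n].
Proof.
rewrite (_ : [set 0] = rV_box n 0); first exact: measurable_rV_box.
apply/seteqP; split => x /=; first by move=> -> i; rewrite mxE normr0.
by move=> h; apply/rowP => i; rewrite mxE; apply/eqP; rewrite -normr_le0; exact: h.
Qed.

(** Dilation by [b] multiplies volumes by [b^n]. The maximum with 0 covers negative [b]; the origin,
    whose direction is the default value 0, is a null set. *)
Lemma measure_ball_dir A b : measurable A ->
  mu [set x | enorm x <= b /\ A (direction x)] = ((Num.max b 0 ^+ n)%:E * dirw A)%E.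
Proof.
move=> mA; have [b0|b0] := leP b 0.
  rewrite expr0n gtn_eqF// mul0e; apply/eqP; rewrite -measure_le0.
  rewrite -lebesgue_rV_set0; apply: le_measure; rewrite ?inE.
  - exact: measurable_ball_dir.
  - exact: measurable_rV0.
  move=> x [/= xb _]; apply/eqP; rewrite -enorm_eq0 eq_le enorm_ge0 andbT.
  exact: le_trans xb b0.
set D := @punctured_ball R n `&` @direction R n @^-1` A.
have mD : measurable D.
  by apply: measurableI; [exact: measurable_punctured_ball|exact: measurable_direction_preimage].
have bi0 : 0 < b^-1 by rewrite invr_gt0.
have mC : measurable [set x | 0 < enorm x <= b /\ A (direction x)].
  apply: measurableI; last exact: measurable_direction_preimage.
  have := @measurable_enorm R n measurableT _ (measurable_itv `]0, b]).
  by rewrite setTI; congr measurable; apply/seteqP; split => x /=; rewrite in_itv/=.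
have E : mu [set x | 0 < enorm x <= b /\ A (direction x)] = ((b ^+ n)%:E * dirw A)%E.
  have mI : measurable_fun setT (fun x => (\1_D x)%:E : \bar R).
    by apply/measurable_EFinP; exact: measurable_indic.
  have I0 x : (0 <= (\1_D x)%:E :> \bar R)%E by rewrite lee_fin.
  have := ge0_integral_affine_rV (0 : 'rV[R]_n) bi0 mI I0.
  rewrite exprVn invrK [in X in _ = X -> _]integral_indic//; rewrite setIT => <-.
  set C := [set x | _] in mC *.
  transitivity (\int[mu]_x (\1_C x)%:E)%E; first by rewrite integral_indic// setIT.
  apply: eq_integral => x _; rewrite addr0 !indicE; congr ((nat_of_bool _)%:R%:E).
  apply/idP/idP => /set_mem [/= /andP[h1 h2] h3]; apply/mem_set; split => /=.
  - by rewrite /punctured_ball/= enormZ gtr0_norm// mulr_gt0//= ler_pdivrMl// mulr1.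
  - by rewrite /preimage/= directionZ.
  - by move: h1 h2; rewrite enormZ gtr0_norm// pmulr_rgt0// ler_pdivrMl// mulr1 => -> ->.
  - by move: h3; rewrite /preimage/= directionZ.
rewrite -E; apply/eqP; rewrite eq_le; apply/andP; split; last first.
  apply: le_measure; rewrite ?inE//; first exact: measurable_ball_dir.
  by move=> x [/= /andP[_ xb] Ax].
rewrite -[leRHS]adde0 -lebesgue_rV_set0.
apply: le_trans (measureU2 _ mC measurable_rV0).
apply: le_measure; rewrite ?inE.
- exact: measurable_ball_dir.
- by apply: measurableU => //; exact: measurable_rV0.
move=> x [/= xb Ax]; have [->|x0] := eqVneq x 0; first by right.
by left; rewrite enorm_gt0 x0.
Qed.

Lemma sphere_measureTE : sigma setT = (n%:R%:E * dirw setT)%E.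
Proof. by []. Qed.

Lemma dirw_gt0 : (0 < dirw setT)%E.
Proof.
have mM := lebesgue_rV_box_lty n 1.
have n1 : 0 < n%:R :> R by rewrite ltr0n.
(* [d <= 1] gives [n d^2 <= n d = 1], so the box of half-side [d] lies in the unit ball. *)
pose d := n%:R^-1 : R.
have d0 : 0 < d by rewrite invr_gt0.
apply: lt_le_trans (rV_box_gt0 (n := n) d0) _.
have -> : dirw setT = mu [set x | enorm x <= 1 /\ setT (direction x)].
  by rewrite measure_ball_dir// max_l// expr1n mul1e.
apply: le_measure; rewrite ?inE.
- exact: measurable_rV_box.
- exact: measurable_ball_dir.
move=> x xd; split => //.
rewrite -(ler_pXn2r (n := 2)) ?nnegrE ?enorm_ge0// expr1n enorm_sqr.
apply: (@le_trans _ _ (\sum_(i < n) d)).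
  apply: ler_sum => i _; rewrite -real_normK ?num_real//.
  apply: (@le_trans _ _ (d ^+ 2)); first by apply: lerXn2r; rewrite ?nnegrE ?(ltW d0)//; exact: xd.
  by rewrite expr2 ler_piMr ?(ltW d0)// invf_le1// ler1n.
by rewrite sumr_const card_ord -[d *+ n]mulr_natr mulVf// gt_eqF.
Qed.

Definition sphere_area : R := fine (sigma setT).

Lemma sphere_areaE : sigma setT = sphere_area%:E.
Proof. by rewrite /sphere_area fineK// sphere_measureTE fin_numM// dirw_fin. Qed.

Lemma sphere_area_gt0 : 0 < sphere_area.
Proof.
rewrite -lte_fin -sphere_areaE sphere_measureTE mule_gt0 ?dirw_gt0//.
by rewrite lte_fin ltr0n.
Qed.

Lemma sphere_measure_lty A : measurable A -> (sigma A < +oo)%E.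
Proof.
move=> mA; apply: (@le_lt_trans _ _ (sigma setT)).
  by apply: le_measure; rewrite ?inE.
by rewrite sphere_areaE ltry.
Qed.

Lemma sphere_measureC : sigma (~` @esphere R n) = 0%E.
Proof.
rewrite /sphere_measure (_ : _ `&` _ = set0) ?measure0 ?mule0//.
apply/seteqP; split => x //= [/= /andP[x0 _]]; apply.
by apply: direction_enorm1; rewrite -enorm_gt0.
Qed.

Let sphere_sigma_finite : sigma_finite setT sigma.
Proof.
exists (fun=> setT); first by rewrite bigcup_const.
by move=> i; split => //; exact: sphere_measure_lty.
Qed.

HB.instance Definition _ := Measure_isSigmaFinite.Build _ _ _ sigma sphere_sigma_finite.

(** The distribution of the norm under Lebesgue measure; it stands for [S r^(n-1) dr], with [S] the
    area of the sphere, without a density ever being computed. *)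
Definition radial_law (I : set (measurableTypeR R)) : \bar R := mu (@enorm R n @^-1` I).

Let menorm : measurable_fun [set: 'rV[R]_n] (@enorm R n : 'rV[R]_n -> measurableTypeR R).
Proof. exact: measurable_enorm. Qed.

Let radial_law0 : radial_law set0 = 0%E.
Proof. by rewrite /radial_law preimage_set0 measure0. Qed.

Let radial_law_ge0 I : (0 <= radial_law I)%E.
Proof. exact: measure_ge0. Qed.

Let radial_law_sigma_additive : semi_sigma_additive radial_law.
Proof.
move=> F mF tF mUF; rewrite /radial_law preimage_bigcup.
apply: measure_semi_sigma_additive.
- by move=> k; rewrite -[X in measurable X]setTI; exact: menorm.
- apply/trivIsetP => /= i j _ _ ij; rewrite -preimage_setI.
  by move/trivIsetP : tF => /(_ _ _ _ _ ij) ->//; rewrite preimage_set0.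
- by rewrite -preimage_bigcup -[X in measurable X]setTI; exact: menorm.
Qed.

HB.instance Definition _ := isMeasure.Build _ _ _ radial_law
  radial_law0 radial_law_ge0 radial_law_sigma_additive.

Let radial_law_sigma_finite : sigma_finite setT radial_law.
Proof.
exists (fun k => `]-oo, k%:R]%classic).
  apply/esym/seteqP; split => // r _; exists (Num.trunc `|r|).+1 => //=.
  rewrite in_itv/=; apply: le_trans (ler_norm r) _; apply: ltW; exact: truncnS_gt.
move=> k; split; first exact: (measurable_itv `]-oo, k%:R]).
apply: le_lt_trans (lebesgue_rV_box_lty n k%:R).
rewrite /radial_law; apply: le_measure; rewrite ?inE.
- by have := @measurable_enorm R n measurableT _ (measurable_itv `]-oo, k%:R]); rewrite setTI.
- exact: measurable_rV_box.
by move=> x; rewrite /= in_itv/= => xk i; apply: le_trans (coor_le_enorm x i) xk.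
Qed.

HB.instance Definition _ := Measure_isSigmaFinite.Build _ _ _ radial_law radial_law_sigma_finite.

Definition polar_map x : measurableTypeR R * 'rV[R]_n := (enorm x, direction x).

Lemma measurable_polar_map : measurable_fun setT polar_map.
Proof. by apply/measurable_fun_pair; [exact: menorm|exact: measurable_direction]. Qed.

Lemma measure_annulus_dir A a b : measurable A -> a <= b ->
  mu [set x | a < enorm x <= b /\ A (direction x)] =
  ((Num.max b 0 ^+ n - Num.max a 0 ^+ n)%:E * dirw A)%E.
Proof.
move=> mA ab.
pose D c := [set x | enorm x <= c /\ A (direction x)].
have mb c : mu (D c) = ((Num.max c 0 ^+ n)%:E * dirw A)%E by exact: measure_ball_dir.
have mD c : measurable (D c) by exact: measurable_ball_dir.
have Dfin : (mu (D b) < +oo)%E by rewrite mb -(fineK (dirw_fin mA)) -EFinM ltry.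
have E : mu (D b `\` D a) = (mu (D b) - mu (D b `&` D a))%E by rewrite measureD.
rewrite (_ : mkset _ = D b `\` D a); last first.
  apply/seteqP; split => x /=.
    by move=> [/andP[xa xb] Ax]; split => // -[]; rewrite leNgt xa.
  move=> [[xb Ax] xa]; split => //; rewrite xb andbT ltNge; apply/negP => xa'.
  exact: xa.
have DI : D b `&` D a = D a.
  by apply/seteqP; split => x /= => [[_ []]|[xa Ax]] //; do !split => //; exact: le_trans ab.
rewrite E DI !mb -(fineK (dirw_fin mA)) -!EFinM -EFinB.
by rewrite mulrBl.
Qed.

(** For fixed [A] both sides are measures in [I], and they agree on half-open intervals, where
    annular sectors have volume [(b^n - a^n) dirw A]. The factor [sphere_area] on the left balances
    [radial_law], which already counts the whole sphere. *)
Lemma polar_law_rect (I : set (measurableTypeR R)) A : measurable I -> measurable A ->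
  (sphere_area%:E * mu (polar_map @^-1` (I `*` A)) = radial_law I * sigma A)%E.
Proof.
move=> mI mA.
have s0 : 0 <= sphere_area by exact: ltW sphere_area_gt0.
have mdir : measurable (@direction R n @^-1` A) by exact: measurable_direction_preimage.
have sAfin : sigma A \is a fin_num by rewrite ge0_fin_numE ?sphere_measure_lty.
have sA0 : 0 <= fine (sigma A) by exact: fine_ge0.
have U := @measure_unique _ R (measurableTypeR R) (@ocitv R) (fun k => `]-k%:R, k%:R]%classic)
  erefl (@ocitvI R) _ _
  (mscale (NngNum s0) (pushforward (mrestr mu mdir) (@enorm R n : 'rV[R]_n -> measurableTypeR R)))
  (mscale (NngNum sA0) radial_law).
transitivity (mscale (NngNum sA0) radial_law I); last first.
  by rewrite /mscale/= fineK// muleC.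
rewrite -(U _ _ menorm)//.
- move=> k; have [->|k0] := posnP k; first by rewrite oppr0 set_itv_ge ?bnd_simp ?ltxx//; exact: ocitv0.
  by apply/ocitvP; right; exists (- k%:R, k%:R) => //=; rewrite gtrN// ltr0n.
- apply/seteqP; split => // r _; exists (Num.trunc `|r|).+1 => //=.
  rewrite in_itv/=; have := truncnS_gt `|r|; rewrite ltr_norml => /andP[-> /ltW ->] //.
- move=> X /ocitvP[->|[[a b] /= ab ->]]; first by rewrite !measure0.
  rewrite /mscale/= /pushforward /mrestr /radial_law.
  have -> : (@enorm R n @^-1` `]a, b] `&` @direction R n @^-1` A) =
      [set x | a < enorm x <= b /\ A (direction x)].
    by apply/seteqP; split => x /=; rewrite in_itv/=.
  have -> : (@enorm R n @^-1` `]a, b]) = [set x | a < enorm x <= b /\ setT (direction x)].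
    by apply/seteqP; split => x /=; rewrite in_itv/=; [move=> h; split|case].
  rewrite !measure_annulus_dir ?(ltW ab)// -sphere_areaE (fineK sAfin).
  rewrite sphere_measureTE /sphere_measure -/(dirw A).
  rewrite -(fineK (dirw_fin mA)) -(fineK (dirw_fin measurableT)) -!EFinM.
  by congr EFin; ring.
- move=> k; rewrite /mscale/= /pushforward /mrestr.
  rewrite lte_mul_pinfty ?lee_fin//.
  apply: (@le_lt_trans _ _ (mu [set x | enorm x <= k%:R /\ setT (direction x)])); last first.
    by rewrite measure_ball_dir// -(fineK (dirw_fin measurableT)) -EFinM ltry.
  apply: le_measure; rewrite ?inE.
  + apply: measurableI => //.
    by have := @measurable_enorm R n measurableT _ (measurable_itv `]- k%:R, k%:R]); rewrite setTI.
  + exact: measurable_ball_dir.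
  by move=> x [/=]; rewrite in_itv/= => /andP[_ xk] _.
Qed.

(** Up to the factor [sphere_area], the image of Lebesgue measure under [polar_map] is a product
    measure, by uniqueness on rectangles. After Tonelli the radial integral is pulled back to R^n,
    so the right-hand side averages over the sphere through [x]. *)
Theorem polar (F : measurableTypeR R * 'rV[R]_n -> \bar R) :
  measurable_fun setT F -> (forall p, 0 <= F p)%E ->
  (sphere_area%:E * \int[mu]_x F (enorm x, direction x) =
   \int[mu]_x \int[sigma]_w F (enorm x, w))%E.
Proof.
move=> mF F0.
have s0 : 0 <= sphere_area by exact: ltW sphere_area_gt0.
have [L LE] : exists L : {measure set (measurableTypeR R * 'rV[R]_n) -> \bar R},
    forall B, L B = mu (polar_map @^-1` B).
  by unshelve eexists (pushforward mu polar_map); [exact: measurable_polar_map|].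
transitivity (\int[mscale (NngNum s0) L]_p F p)%E.
  rewrite ge0_integral_mscale//=; congr (_ * _)%E.
  transitivity (\int[pushforward mu polar_map]_p F p)%E.
    by rewrite ge0_integral_pushforward//; exact: measurable_polar_map.
  apply: eq_measure_integral; first exact: measurable_polar_map.
  by move=> mp B mB _; have := LE B.
transitivity (\int[radial_law \x sigma]_p F p)%E.
  apply: eq_measure_integral => B mB _.
  apply/esym; apply: (@product_measure_unique _ _ _ _ R radial_law sigma (mscale (NngNum s0) L)) => //.
  by move=> I A mI mA; rewrite -polar_law_rect//; congr (_ * _)%E; exact: LE.
rewrite fubini_tonelli1//.
transitivity (\int[pushforward mu (@enorm R n : 'rV[R]_n -> measurableTypeR R)]_r \int[sigma]_w F (r, w))%E => //.
rewrite ge0_integral_pushforward//.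
  exact: (measurable_fun_fubini_tonelli_F F).
by move=> r _; exact: integral_ge0.
Qed.

Lemma measurable_sphere_integral (F : measurableTypeR R * 'rV[R]_n -> \bar R) :
  measurable_fun setT F -> (forall p, 0 <= F p)%E ->
  measurable_fun setT (fun x : 'rV[R]_n => \int[sigma]_w F (enorm x, w))%E.
Proof.
move=> mF F0.
exact: (measurableT_comp (measurable_fun_fubini_tonelli_F (m2 := sigma) F mF F0) menorm).
Qed.

End polar_coordinates.

(** * Integrals and means over spheres *)

Section spherical_means.
Context {R : realType} {n : nat}.
Hypothesis n0 : (0 < n)%N.
Local Notation mu := (lebesgue_rV R n).
Local Notation sigma := (@sphere_measure R n).
Local Notation S := (@sphere_area R n).
Implicit Types (x y z : 'rV[R]_n) (f u : 'rV[R]_n -> R) (W : R -> R).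

Lemma measurable_polar_scale : measurable_fun setT
  (fun p : measurableTypeR R * 'rV[R]_n => p.1 *: p.2).
Proof.
apply: measurable_fun_rVP => i.
rewrite (_ : _ \o _ = fun p => p.1 * rV_coor i p.2); last first.
  by apply/funext => p; rewrite /rV_coor/= !mxE.
apply: measurable_funM; first exact: measurable_fst.
by apply: measurableT_comp; [exact: measurable_rV_coor|exact: measurable_snd].
Qed.

Lemma measurable_scale_rV (r : R) : measurable_fun setT (fun w : 'rV[R]_n => r *: w).
Proof.
have := @measurable_affine_rV R n r 0.
by under [X in measurable_fun _ X -> _]eq_fun do rewrite addr0.
Qed.

Lemma polar_weight W (h : 'rV[R]_n -> \bar R) : measurable_fun setT W ->
  (forall r, 0 <= W r) -> measurable_fun setT h -> (forall x, 0 <= h x)%E ->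
  (S%:E * \int[mu]_x ((W (enorm x))%:E * h x) =
   \int[mu]_x ((W (enorm x))%:E * \int[sigma]_w h (enorm x *: w)%R))%E.
Proof.
move=> mW W0 mh h0.
have := @polar _ _ n0 (fun p => (W p.1)%:E * h (p.1 *: p.2)%R)%E.
move=> /=; under [X in (_ * X)%E]eq_integral do rewrite enorm_direction.
move=> ->; last 2 first.
- apply: emeasurable_funM; last exact: (measurableT_comp mh measurable_polar_scale).
  apply/measurable_EFinP; exact: (measurableT_comp mW measurable_fst).
- by move=> p; rewrite mule_ge0// lee_fin.
apply: eq_integral => x _; rewrite ge0_integralZl//.
- by apply: (measurableT_comp mh); exact: measurable_scale_rV.
- by rewrite lee_fin.
Qed.

Lemma measurable_sphere_weight (h : 'rV[R]_n -> \bar R) :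
  measurable_fun setT h -> (forall x, 0 <= h x)%E ->
  measurable_fun setT (fun x => \int[sigma]_w h (enorm x *: w)%R)%E.
Proof.
move=> mh h0; have H := @measurable_sphere_integral _ _ (fun p => h (p.1 *: p.2)%R).
by apply: H => //; exact: (measurableT_comp mh measurable_polar_scale).
Qed.

(** Norm and direction are independent: a radial times an angular function integrates to a
    product. *)
Lemma polar_prod W (h : 'rV[R]_n -> \bar R) : measurable_fun setT W ->
  (forall r, 0 <= W r) -> measurable_fun setT h -> (forall x, 0 <= h x)%E ->
  (S%:E * \int[mu]_x ((W (enorm x))%:E * h (direction x)) =
   \int[mu]_x ((W (enorm x))%:E) * \int[sigma]_w h w)%E.
Proof.
move=> mW W0 mh h0.
have := @polar _ _ n0 (fun p => (W p.1)%:E * h p.2)%E; move=> /= ->; last 2 first.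
- apply: emeasurable_funM; last exact: (measurableT_comp mh measurable_snd).
  apply/measurable_EFinP; exact: (measurableT_comp mW measurable_fst).
- by move=> p; rewrite mule_ge0// lee_fin.
rewrite -ge0_integralZr//.
- by apply: eq_integral => x _; rewrite ge0_integralZl// lee_fin.
- apply/measurable_EFinP; apply: (measurableT_comp mW); exact: measurable_enorm.
- by move=> x _; rewrite lee_fin.
- by apply: integral_ge0 => w _.
Qed.

Lemma sphere_integrable_bounded u (B : R) : measurable_fun setT u ->
  (forall w, `|u w| <= B) -> sigma.-integrable setT (EFin \o u).
Proof.
move=> mu uB; apply: (le_integrableR mu uB).
apply: ge0_integrableR => //.
  by move=> x; exact: le_trans (normr_ge0 _) (uB x).
by rewrite integral_cst//= sphere_areaE// -EFinM ltry.
Qed.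

Lemma sphere_sqr_integrable u : measurable_fun setT u ->
  (\int[sigma]_w ((u w ^+ 2)%:E) < +oo)%E ->
  sigma.-integrable setT (EFin \o u) /\ sigma.-integrable setT (EFin \o (fun w => u w ^+ 2)).
Proof.
move=> mu u2.
have i2 : sigma.-integrable setT (EFin \o (fun w => u w ^+ 2)).
  by apply: ge0_integrableR => //; [exact: measurable_funX|move=> w; exact: sqr_ge0].
split => //.
have i1 : sigma.-integrable setT (EFin \o (fun=> 1 : R)).
  by apply: (@sphere_integrable_bounded _ 1) => // w; rewrite normr1.
apply: le_integrableR mu _ (integrableRD i1 i2) => w.
by rewrite -(real_normK (num_real (u w))); have := normr_ge0 (u w); nra.
Qed.

(** Expand the nonnegative integral of [(u - m)^2], with [m] the mean of [u]. *)
Lemma sphere_sqr_mean u : sigma.-integrable setT (EFin \o u) ->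
  sigma.-integrable setT (EFin \o (fun w => u w ^+ 2)) ->
  (\int[sigma]_w u w) ^+ 2 <= S * \int[sigma]_w (u w ^+ 2).
Proof.
move=> iu iu2; have S0 := @sphere_area_gt0 R _ n0.
have i1 : sigma.-integrable setT (EFin \o (fun=> 1 : R)).
  by apply: (@sphere_integrable_bounded _ 1) => // w; rewrite normr1.
have I1 : \int[sigma]_w (1 : R) = S by rewrite Rintegral_cst// mul1r.
set A := \int[sigma]_w u w; set B := \int[sigma]_w (u w ^+ 2).
pose m := A / S.
have : 0 <= \int[sigma]_w ((u w - m) ^+ 2) by apply: Rintegral_ge0 => w _; exact: sqr_ge0.
rewrite (_ : (fun w => _) = fun w => (u w ^+ 2 - (2 * m) * u w) + m ^+ 2 * 1); last first.
  by apply/funext => w; ring.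
rewrite RintegralD//; [|exact: integrableRB iu2 (integrableRZ _ iu)|exact: integrableRZ].
rewrite RintegralB//; last exact: integrableRZ.
rewrite (RintegralZl _ measurableT iu) (RintegralZl _ measurableT i1) I1 -/A -/B.
have -> : B - 2 * m * A + m ^+ 2 * S = B - A ^+ 2 / S by rewrite /m; field; exact: lt0r_neq0.
by rewrite subr_ge0 ler_pdivrMr// mulrC.
Qed.

Lemma sphere_Rintegral_esphere u : measurable_fun setT u ->
  sigma.-integrable setT (EFin \o u) ->
  \int[sigma]_(w in @esphere R n) u w = \int[sigma]_w u w.
Proof.
move=> mu iu; rewrite /Rintegral; congr fine.
have mE : measurable (@esphere R n).
  have := @measurable_enorm R n measurableT _ (measurable_set1 1).
  by rewrite setTI; congr measurable; apply/seteqP; split => x.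
rewrite [RHS](negligible_integral (N := ~` @esphere R n))//.
- by rewrite setTD setCK.
- exact: measurableC.
- exact: sphere_measureC.
Qed.

(** On almost every sphere the mean of [f] is 0, so the integral of [u] is that of [u - f].
    Cauchy-Schwarz on the sphere gives one factor [sphere_area], the polar formula the other. *)
Lemma radial_mean_bound u f W (B : R) : measurable_fun setT u ->
  (forall x, `|u x| <= B) -> sqint f ->
  {ae mu, forall x, \int[sigma]_(w in @esphere R n) f (enorm x *: w) = 0} ->
  measurable_fun setT W -> (forall r, 0 <= W r) ->
  (\int[mu]_x (W (enorm x) * (\int[sigma]_w u (enorm x *: w)) ^+ 2)%:E <=
   (S ^+ 2)%:E * \int[mu]_x (W (enorm x) * (u x - f x) ^+ 2)%:E)%E.
Proof.
move=> mu' uB sf Pf mW W0.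
have S0 := @sphere_area_gt0 R _ n0.
have [mf if2] := sf.
have muf : measurable_fun setT (fun x => ((u x - f x) ^+ 2)%:E).
  by apply/measurable_EFinP; apply: measurable_funX; exact: measurable_funB.
have uf0 x : (0 <= ((u x - f x) ^+ 2)%:E)%E by rewrite lee_fin sqr_ge0.
have mf2 : measurable_fun setT (fun x => (f x ^+ 2)%:E).
  by apply/measurable_EFinP; exact: measurable_funX.
have f20 x : (0 <= (f x ^+ 2)%:E)%E by rewrite lee_fin sqr_ge0.
have mWe : measurable_fun setT (fun x => (W (enorm x))%:E).
  by apply/measurable_EFinP; apply: (measurableT_comp mW); exact: measurable_enorm.
have aefin : {ae mu, forall x, (\int[sigma]_w (f (enorm x *: w) ^+ 2)%:E < +oo)%E}.
  have mI := measurable_sphere_weight mf2 f20.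
  have : mu.-integrable setT (fun x => \int[sigma]_w (f (enorm x *: w) ^+ 2)%:E)%E.
    apply/integrableP; split => //.
    under eq_integral => x _ do rewrite gee0_abs ?integral_ge0//.
    have := polar_weight (W := fun=> 1) _ _ mf2 f20 => /(_ (measurable_cst _) (fun _ => ler01)).
    under [X in _ = X -> _]eq_integral do rewrite mul1e.
    move=> <-; under eq_integral do rewrite mul1e.
    by rewrite integral_Rintegral// -EFinM ltry.
  move=> /integrable_ae -/(_ measurableT); apply: filterS => x /(_ Logic.I).
  by rewrite ge0_fin_numE// integral_ge0.
have mscale_f (g : 'rV[R]_n -> R) (r : R) : measurable_fun setT g ->
    measurable_fun setT (fun w : 'rV[R]_n => g (r *: w)).
  by move=> mg; apply: (measurableT_comp mg); exact: measurable_scale_rV.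
have B0 : 0 <= B by exact: le_trans (normr_ge0 _) (uB 0).
(* Tonelli's theorem gives measurability for nonnegative integrands, hence the shift by the bound
   [B]. *)
have mmean : measurable_fun setT (fun x => \int[sigma]_w u (enorm x *: w)).
  have muB : measurable_fun setT (fun x => (u x + B)%:E).
    by apply/measurable_EFinP; exact: measurable_funD.
  have uB0 x : (0 <= (u x + B)%:E)%E.
    by rewrite lee_fin; have := uB x; rewrite ler_norml => /andP[h _]; lra.
  have mI := measurable_sphere_weight muB uB0.
  rewrite (_ : (fun x => _) = fun x => fine (\int[sigma]_w (u (enorm x *: w) + B)%:E)%E - B * S).
    by apply: measurable_funB => //; exact: measurableT_comp.
  apply/funext => x; rewrite -/(Rintegral sigma setT (fun w => u (enorm x *: w) + B)).
  have iu : sigma.-integrable setT (EFin \o (fun w => u (enorm x *: w))).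
    by apply: (@sphere_integrable_bounded _ B) => //; exact: mscale_f.
  have iB : sigma.-integrable setT (EFin \o (fun=> B)).
    by apply: (@sphere_integrable_bounded _ B) => // _; rewrite ger0_norm.
  by rewrite RintegralD// Rintegral_cst// addrK.
apply: (@le_trans _ _ (\int[mu]_x ((W (enorm x))%:E * (S%:E *
    \int[sigma]_w ((u (enorm x *: w) - f (enorm x *: w)) ^+ 2)%:E)))%E).
  apply: ae_ge0_le_integral => //.
  - by move=> x _; rewrite lee_fin mulr_ge0// sqr_ge0.
  - apply/measurable_EFinP; apply: measurable_funM; last exact: measurable_funX.
    by apply: (measurableT_comp mW); exact: measurable_enorm.
  - by move=> x _; rewrite !mule_ge0 ?lee_fin// ?(ltW S0)// integral_ge0.
  - apply: emeasurable_funM => //; apply: measurable_funeM.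
    exact: (measurable_sphere_weight muf uf0).
  apply: filterS2 aefin Pf => x fx Pfx _.
  set r := enorm x in fx Pfx *.
  have [ig ig2] := sphere_sqr_integrable (mscale_f _ r mf) fx.
  have iu : sigma.-integrable setT (EFin \o (fun w => u (r *: w))).
    by apply: (@sphere_integrable_bounded _ B) => //; exact: mscale_f.
  have iu2 : sigma.-integrable setT (EFin \o (fun w => u (r *: w) ^+ 2)).
    apply: (@sphere_integrable_bounded _ (B ^+ 2)); first by apply: measurable_funX; exact: mscale_f.
    by move=> w; rewrite normrX; apply: lerXn2r; rewrite ?nnegrE.
  have id : sigma.-integrable setT (EFin \o (fun w => u (r *: w) - f (r *: w))).
    exact: integrableRB.
  have id2 : sigma.-integrable setT (EFin \o (fun w => (u (r *: w) - f (r *: w)) ^+ 2)).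
    apply: le_integrableR (integrableRZ 2 (integrableRD iu2 ig2)).
      by apply: measurable_funX; apply: measurable_funB; exact: mscale_f.
    move=> w; rewrite ger0_norm ?sqr_ge0//.
    have := sqr_ge0 (u (r *: w) + f (r *: w)); nra.
  have fE : \int[sigma]_w f (r *: w) = 0.
    by rewrite -sphere_Rintegral_esphere//; exact: mscale_f.
  have uE : \int[sigma]_w u (r *: w) = \int[sigma]_w (u (r *: w) - f (r *: w)).
    by rewrite RintegralB// fE subr0.
  rewrite integral_Rintegral// -!EFinM lee_fin ler_wpM2l// uE.
  exact: sphere_sqr_mean.
under eq_integral => x _ do rewrite muleCA.
rewrite ge0_integralZl//; last 3 first.
- by apply: emeasurable_funM => //; exact: (measurable_sphere_weight muf uf0).
- by move=> x _; rewrite mule_ge0 ?lee_fin// integral_ge0.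
- by rewrite lee_fin ltW.
rewrite -(polar_weight mW W0 muf uf0) muleA -EFinM -expr2.
by under [X in (_ <= _ * X)%E]eq_integral => x _ do rewrite EFinM.
Qed.

(** Integrates an inequality known on each sphere of positive radius against a radial weight; the
    condition [W 0 = 0] settles the origin, through which there is no sphere. *)
Lemma integrate_spheres (u1 u2 u : 'rV[R]_n -> R) W (c1 c2 : R) : 0 <= c1 -> 0 <= c2 ->
  measurable_fun setT u1 -> measurable_fun setT u2 -> 
  (forall x, 0 <= u1 x) -> (forall x, 0 <= u2 x) ->
  measurable_fun setT (fun x => \int[sigma]_w u (enorm x *: w)) ->
  measurable_fun setT W -> (forall r, 0 <= W r) -> W 0 = 0 ->
  (forall r, 0 < r -> (c1%:E * \int[sigma]_w (u1 (r *: w))%:E <=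
    \int[sigma]_w (u2 (r *: w))%:E + c2%:E * ((\int[sigma]_w u (r *: w)) ^+ 2)%:E)%E) ->
  (c1%:E * (S%:E * \int[mu]_x (W (enorm x) * u1 x)%:E) <=
   S%:E * \int[mu]_x (W (enorm x) * u2 x)%:E +
   c2%:E * \int[mu]_x (W (enorm x) * (\int[sigma]_w u (enorm x *: w)) ^+ 2)%:E)%E.
Proof.
move=> c10 c20 m1 m2 u10 u20 mm mW W0 W00 H.
have e1 : measurable_fun setT (EFin \o u1) by exact/measurable_EFinP.
have e2 : measurable_fun setT (EFin \o u2) by exact/measurable_EFinP.
have p1 x : (0 <= (EFin \o u1) x)%E by rewrite lee_fin.
have p2 x : (0 <= (EFin \o u2) x)%E by rewrite lee_fin.
have mWe : measurable_fun setT (fun x => (W (enorm x))%:E).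
  by apply/measurable_EFinP; apply: (measurableT_comp mW); exact: measurable_enorm.
have mi1 := measurable_sphere_weight e1 p1.
have mi2 := measurable_sphere_weight e2 p2.
have q1 (r : R) : (0 <= \int[sigma]_w (u1 (r *: w))%:E)%E by apply: integral_ge0 => w _; rewrite lee_fin.
have q2 (r : R) : (0 <= \int[sigma]_w (u2 (r *: w))%:E)%E by apply: integral_ge0 => w _; rewrite lee_fin.
have mq : measurable_fun setT (fun x => (W (enorm x) * (\int[sigma]_w u (enorm x *: w)) ^+ 2)%:E).
  apply/measurable_EFinP; apply: measurable_funM; last exact: measurable_funX.
  by apply: (measurableT_comp mW); exact: measurable_enorm.
have q0 x : (0 <= (W (enorm x) * (\int[sigma]_w u (enorm x *: w)) ^+ 2)%:E)%E.
  by rewrite lee_fin mulr_ge0// sqr_ge0.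
under eq_integral => x _ do rewrite EFinM.
under [X in (_ <= _ * X + _)%E]eq_integral => x _ do rewrite EFinM.
rewrite (polar_weight mW W0 e1 p1) (polar_weight mW W0 e2 p2) /=.
rewrite -!ge0_integralZl//; last 2 first.
- by apply: emeasurable_funM.
- by move=> x _; rewrite mule_ge0// lee_fin.
rewrite -ge0_integralD//; last 4 first.
- by move=> x _; rewrite mule_ge0// lee_fin.
- by apply: emeasurable_funM.
- by move=> x _; rewrite mule_ge0// lee_fin.
- exact: measurable_funeM.
apply: ge0_le_integral => //.
- by move=> x _; rewrite !mule_ge0// lee_fin.
- by apply: measurable_funeM; exact: emeasurable_funM.
- by apply: emeasurable_funD; [exact: emeasurable_funM|exact: measurable_funeM].
move=> x _; have [x0|x0] := eqVneq x 0.
  have -> : enorm x = 0 by apply/eqP; rewrite enorm_eq0 x0.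
  by rewrite W00 !mul0e !mul0r !mule0 adde0.
have r0 : 0 < enorm x by rewrite enorm_gt0.
rewrite muleCA (EFinM (W _)) [in X in (_ <= _ + X)%E]muleCA -ge0_muleDr//; last first.
  by rewrite mule_ge0// lee_fin ?sqr_ge0.
apply: lee_wpmul2l; first by rewrite lee_fin.
exact: H.
Qed.

End spherical_means.

(** * Tensorization of the variance *)

Lemma mul_sqr_ge0 (R : realDomainType) (a b c : R) : 0 <= a -> 0 <= b -> 0 <= a * b * c ^+ 2.
Proof. by move=> a0 b0; apply: mulr_ge0; [exact: mulr_ge0|exact: sqr_ge0]. Qed.

(** The halving that ends the tensorization argument, where the integrals may be infinite. *)
Lemma adde_double_le (R : realType) (V A B : \bar R) : (0 <= V -> 0 <= A -> 0 <= B ->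
  V + V <= (A + A) + (B + B) -> V <= A + B)%E.
Proof.
case: A => [a| |] //; case: B => [b| |] //; rewrite ?addey ?addye ?leey//.
by case: V => [v| |]//; rewrite -!EFinD !lee_fin => *; lra.
Qed.

Lemma ge0_le_integral_quad d (T : measurableType d) (R : realType) (m : {measure set T -> \bar R})
    (f1 f2 g1 g2 g3 g4 : T -> \bar R) :
  measurable_fun setT f1 -> measurable_fun setT f2 -> measurable_fun setT g1 ->
  measurable_fun setT g2 -> measurable_fun setT g3 -> measurable_fun setT g4 ->
  (forall x, 0 <= f1 x)%E -> (forall x, 0 <= f2 x)%E -> (forall x, 0 <= g1 x)%E ->
  (forall x, 0 <= g2 x)%E -> (forall x, 0 <= g3 x)%E -> (forall x, 0 <= g4 x)%E ->
  (forall x, f1 x + f2 x <= (g1 x + g2 x) + (g3 x + g4 x))%E ->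
  (\int[m]_x f1 x + \int[m]_x f2 x <=
   (\int[m]_x g1 x + \int[m]_x g2 x) + (\int[m]_x g3 x + \int[m]_x g4 x))%E.
Proof.
move=> mf1 mf2 mg1 mg2 mg3 mg4 f10 f20 g10 g20 g30 g40 H.
have mg12 := emeasurable_funD mg1 mg2; have mg34 := emeasurable_funD mg3 mg4.
rewrite -!ge0_integralD//; last 2 first.
- by move=> x _; rewrite adde_ge0.
- by move=> x _; rewrite adde_ge0.
apply: ge0_le_integral => //.
- by move=> x _; rewrite adde_ge0.
- exact: emeasurable_funD.
- exact: emeasurable_funD.
Qed.

(* The library's sigma-finiteness of product measures is shadowed by its
   instance for finite measures. *)
Section square_measure.
Context d (T : measurableType d) {R : realType} (m : {sigma_finite_measure set T -> \bar R}).

Definition square_measure : set (T * T) -> \bar R := (m \x m)%E.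

HB.instance Definition _ := Measure.on square_measure.

Let square_measure_sigma_finite : sigma_finite setT square_measure.
Proof.
have /sigma_finiteP[F [FT ndF Foo]] := sigma_finiteT m.
exists (fun k => F k `*` F k).
  apply/esym; rewrite -subTset => -[x y] _.
  have [i _ Fi] : (\bigcup_i F i) x by rewrite -FT.
  have [j _ Fj] : (\bigcup_i F i) y by rewrite -FT.
  exists (maxn i j) => //; split.
    by move: Fi; exact/subsetPset/ndF/leq_maxl.
  by move: Fj; exact/subsetPset/ndF/leq_maxr.
move=> k; have [mFk Fk] := Foo k; split; first exact: measurableX.
by rewrite [square_measure _]product_measure1E// lte_mul_pinfty// ge0_fin_numE.
Qed.

HB.instance Definition _ := Measure_isSigmaFinite.Build _ _ _ square_measure
  square_measure_sigma_finite.

Lemma integral_square_measure (g : T * T -> \bar R) :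
  measurable_fun setT g -> (forall q, 0 <= g q)%E ->
  (\int[square_measure]_q g q = \int[m]_x \int[m]_y g (x, y))%E.
Proof. exact: fubini_tonelli1. Qed.

Lemma integral_square_measure_swap (g : T * T -> \bar R) :
  measurable_fun setT g -> (forall q, 0 <= g q)%E ->
  (\int[square_measure]_q g (q.2, q.1) = \int[square_measure]_q g q)%E.
Proof.
move=> mg g0; rewrite !integral_square_measure//; first by rewrite -fubini_tonelli.
by apply: (measurableT_comp mg); apply/measurable_fun_pair; [exact: measurable_snd|exact: measurable_fst].
Qed.

End square_measure.

Section tensorization.
Context d1 d2 (T1 : measurableType d1) (T2 : measurableType d2) {R : realType}.
Variables (m1 : {sigma_finite_measure set T1 -> \bar R})
  (m2 : {sigma_finite_measure set T2 -> \bar R}).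
Variables (w1 : T1 -> R) (w2 : T2 -> R) (h : T1 * T2 -> R).
Hypotheses (mw1 : measurable_fun setT w1) (mw2 : measurable_fun setT w2)
  (mh : measurable_fun setT h) (w1_ge0 : forall s, 0 <= w1 s) (w2_ge0 : forall x, 0 <= w2 x)
  (int_w1 : (\int[m1]_s (w1 s)%:E = 1)%E) (int_w2 : (\int[m2]_x (w2 x)%:E = 1)%E).
Implicit Types (s t : T1) (x y : T2) (p q : T1 * T2).

Let K s t x y a : \bar R := (w1 s * w1 t * (w2 x * w2 y) * a ^+ 2)%:E.

Let K0 s t x y a : (0 <= K s t x y a)%E.
Proof. by rewrite /K lee_fin; apply: mul_sqr_ge0; exact: mulr_ge0. Qed.

Let mK d (T : measurableType d) (fs ft : T -> T1) (fx fy : T -> T2) (fa : T -> R) :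
  measurable_fun setT fs -> measurable_fun setT ft -> measurable_fun setT fx ->
  measurable_fun setT fy -> measurable_fun setT fa ->
  measurable_fun setT (fun z => K (fs z) (ft z) (fx z) (fy z) (fa z)).
Proof.
move=> ms mt mx my ma; apply/measurable_EFinP; apply: measurable_funM; last exact: measurable_funX.
apply: measurable_funM; apply: measurable_funM.
- exact: (measurableT_comp mw1 ms).
- exact: (measurableT_comp mw1 mt).
- exact: (measurableT_comp mw2 mx).
- exact: (measurableT_comp mw2 my).
Qed.

Let mhp d (T : measurableType d) (fs : T -> T1) (fx : T -> T2) :
  measurable_fun setT fs -> measurable_fun setT fx -> measurable_fun setT (fun z => h (fs z, fx z)).
Proof. by move=> ms mx; exact: (measurableT_comp mh (measurable_fun_pair ms mx)). Qed.

(** Twice the variance of [u] under the density [w], in a symmetric form that has a value in the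
    extended reals for every measurable [u]. *)
Definition pair_var d (T : measurableType d) (m : set T -> \bar R) (w : T -> R) (u : T -> R) : \bar R :=
  (\int[m]_x \int[m]_y (w x * w y * (u x - u y) ^+ 2)%:E)%E.

Let M1 := square_measure m1.
Let M2 := square_measure m2.

Let J (a : T1 -> T1 -> T2 -> T2 -> R) : \bar R :=
  (\int[M1]_p \int[M2]_q K p.1 p.2 q.1 q.2 (a p.1 p.2 q.1 q.2))%E.

Let ma4 (f1 f2 : T1 * T1 -> T1) (g1 g2 : T2 * T2 -> T2) :
  measurable_fun setT f1 -> measurable_fun setT f2 -> measurable_fun setT g1 -> measurable_fun setT g2 ->
  measurable_fun setT (fun z : (T1 * T1) * (T2 * T2) =>
    K z.1.1 z.1.2 z.2.1 z.2.2 (h (f1 z.1, g1 z.2) - h (f2 z.1, g2 z.2))).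
Proof.
move=> mf1 mf2 mg1 mg2.
have m1' : measurable_fun setT (fun z : (T1 * T1) * (T2 * T2) => z.1) by exact: measurable_fst.
have m2' : measurable_fun setT (fun z : (T1 * T1) * (T2 * T2) => z.2) by exact: measurable_snd.
apply: mK.
- exact: (measurableT_comp measurable_fst m1').
- exact: (measurableT_comp measurable_snd m1').
- exact: (measurableT_comp measurable_fst m2').
- exact: (measurableT_comp measurable_snd m2').
apply: measurable_funB; apply: mhp.
- exact: (measurableT_comp mf1 m1').
- exact: (measurableT_comp mg1 m2').
- exact: (measurableT_comp mf2 m1').
- exact: (measurableT_comp mg2 m2').
Qed.

Let mJ (f1 f2 : T1 * T1 -> T1) (g1 g2 : T2 * T2 -> T2) :
  measurable_fun setT f1 -> measurable_fun setT f2 -> measurable_fun setT g1 -> measurable_fun setT g2 ->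
  measurable_fun setT (fun p : T1 * T1 => \int[M2]_q
    K p.1 p.2 q.1 q.2 (h (f1 p, g1 q) - h (f2 p, g2 q)))%E.
Proof.
move=> mf1 mf2 mg1 mg2; have H := ma4 mf1 mf2 mg1 mg2.
set G := (fun z => _) in H; have G0 z : (0 <= G z)%E by exact: K0.
exact: (@measurable_fun_fubini_tonelli_F _ _ _ _ _ M2 G H G0).
Qed.

Let mJ1 (f1 f2 : T1 * T1 -> T1) (g1 g2 : T2 * T2 -> T2) (p : T1 * T1) :
  measurable_fun setT f1 -> measurable_fun setT f2 -> measurable_fun setT g1 -> measurable_fun setT g2 ->
  measurable_fun setT (fun q : T2 * T2 =>
    K p.1 p.2 q.1 q.2 (h (f1 p, g1 q) - h (f2 p, g2 q)))%E.
Proof.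
move=> mf1 mf2 mg1 mg2; have H := ma4 mf1 mf2 mg1 mg2.
exact: (measurableT_comp H (pair1_measurable p)).
Qed.

Let J_swap : J (fun s t x y => h (s, y) - h (t, x)) = J (fun s t x y => h (s, x) - h (t, y)).
Proof.
rewrite /J; apply: eq_integral => p _.
have mG := mJ1 p measurable_fst measurable_snd measurable_fst measurable_snd.
rewrite -[RHS](integral_square_measure_swap m2 mG); last by move=> q; exact: K0.
by apply: eq_integral => q _ /=; rewrite /K [w2 q.1 * _]mulrC.
Qed.

Let J_x1 : J (fun s t x y => h (s, x) - h (s, y)) =
  (\int[m1]_s ((w1 s)%:E * pair_var m2 w2 (fun x => h (s, x))))%E.
Proof.
have m4 := ma4 measurable_fst measurable_fst measurable_fst measurable_snd.
rewrite /J integral_square_measure; last 2 first.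
- exact: (mJ measurable_fst measurable_fst measurable_fst measurable_snd).
- by move=> p; apply: integral_ge0 => q _; exact: K0.
apply: eq_integral => s _.
have mV : measurable_fun setT (fun q : T2 * T2 => (w2 q.1 * w2 q.2 * (h (s, q.1) - h (s, q.2)) ^+ 2)%:E).
  apply/measurable_EFinP; apply: measurable_funM; first apply: measurable_funM.
  - exact: (measurableT_comp mw2 measurable_fst).
  - exact: (measurableT_comp mw2 measurable_snd).
  apply: measurable_funX; apply: measurable_funB; exact: mhp.
have V0 (q : T2 * T2) : (0 <= (w2 q.1 * w2 q.2 * (h (s, q.1) - h (s, q.2)) ^+ 2)%:E)%E.
  by rewrite lee_fin; exact: mul_sqr_ge0.
transitivity (\int[m1]_t ((w1 t)%:E * ((w1 s)%:E * pair_var m2 w2 (fun x => h (s, x)))))%E.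
  apply: eq_integral => t _; rewrite muleA -EFinM mulrC.
  rewrite /pair_var -[X in (_ * X)%E](integral_square_measure m2 mV V0).
  rewrite -ge0_integralZl; [|exact: measurableT|exact: mV|by move=> q _; exact: V0|by rewrite lee_fin mulr_ge0].
  by apply: eq_integral => q _; rewrite /K -EFinM !mulrA.
rewrite ge0_integralZr; last 4 first.
- exact: measurableT.
- exact/measurable_EFinP.
- by move=> t _; rewrite lee_fin.
- apply: mule_ge0; first by rewrite lee_fin.
  by apply: integral_ge0 => x _; apply: integral_ge0 => y _; rewrite lee_fin; exact: mul_sqr_ge0.
by rewrite int_w1 mul1e.
Qed.

Let J_x2 : J (fun s t x y => h (t, x) - h (t, y)) =
  (\int[m1]_s ((w1 s)%:E * pair_var m2 w2 (fun x => h (s, x))))%E.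
Proof.
have mG := mJ measurable_fst measurable_fst measurable_fst measurable_snd.
rewrite -J_x1 /J -[RHS](integral_square_measure_swap m1 mG); last first.
  by move=> p; apply: integral_ge0 => q _; exact: K0.
apply: eq_integral => p _; apply: eq_integral => q _ /=.
by rewrite /K [w1 p.1 * _]mulrC.
Qed.

Let J_t1 : J (fun s t x y => h (s, x) - h (t, x)) =
  (\int[m2]_x ((w2 x)%:E * pair_var m1 w1 (fun s => h (s, x))))%E.
Proof.
have m4 := ma4 measurable_fst measurable_snd measurable_fst measurable_fst.
rewrite /J (fubini_tonelli (m1 := M1) (m2 := M2) _ m4); last by move=> z; exact: K0.
rewrite integral_square_measure; last 2 first.
- by apply: (measurable_fun_fubini_tonelli_G _ m4) => z; exact: K0.
- by move=> q; apply: integral_ge0 => p _; exact: K0.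
apply: eq_integral => x _.
have mV : measurable_fun setT (fun q : T1 * T1 => (w1 q.1 * w1 q.2 * (h (q.1, x) - h (q.2, x)) ^+ 2)%:E).
  apply/measurable_EFinP; apply: measurable_funM; first apply: measurable_funM.
  - exact: (measurableT_comp mw1 measurable_fst).
  - exact: (measurableT_comp mw1 measurable_snd).
  apply: measurable_funX; apply: measurable_funB; exact: mhp.
have V0 (q : T1 * T1) : (0 <= (w1 q.1 * w1 q.2 * (h (q.1, x) - h (q.2, x)) ^+ 2)%:E)%E.
  by rewrite lee_fin; exact: mul_sqr_ge0.
transitivity (\int[m2]_y ((w2 y)%:E * ((w2 x)%:E * pair_var m1 w1 (fun s => h (s, x)))))%E.
  apply: eq_integral => y _; rewrite muleA -EFinM mulrC.
  rewrite /pair_var -[X in (_ * X)%E](integral_square_measure m1 mV V0).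
  rewrite -ge0_integralZl; [|exact: measurableT|exact: mV|by move=> q _; exact: V0|by rewrite lee_fin mulr_ge0].
  by apply: eq_integral => p _; rewrite /K -EFinM; congr EFin; ring.
rewrite ge0_integralZr; last 4 first.
- exact: measurableT.
- exact/measurable_EFinP.
- by move=> t _; rewrite lee_fin.
- apply: mule_ge0; first by rewrite lee_fin.
  by apply: integral_ge0 => s _; apply: integral_ge0 => t _; rewrite lee_fin; exact: mul_sqr_ge0.
by rewrite int_w2 mul1e.
Qed.

Let J_t2 : J (fun s t x y => h (s, y) - h (t, y)) =
  (\int[m2]_x ((w2 x)%:E * pair_var m1 w1 (fun s => h (s, x))))%E.
Proof.
rewrite -J_t1 /J; apply: eq_integral => p _.
have mG := mJ1 p measurable_fst measurable_snd measurable_fst measurable_fst.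
rewrite -[RHS](integral_square_measure_swap m2 mG); last by move=> q; exact: K0.
by apply: eq_integral => q _ /=; rewrite /K [w2 q.1 * _]mulrC.
Qed.

(* the sum of the squares of the diagonals of a quadrilateral is at most the
   sum of the squares of its sides *)
Let J_quadrilateral :
  (J (fun s t x y => (h (s, x) - h (t, y))%R) + J (fun s t x y => (h (s, y) - h (t, x))%R) <=
   (J (fun s t x y => (h (s, x) - h (s, y))%R) + J (fun s t x y => (h (t, x) - h (t, y))%R)) +
   (J (fun s t x y => (h (s, x) - h (t, x))%R) + J (fun s t x y => (h (s, y) - h (t, y))%R)))%E.
Proof.
have F1 : measurable_fun setT (@fst T1 T1) by exact: measurable_fst.
have S1 : measurable_fun setT (@snd T1 T1) by exact: measurable_snd.
have F2 : measurable_fun setT (@fst T2 T2) by exact: measurable_fst.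
have S2 : measurable_fun setT (@snd T2 T2) by exact: measurable_snd.
have A1 := mJ F1 S1 F2 S2; have A2 := mJ F1 S1 S2 F2.
have B1 := mJ F1 F1 F2 S2; have B2 := mJ S1 S1 F2 S2.
have B3 := mJ F1 S1 F2 F2; have B4 := mJ F1 S1 S2 S2.
refine (@ge0_le_integral_quad _ _ _ M1 _ _ _ _ _ _ A1 A2 B1 B2 B3 B4 _ _ _ _ _ _ _) => p;
  [by apply: integral_ge0 => q _; exact: K0..|].
have a1 := mJ1 p F1 S1 F2 S2; have a2 := mJ1 p F1 S1 S2 F2.
have b1 := mJ1 p F1 F1 F2 S2; have b2 := mJ1 p S1 S1 F2 S2.
have b3 := mJ1 p F1 S1 F2 F2; have b4 := mJ1 p F1 S1 S2 S2.
refine (@ge0_le_integral_quad _ _ _ M2 _ _ _ _ _ _ a1 a2 b1 b2 b3 b4 _ _ _ _ _ _ _) => q; [exact: K0..|].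
move: q => [x y]; rewrite /K -!EFinD lee_fin -!mulrDr ler_wpM2l ?mulr_ge0//=.
rewrite -subr_ge0; set A := h (p.1, x); set B := h (p.1, y); set C := h (p.2, x); set D := h (p.2, y).
have -> : (A - B) ^+ 2 + (C - D) ^+ 2 + ((A - C) ^+ 2 + (B - D) ^+ 2) -
  ((A - D) ^+ 2 + (B - C) ^+ 2) = (A - B - C + D) ^+ 2 by ring.
exact: sqr_ge0.
Qed.

(** The Efron-Stein inequality for two independent variables. Exchanging [x] and [y] shows that the
    two diagonals of the array with rows [s, t] and columns [x, y] have equal integrals; likewise
    for each pair of opposite sides. The quadrilateral inequality is then twice the claim. *)
Lemma pair_var_tensor :
  (\int[m1]_s \int[m1]_t \int[m2]_x \int[m2]_y
     (w1 s * w1 t * (w2 x * w2 y) * (h (s, x) - h (t, y)) ^+ 2)%:E <=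
   \int[m1]_s ((w1 s)%:E * pair_var m2 w2 (fun x => h (s, x))) +
   \int[m2]_x ((w2 x)%:E * pair_var m1 w1 (fun s => h (s, x))))%E.
Proof.
have H := J_quadrilateral; rewrite J_swap J_x1 J_x2 J_t1 J_t2 in H.
have <- : J (fun s t x y => h (s, x) - h (t, y)) = (\int[m1]_s \int[m1]_t \int[m2]_x \int[m2]_y
     (w1 s * w1 t * (w2 x * w2 y) * (h (s, x) - h (t, y)) ^+ 2)%:E)%E.
  have mG := mJ measurable_fst measurable_snd measurable_fst measurable_snd.
  rewrite /J integral_square_measure; last 2 first.
  - exact: mG.
  - by move=> p; apply: integral_ge0 => q _; exact: K0.
  apply: eq_integral => s _; apply: eq_integral => t _ /=.
  rewrite integral_square_measure; [by []| |by move=> q; exact: K0].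
  exact: (mJ1 (s, t) measurable_fst measurable_snd measurable_fst measurable_snd).
apply: adde_double_le H.
- by apply: integral_ge0 => p _; apply: integral_ge0 => q _; exact: K0.
- apply: integral_ge0 => s _; apply: mule_ge0; first by rewrite lee_fin.
  by apply: integral_ge0 => x _; apply: integral_ge0 => y _; rewrite lee_fin; exact: mul_sqr_ge0.
- apply: integral_ge0 => x _; apply: mule_ge0; first by rewrite lee_fin.
  by apply: integral_ge0 => s _; apply: integral_ge0 => t _; rewrite lee_fin; exact: mul_sqr_ge0.
Qed.

End tensorization.

Lemma measurable_pair_var d1 d2 (T1 : measurableType d1) (T2 : measurableType d2) {R : realType}
    (m : {sigma_finite_measure set T2 -> \bar R}) (w : T2 -> R) (h : T1 * T2 -> R) :
  measurable_fun setT w -> (forall x, 0 <= w x) -> measurable_fun setT h ->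
  measurable_fun setT (fun s => pair_var m w (fun x => h (s, x))).
Proof.
move=> mw w0 mh.
pose k (z : (T1 * T2) * T2) : \bar R := (w z.1.2 * w z.2 * (h z.1 - h (z.1.1, z.2)) ^+ 2)%:E.
have k0 z : (0 <= k z)%E by rewrite lee_fin; exact: mul_sqr_ge0.
have m1 : measurable_fun setT (fun z : (T1 * T2) * T2 => z.1) by exact: measurable_fst.
have m2 : measurable_fun setT (fun z : (T1 * T2) * T2 => z.2) by exact: measurable_snd.
have mk : measurable_fun setT k.
  apply/measurable_EFinP; apply: measurable_funM; first apply: measurable_funM.
  - exact: (measurableT_comp mw (measurableT_comp measurable_snd m1)).
  - exact: (measurableT_comp mw m2).
  apply: measurable_funX; apply: measurable_funB; first exact: (measurableT_comp mh m1).
  exact: (measurableT_comp mh (measurable_fun_pair (measurableT_comp measurable_fst m1) m2)).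
have H1 := measurable_fun_fubini_tonelli_F (m2 := m) k mk k0.
have H10 p : (0 <= fubini_F m k p)%E by apply: integral_ge0 => y _; exact: k0.
exact: (measurable_fun_fubini_tonelli_F (m2 := m) _ H1 H10).
Qed.

Section pair_var_upper_bound.
Context d (T : measurableType d) {R : realType} (m : {measure set T -> \bar R}).
Variables (w h : T -> R).
Hypotheses (mw : measurable_fun setT w) (mh : measurable_fun setT h) (w_ge0 : forall x, 0 <= w x)
  (int_w : (\int[m]_x (w x)%:E = 1)%E).

Let int_w_lin (a b e : R) (f g k : T -> R) : m.-integrable setT (EFin \o f) ->
  m.-integrable setT (EFin \o g) -> m.-integrable setT (EFin \o k) ->
  (\int[m]_x (a * f x + b * g x + e * k x)%:E =
   (a * \int[m]_x f x + b * \int[m]_x g x + e * \int[m]_x k x)%:E)%E.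
Proof.
move=> i1 i2 i3.
have j1 := integrableRZ a i1; have j2 := integrableRZ b i2; have j3 := integrableRZ e i3.
have j12 := integrableRD j1 j2.
rewrite integral_Rintegral; last exact: integrableRD.
by rewrite RintegralD// RintegralD// !RintegralZl.
Qed.

(** The formula of Koenig and Huygens with centre [c]. Being an equality, it later preserves the
    squared mean in the inequality on spheres. *)
Lemma pair_varE (c : R) : m.-integrable setT (EFin \o (fun x => w x * (h x - c) ^+ 2)) ->
  (pair_var m w h = (2 * \int[m]_x (w x * (h x - c) ^+ 2) -
    2 * (\int[m]_x (w x * (h x - c))) ^+ 2)%:E)%E.
Proof.
move=> i2; have i0 : m.-integrable setT (EFin \o w).
  by apply: ge0_integrableR => //; rewrite int_w ltry.
have i1 : m.-integrable setT (EFin \o (fun x => w x * (h x - c))).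
  apply: (le_integrableR _ _ (integrableRD i0 i2)).
    by apply: measurable_funM => //; exact: measurable_funB.
  move=> x; rewrite normrM ger0_norm// -[X in _ <= X + _]mulr1 -mulrDr ler_wpM2l//.
  by rewrite -normrX ger0_norm ?sqr_ge0// || by rewrite -real_normK ?num_real//; have := normr_ge0 (h x - c); nra.
have E0 : \int[m]_x w x = 1 by rewrite /Rintegral int_w.
set M1 := \int[m]_x (w x * (h x - c)); set M2 := \int[m]_x (w x * (h x - c) ^+ 2).
rewrite /pair_var.
transitivity (\int[m]_x (M2 * w x + 1 * (w x * (h x - c) ^+ 2) + (- 2 * M1) * (w x * (h x - c)))%:E)%E.
  apply: eq_integral => x _.
  transitivity (\int[m]_y ((w x * (h x - c) ^+ 2) * w y + (w x) * (w y * (h y - c) ^+ 2) +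
      (- 2 * w x * (h x - c)) * (w y * (h y - c)))%:E)%E.
    by apply: eq_integral => y _; congr EFin; ring.
  by rewrite int_w_lin// E0 -/M1 -/M2; congr EFin; ring.
by rewrite int_w_lin// E0 -/M1 -/M2; congr EFin; ring.
Qed.

Lemma pair_var_le (c : R) : (pair_var m w h <= 2%:E * \int[m]_x (w x * (h x - c) ^+ 2)%:E)%E.
Proof.
have m2 : measurable_fun setT (fun x => w x * (h x - c) ^+ 2).
  by apply: measurable_funM => //; apply: measurable_funX; exact: measurable_funB.
have p2 x : 0 <= w x * (h x - c) ^+ 2 by rewrite mulr_ge0// sqr_ge0.
have [foo|] := ltP (\int[m]_x (w x * (h x - c) ^+ 2)%:E)%E +oo%E.
  have i2 := ge0_integrableR m2 p2 foo.
  rewrite (pair_varE i2) integral_Rintegral// -EFinM lee_fin.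
  by have := sqr_ge0 (\int[m]_x (w x * (h x - c))); lra.
by rewrite leye_eq => /eqP ->; rewrite gt0_muley ?leey// lte_fin.
Qed.

End pair_var_upper_bound.

(** * The Gaussian Poincare inequality on the line *)

Lemma integral_FTC {R : realType} (F f : R -> R) (a b : R) : a < b ->
  (forall x, a <= x <= b -> is_derive x 1 F (f x)) ->
  (forall x, a <= x <= b -> {for x, continuous f}) ->
  (\int[@lebesgue_measure R]_(x in `[a, b]) (f x)%:E = (F b - F a)%:E)%E.
Proof.
move=> ab DF cf; rewrite (@continuous_FTC2 _ f F)//.
- by apply: continuous_in_subspaceT => x; rewrite inE/= in_itv/= => /cf.
- split.
  + by move=> x; rewrite in_itv/= => /andP[ax xb]; have [] := DF x; rewrite ?(ltW ax) ?(ltW xb).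
  + by apply: cvg_at_right_filter; apply: is_derive_continuous (DF a _); rewrite lexx ltW.
  + by apply: cvg_at_left_filter; apply: is_derive_continuous (DF b _); rewrite lexx ltW.
- move=> x; rewrite in_itv/= => /andP[ax xb]; rewrite derive1E.
  by have [] := DF x; rewrite ?(ltW ax) ?(ltW xb).
Qed.

Section gaussian_line.
Context {R : realType}.
Local Notation leb := (@lebesgue_measure R).

Definition gauss (t : R) : R := normal_pdf 0 1 t.

Lemma gaussE t : gauss t = normal_peak (1 : R) * expR (- (t ^+ 2 / 2)).
Proof.
rewrite /gauss normal_pdfE ?oner_neq0// /normal_fun subr0 expr1n.
by rewrite mulNr (_ : (1 *+ 2 : R) = 2)//.
Qed.

Lemma gauss_ge0 t : 0 <= gauss t.
Proof. exact: normal_pdf_ge0. Qed.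

Lemma measurable_gauss : measurable_fun setT gauss.
Proof. exact: measurable_normal_pdf. Qed.

Lemma integral_gauss : (\int[leb]_t (gauss t)%:E = 1)%E.
Proof. exact: integral_normal_pdf. Qed.

Lemma is_derive_gauss (t : R) : is_derive t 1 gauss (- (t * gauss t)).
Proof.
rewrite (_ : gauss = fun t => normal_peak (1 : R) * expR (- (t ^+ 2 / 2))); last first.
  by apply/funext => u; rewrite gaussE.
have Di : is_derive t 1 (id : R -> R) 1 by exact: is_derive_id.
have D1 : is_derive t 1 (fun u : R => (- 2^-1) * (u * u)) ((- 2^-1) * (1 * t + t * 1)).
  exact: is_derive_cst_mul (is_derive_mul Di Di).
have D2 : is_derive t 1 (fun u : R => expR (- (u ^+ 2 / 2)))
    (expR (- (t ^+ 2 / 2)) * ((- 2^-1) * (1 * t + t * 1))).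
  rewrite (_ : (fun u => _) = fun u : R => expR ((- 2^-1) * (u * u))); last first.
    by apply/funext => u; congr expR; rewrite expr2; ring.
  rewrite (_ : - (t ^+ 2 / 2) = (- 2^-1) * (t * t)); last by rewrite expr2; ring.
  exact: is_derive_comp1 (is_derive_expR _) D1.
by apply: is_derive_eq (is_derive_cst_mul _ D2) _; field.
Qed.

Lemma continuous_gauss : continuous gauss.
Proof. by move=> t; exact: is_derive_continuous (is_derive_gauss t). Qed.


(** From [exp s >= 1 + s] at [s = t^2 / 2]. It controls the boundary terms in the computation of the
    second moment. *)
Lemma gauss_mul_le t : 0 < t -> t * gauss t <= normal_peak (1 : R) * 2 / t.
Proof.
move=> t0; have P0 := normal_peak_ge0 (1 : R).
rewrite gaussE expRN ler_pdivlMr//.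
have s0 : 0 < t ^+ 2 / 2 by rewrite divr_gt0// exprn_gt0.
have E : 1 + t ^+ 2 / 2 <= expR (t ^+ 2 / 2) by exact: expR_ge1Dx.
have x0 : 0 < expR (t ^+ 2 / 2) by exact: expR_gt0.
rewrite -[X in X <= _](_ : normal_peak 1 * (t ^+ 2 / expR (t ^+ 2 / 2)) = _); last first.
  by rewrite expr2; ring.
by apply: ler_wpM2l => //; rewrite ler_pdivrMr//; lra.
Qed.

Section poincare.
Variables (h h' : R -> R).
Hypotheses (Dh : forall t : R, is_derive t 1 h (h' t)) (ch' : continuous h').

Let H t := h t - h 0.
(** The boundary term of the integration by parts. It tends to 0 at the origin because [H 0 = 0],
    and it has the sign of [t], which is favourable at both far ends. *)
Let F t := gauss t * (H t * H t) * t^-1.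

Let DH (t : R) : is_derive t 1 H (h' t).
Proof.
have Dc : is_derive t 1 (fun=> - h 0) 0 by exact: is_derive_cst.
have := is_derive_add (Dh t) Dc.
by rewrite addr0.
Qed.

Let ch : continuous h. Proof. by move=> t; exact: is_derive_continuous (Dh t). Qed.
Let cH : continuous H. Proof. by move=> t; exact: is_derive_continuous (DH t). Qed.

Let f t := - (t * gauss t) * (H t * H t) * t^-1 + gauss t * (2 * h' t * H t) * t^-1 -
  gauss t * (H t * H t) * (t^-1 * t^-1).

Let DF (t : R) : t != 0 -> is_derive t 1 F (f t).
Proof.
move=> t0.
have Di : is_derive t 1 (id : R -> R) 1 by exact: is_derive_id.
have D1 := is_derive_mul (is_derive_mul (is_derive_gauss t) (is_derive_mul (DH t) (DH t)))
  (is_derive_inv t0 Di).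
apply: is_derive_eq D1 _; rewrite /f -exprVn expr2; ring.
Qed.

Let cinv (t : R) : t != 0 -> {for t, continuous (fun u : R => u^-1)}.
Proof. by move=> t0; exact: inv_continuous. Qed.

Let cf (t : R) : t != 0 -> {for t, continuous f}.
Proof.
move=> t0; have ci := cinv t0; have cg := @continuous_gauss t.
have cp : {for t, continuous (fun t : R => t * gauss t)} by apply: (@continuousM _ _ (id : R -> R) gauss) => //; exact: id_continuous.
have cHH : {for t, continuous (fun t : R => H t * H t)} by exact: (@continuousM _ _ H H _ (@cH t) (@cH t)).
have ch2 : {for t, continuous (fun t : R => 2 * h' t)} by apply: cvgMl_tmp; exact: ch'.
have chH : {for t, continuous (fun t : R => 2 * h' t * H t)} by exact: (@continuousM _ _ (fun t : R => 2 * h' t) H _ ch2 (@cH t)).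
have cii : {for t, continuous (fun t : R => t^-1 * t^-1)} by exact: (@continuousM _ _ (@GRing.inv R) (@GRing.inv R) _ ci ci).
apply: (@continuousB _ _ _ (fun t : R => - (t * gauss t) * (H t * H t) * t^-1 + gauss t * (2 * h' t * H t) * t^-1)
   (fun t : R => gauss t * (H t * H t) * (t^-1 * t^-1))).
  apply: (@continuousD _ _ _ (fun t : R => - (t * gauss t) * (H t * H t) * t^-1)
    (fun t : R => gauss t * (2 * h' t * H t) * t^-1)).
    apply: (@continuousM _ _ (fun t : R => - (t * gauss t) * (H t * H t)) (@GRing.inv R)) => //.
    apply: (@continuousM _ _ (fun t : R => - (t * gauss t)) (fun t : R => H t * H t)) => //.
    exact: (@continuousN _ _ _ (fun t : R => t * gauss t)).
  apply: (@continuousM _ _ (fun t : R => gauss t * (2 * h' t * H t)) (@GRing.inv R)) => //.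
  exact: (@continuousM _ _ gauss (fun t : R => 2 * h' t * H t)).
apply: (@continuousM _ _ (fun t : R => gauss t * (H t * H t)) (fun t : R => t^-1 * t^-1)) => //.
exact: (@continuousM _ _ gauss (fun t : R => H t * H t)).
Qed.

Let cu : continuous (fun t : R => gauss t * (H t) ^+ 2).
Proof.
move=> t; apply: (@continuousM _ _ gauss (fun t : R => H t ^+ 2)); first exact: continuous_gauss.
exact: (@continuousM _ _ H H _ (@cH t) (@cH t)).
Qed.

Let cv : continuous (fun t : R => gauss t * (h' t) ^+ 2).
Proof.
move=> t; apply: (@continuousM _ _ gauss (fun t : R => h' t ^+ 2)); first exact: continuous_gauss.
exact: (@continuousM _ _ h' h' _ (@ch' t) (@ch' t)).
Qed.

Let int_itv g a b : (forall t, a <= t <= b -> {for t, continuous g}) ->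
  leb.-integrable `[a, b] (EFin \o g).
Proof.
move=> cg; apply: continuous_compact_integrable; first exact: segment_compact.
by apply: continuous_in_subspaceT => x; rewrite inE/= in_itv/= => /cg.
Qed.

(* gauss (h' - H/t)^2 >= 0 says that gauss H^2 + (gauss H^2/t)' <= gauss h'^2 *)
Let piece a b : a < b -> (forall t, a <= t <= b -> t != 0) ->
  (\int[leb]_(t in `[a, b]) (gauss t * (H t) ^+ 2)%:E <=
   \int[leb]_(t in `[a, b]) (gauss t * (h' t) ^+ 2)%:E + (F a - F b)%:E)%E.
Proof.
move=> ab ab0.
have iu : leb.-integrable `[a, b] (EFin \o (fun t : R => gauss t * (H t) ^+ 2)) by apply: int_itv => t _; exact: cu.
have iv : leb.-integrable `[a, b] (EFin \o (fun t : R => gauss t * (h' t) ^+ 2)) by apply: int_itv => t _; exact: cv.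
have jf : leb.-integrable `[a, b] (EFin \o f) by apply: int_itv => t tab; exact: cf (ab0 _ tab).
have E := integral_FTC ab (fun t tab => DF (ab0 t tab)) (fun t tab => cf (ab0 t tab)).
have L : (\int[leb]_(t in `[a, b]) ((gauss t * (H t) ^+ 2)%:E + (f t)%:E) <=
    \int[leb]_(t in `[a, b]) (gauss t * (h' t) ^+ 2)%:E)%E.
  apply: le_integral => //; first exact: integrableD.
  move=> t; rewrite inE/= in_itv/= => /ab0 t0; rewrite lee_fin -subr_ge0.
  rewrite (_ : _ - _ = gauss t * (h' t - H t * t^-1) ^+ 2); last by rewrite /f; field.
  by rewrite mulr_ge0 ?gauss_ge0// sqr_ge0.
rewrite integralD// E in L.
have := leeD2r (F a - F b)%:E L; rewrite -addeA -EFinD (_ : F b - F a + (F a - F b) = 0); last by ring.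
by rewrite adde0.
Qed.

Let F_cvg0 : F t @[t --> 0^'] --> 0.
Proof.
have /is_deriveP D0 := Dh 0.
have cd : (t^-1 * H t) @[t --> 0^'] --> h' 0.
  rewrite (_ : (fun t : R => t^-1 * H t) = (fun t : R => t^-1 *: (h (t *: 1 + 0) - h 0)))//.
  by apply/funext => t; rewrite /GRing.scale/= mulr1 addr0.
have ci : t @[t --> (0 : R)^'] --> (0 : R) by exact: cvg_within.
have cg : gauss t @[t --> 0^'] --> gauss 0 by exact: (cvg_comp _ _ ci (@continuous_gauss 0)).
have := cvgM cg (cvgM (cvgM cd cd) ci); rewrite !mulr0 => C.
suff E : {near 0^', (fun t : R => gauss t * ((t^-1 * H t) * (t^-1 * H t) * t)) =1 F}.
  exact: cvg_trans (near_eq_cvg E) (C _ _ _).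
near=> t.
have t0 : t != 0 by near: t; exact: nbhs_dnbhs_neq.
by rewrite /F; field.
Unshelve. all: end_near. Qed.

Let a (j : nat) : R := j.+1%:R^-1.
(** [j.+2], so that [a j < b j] already for [j = 0]. *)
Let b (j : nat) : R := j.+2%:R.
Let I1 j : set R := `[- b j, - a j].
Let I2 j : set R := `[a j, b j].
Let S j := I1 j `|` I2 j.

Let a_gt0 j : 0 < a j. Proof. by rewrite invr_gt0. Qed.
Let ab j : a j < b j.
Proof. by rewrite (@le_lt_trans _ _ 1)// ?invf_le1// ?ltr1n// ler1n. Qed.

Let U (t : R) := (gauss t * (H t) ^+ 2)%:E.
Let V (t : R) := (gauss t * (h' t) ^+ 2)%:E.
Let U0 t : (0 <= U t)%E. Proof. by rewrite lee_fin mulr_ge0 ?gauss_ge0 ?sqr_ge0. Qed.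
Let V0 t : (0 <= V t)%E. Proof. by rewrite lee_fin mulr_ge0 ?gauss_ge0 ?sqr_ge0. Qed.
Let mU : measurable_fun setT U.
Proof. by apply/measurable_EFinP; exact: continuous_measurable_fun. Qed.
Let mV : measurable_fun setT V.
Proof. by apply/measurable_EFinP; exact: continuous_measurable_fun. Qed.

Let mI1 j : measurable (I1 j : set (measurableTypeR R)). Proof. exact: measurable_itv. Qed.
Let mI2 j : measurable (I2 j : set (measurableTypeR R)). Proof. exact: measurable_itv. Qed.
Let mS j : measurable (S j : set (measurableTypeR R)). Proof. exact: measurableU. Qed.

Let disjS j : [disjoint I1 j & I2 j].
Proof.
apply/disj_setPS => t []; rewrite /I1 /I2 /= !in_itv/= => /andP[_ t1] /andP[t2 _].
by have := a_gt0 j; lra.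
Qed.

Let int_S (W : measurableTypeR R -> \bar R) j : measurable_fun setT W -> (forall t, 0 <= W t)%E ->
  (\int[leb]_(t in S j) W t = \int[leb]_(t in I1 j) W t +
    \int[leb]_(t in I2 j) W t)%E.
Proof.
move=> mW W0; rewrite ge0_integral_setU//; exact: (measurable_funS measurableT).
Qed.

Let S_bound j : (\int[leb]_(t in S j) U t <= \int[leb]_t V t + (F (a j) - F (- a j))%R%:E)%E.
Proof.
have p1 : (\int[leb]_(t in I1 j) U t <=
    \int[leb]_(t in I1 j) V t + (F (- b j) - F (- a j))%R%:E)%E.
  apply: piece; first by rewrite ltrN2.
  by move=> t /andP[_ ta]; rewrite lt_eqF//; have := a_gt0 j; lra.
have p2 : (\int[leb]_(t in I2 j) U t <=
    \int[leb]_(t in I2 j) V t + (F (a j) - F (b j))%R%:E)%E.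
  apply: piece; first exact: ab.
  by move=> t /andP[ta _]; rewrite gt_eqF//; have := a_gt0 j; lra.
have b0 : 0 < b j by exact: lt_trans (ab j).
have Fb : 0 <= F (b j) by rewrite /F divr_ge0 ?(ltW b0)// mulr_ge0 ?gauss_ge0// -expr2 sqr_ge0.
have Fb' : F (- b j) <= 0.
  by rewrite /F invrN mulrN oppr_le0 divr_ge0 ?(ltW b0)// mulr_ge0 ?gauss_ge0// -expr2 sqr_ge0.
rewrite [leLHS](int_S j mU U0); apply: le_trans (leeD p1 p2) _.
have -> : (\int[leb]_(t in I1 j) V t + (F (- b j) - F (- a j))%R%:E +
   (\int[leb]_(t in I2 j) V t + (F (a j) - F (b j))%R%:E) =
   \int[leb]_(t in S j) V t + (F (- b j) - F (- a j) + (F (a j) - F (b j)))%R%:E)%E.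
  by rewrite [in RHS](int_S j mV V0) EFinD addeACA.
apply: leeD; last by rewrite lee_fin; lra.
by apply: ge0_subset_integral => //; exact: mS.
Qed.

(** The sets [S j] exhaust the line except the origin, where [U] is 0 because [H 0 = 0]. *)
Let US : (\int[leb]_(t in \bigcup_j S j) U t = \int[leb]_t U t)%E.
Proof.
rewrite integral_mkcond; apply: eq_integral => t _; rewrite patchE; case: ifPn => // tS.
suff -> : t = 0 by rewrite /U /H subrr expr0n/= mulr0.
apply: contraNeq tS => t0; rewrite inE.
have t1 : 0 < `|t| by rewrite normr_gt0.
have [i _ /(_ _ (leqnn _)) i1] := near_infty_natSinv_lt (PosNum t1).
have [k kt] : exists k : nat, `|t| <= k%:R.
  by exists (Num.truncn `|t|).+1; rewrite ltW// truncnS_gt.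
exists (maxn i k) => //.
have ai : a (maxn i k) <= `|t|.
  apply: le_trans (ltW i1); rewrite /a lef_pV2 ?posrE// ler_nat ltnS leq_maxl//.
have bi : `|t| <= b (maxn i k).
  by apply: le_trans kt _; rewrite ler_nat; apply: leq_trans (leq_maxr i k) _; rewrite ltnW.
move: ai bi; case: (ltgtP t 0) t0 => // tt _; rewrite ?(ltr0_norm tt) ?(gtr0_norm tt) => ai bi.
- by left; rewrite /I1 /= in_itv/=; lra.
- by right; rewrite /I2 /= in_itv/=; lra.
Qed.

Lemma poincare_line :
  (\int[leb]_t (gauss t * (h t - h 0) ^+ 2)%:E <= \int[leb]_t (gauss t * (h' t) ^+ 2)%:E)%E.
Proof.
rewrite -[leLHS]US; apply/lee_addgt0Pr => e e0.
have C : (\int[leb]_(t in S j) U t)%E @[j --> \oo] --> (\int[leb]_(t in \bigcup_j S j) U t)%E.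
  apply: ge0_nondecreasing_set_cvg_integral => //.
  - move=> i j ij; apply/subsetPset; rewrite /S.
    have aij : a j <= a i by rewrite /a lef_pV2 ?posrE// ler_nat ltnS.
    have bij : b i <= b j by rewrite /b ler_nat !ltnS.
    by apply: setUSS => t; rewrite /I1 /I2 /= !in_itv/=; lra.
  - by move=> i; exact: (measurable_funS measurableT).
rewrite -(cvg_lim _ C)//; apply: lime_le; first by apply/cvg_ex; eexists; exact: C.
have e2 : 0 < e / 2 by rewrite divr_gt0.
have /cvgrPdist_le/(_ _ e2) := F_cvg0.
move=> [d /= d0 Hd]; near=> j.
apply: le_trans (S_bound j) _; apply: leeD => //; rewrite lee_fin.
have ad : a j < d by near: j; exact: (near_infty_natSinv_lt (PosNum d0)).
have a0 := a_gt0 j.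
have := Hd (a j); rewrite /= sub0r normrN (gtr0_norm a0) => /(_ ad (lt0r_neq0 a0)).
have := Hd (- a j); rewrite /= sub0r opprK (gtr0_norm a0) oppr_eq0 => /(_ ad (lt0r_neq0 a0)).
by rewrite !sub0r !normrN !ler_norml => /andP[] ? ? /andP[] ? ?; lra.
Unshelve. all: end_near. Qed.

End poincare.
End gaussian_line.

(** * Variance and second moment of the Gaussian on the line *)

Section gaussian_moments.
Context {R : realType}.
Local Notation leb := (@lebesgue_measure R).

Lemma pair_var_gauss (h h' : R -> R) : (forall t : R, is_derive t 1 h (h' t)) -> continuous h' ->
  (pair_var leb gauss h <= 2%:E * \int[leb]_t (gauss t * h' t ^+ 2)%:E)%E.
Proof.
move=> Dh ch'; have mh : measurable_fun setT h.
  by apply: continuous_measurable_fun => t; exact: is_derive_continuous (Dh t).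
have H := @pair_var_le _ _ _ leb _ _ measurable_gauss mh gauss_ge0 integral_gauss (h 0).
apply: (le_trans H).
by apply: lee_wpmul2l; [rewrite lee_fin|exact: poincare_line].
Qed.

Let I (j : nat) : set R := `[- j.+1%:R, j.+1%:R].

Let mI j : measurable (I j : set (measurableTypeR R)). Proof. exact: measurable_itv. Qed.

(** Since [- t gauss t] has derivative [t^2 gauss t - gauss t], the boundary contribution on
    [[-M, M]] is [2 M gauss M], of order [1 / M]. *)
Let I_bound j : (\int[leb]_(t in I j) (gauss t)%:E <=
  \int[leb]_t (gauss t * t ^+ 2)%:E + (4 * normal_peak (1 : R) * j.+1%:R^-1)%:E)%E.
Proof.
set M : R := j.+1%:R; have M0 : 0 < M by rewrite ltr0n.
pose F (t : R) := - (t * gauss t); pose f (t : R) := gauss t * t ^+ 2 - gauss t.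
have Di (t : R) : is_derive t 1 (id : R -> R) 1 by exact: is_derive_id.
have DF (t : R) : is_derive t 1 F (f t).
  apply: is_derive_eq (is_deriveN (is_derive_mul (Di t) (is_derive_gauss t))) _.
  by rewrite /f expr2 /=; ring.
have cs : continuous (fun t : R => t ^+ 2) by move=> t; exact: exprn_continuous.
have c2 : continuous (fun t : R => gauss t * t ^+ 2).
  by move=> t; apply: (@continuousM _ _ gauss (fun t : R => t ^+ 2)); [exact: continuous_gauss|exact: cs].
have cf : continuous f.
  by move=> t; apply: (@continuousB _ _ _ (fun t : R => gauss t * t ^+ 2) gauss);
    [exact: c2|exact: continuous_gauss].
have intI g : continuous g -> leb.-integrable (I j) (EFin \o g).
  by move=> cg; apply: continuous_compact_integrable; [exact: segment_compact|exact: continuous_subspaceT].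
have NM : - M < M by lra.
have E := integral_FTC NM (fun t _ => DF t) (fun t _ => cf t).
have i2 := intI _ c2; have i0 := intI _ continuous_gauss.
have : (\int[leb]_(t in I j) (f t)%:E =
    \int[leb]_(t in I j) (gauss t * t ^+ 2)%:E - \int[leb]_(t in I j) (gauss t)%:E)%E.
  rewrite -integralB//; exact: mI.
rewrite [X in X = _ -> _]E => E'.
have f2 := integrable_fin_num (mI j) i2; have f0 := integrable_fin_num (mI j) i0.
have -> : (\int[leb]_(t in I j) (gauss t)%:E =
    \int[leb]_(t in I j) (gauss t * t ^+ 2)%:E - (F M - F (- M))%:E)%E.
  by rewrite E' -(fineK f2) -(fineK f0) -!EFinB; congr EFin; ring.
rewrite -EFinN; apply: leeD.
  apply: ge0_subset_integral => //.
    by apply/measurable_EFinP; exact: continuous_measurable_fun.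
  by move=> t _; rewrite lee_fin mulr_ge0 ?gauss_ge0// sqr_ge0.
have := gauss_mul_le M0; rewrite lee_fin /F.
have -> : gauss (- M) = gauss M by rewrite !gaussE sqrrN.
set P := normal_peak 1; rewrite (_ : P * 2 / M = 2 * (P * M^-1)); last by ring.
rewrite (_ : 4 * P * M^-1 = 4 * (P * M^-1)); last by ring.
by rewrite mulNr; move: (M * gauss M) (P * M^-1) => A B; lra.
Qed.

(** The upper bound is the Poincare inequality for the identity function; the lower bound is the
    integration by parts above. *)
Lemma integral_gauss_sqr : (\int[leb]_t (gauss t * t ^+ 2)%:E = 1)%E.
Proof.
apply/eqP; rewrite eq_le; apply/andP; split.
  have Di (t : R) : is_derive t 1 (id : R -> R) 1 by exact: is_derive_id.
  have c1 : continuous (fun _ : R => 1 : R) by move=> t; exact: cvg_cst.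
  have H := poincare_line Di c1.
  have e1 : (\int[leb]_t (gauss t * (id t - id 0) ^+ 2)%:E = \int[leb]_t (gauss t * t ^+ 2)%:E)%E.
    by apply: eq_integral => t _; rewrite /= subr0.
  have e2 : (\int[leb]_t (gauss t * 1 ^+ 2)%:E = 1 :> \bar R)%E.
    by rewrite -integral_gauss; apply: eq_integral => t _; rewrite expr1n mulr1.
  by rewrite e1 e2 in H.
rewrite -[leLHS]integral_gauss -[in leLHS](_ : \bigcup_j I j = setT); last first.
  apply/seteqP; split => // t _; exists (Num.truncn `|t|) => //.
  rewrite /I /= in_itv/= -ler_norml ltW// truncnS_gt//.
have C : (\int[leb]_(t in I j) (gauss t)%:E)%E @[j --> \oo] -->
    (\int[leb]_(t in \bigcup_j I j) (gauss t)%:E)%E.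
  apply: ge0_nondecreasing_set_cvg_integral => //.
  - move=> i j ij; apply/subsetPset => t; rewrite /I /= !in_itv/=.
    have : i.+1%:R <= j.+1%:R :> R by rewrite ler_nat ltnS.
    by lra.
  - move=> j; apply: (measurable_funS measurableT) => //.
    by apply/measurable_EFinP; exact: measurable_gauss.
  - by move=> j t _; rewrite lee_fin gauss_ge0.
apply/lee_addgt0Pr => e e0.
rewrite -(cvg_lim _ C)//; apply: lime_le; first by apply/cvg_ex; eexists; exact: C.
have P0 : 0 <= normal_peak (1 : R) := normal_peak_ge0 _.
have d0 : 0 < e / (4 * normal_peak (1 : R) + 1) by rewrite divr_gt0//; lra.
near=> j; apply: le_trans (I_bound j) _; apply: leeD => //; rewrite lee_fin.
have : j.+1%:R^-1 < e / (4 * normal_peak (1 : R) + 1).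
  by near: j; exact: (near_infty_natSinv_lt (PosNum d0)).
rewrite ltr_pdivlMr; last by lra.
have : 0 < j.+1%:R^-1 :> R by rewrite invr_gt0.
by set x := _^-1; nra.
Unshelve. all: end_near. Qed.

End gaussian_moments.

(** * The standard Gaussian on R^n *)

Section gauss_rV_def.
Context {R : realType}.
Local Notation leb := (@lebesgue_measure R).

Definition gauss_rV n (x : 'rV[R]_n) : R := \prod_(i < n) gauss (x 0 i).

Lemma gauss_rV_cons n (t : R) (x : 'rV[R]_n) : gauss_rV (rV_cons (t, x)) = gauss t * gauss_rV x.
Proof.
rewrite /gauss_rV big_ord_recl rV_cons0; congr (_ * _).
by apply: eq_bigr => i _; rewrite rV_consS.
Qed.

Lemma gauss_rV_ge0 n (x : 'rV[R]_n) : 0 <= gauss_rV x.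
Proof. by apply: prodr_ge0 => i _; exact: gauss_ge0. Qed.

Lemma measurable_gauss_rV n : measurable_fun setT (@gauss_rV n).
Proof.
apply: measurable_prod => i _; apply: (measurableT_comp measurable_gauss).
exact: (@measurable_rV_coor R n i).
Qed.

(** The Gaussian is both a product and radial: an inequality proved coordinate by coordinate can
    thus be read on spheres. *)
Lemma gauss_rV_enorm n (x : 'rV[R]_n) :
  gauss_rV x = normal_peak (1 : R) ^+ n * expR (- (enorm x ^+ 2 / 2)).
Proof.
rewrite enorm_sqr /gauss_rV /sqn (eq_bigr _ (fun i _ => gaussE (x 0 i))) big_split/= prodr_const card_ord.
by congr (_ * _); rewrite -expR_sum mulr_suml sumrN.
Qed.

Lemma integral_gauss_rV n : (\int[lebesgue_rV R n]_x (gauss_rV x)%:E = 1)%E.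
Proof.
elim: n => [|n IH].
  rewrite /= integral_dirac//; first by rewrite diracT mul1e /gauss_rV big_ord0.
  by apply/measurable_EFinP; exact: measurable_gauss_rV.
rewrite ge0_integral_rVS; last 2 first.
- by apply/measurable_EFinP; exact: measurable_gauss_rV.
- by move=> x; rewrite lee_fin gauss_rV_ge0.
rewrite -[RHS]integral_gauss; apply: eq_integral => t _.
under eq_integral do rewrite gauss_rV_cons EFinM.
rewrite ge0_integralZl ?IH ?mule1 ?lee_fin ?gauss_ge0//.
  by apply/measurable_EFinP; exact: measurable_gauss_rV.
by move=> x _; rewrite lee_fin gauss_rV_ge0.
Qed.

(** This moment becomes the constant in the inequality on spheres. *)
Lemma integral_gauss_rV_sqn n : (\int[lebesgue_rV R n]_x (gauss_rV x * sqn x)%:E = n%:R%:E)%E.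
Proof.
have mg m := @measurable_gauss_rV m.
have ms m : measurable_fun setT (fun x : 'rV[R]_m => gauss_rV x * sqn x).
  apply: measurable_funM; first exact: mg.
  by apply: continuous_rV_measurable; exact: continuous_sqn.
have s0 m (x : 'rV[R]_m) : 0 <= gauss_rV x * sqn x by rewrite mulr_ge0 ?gauss_rV_ge0 ?sqn_ge0.
elim: n => [|n IH].
  by apply: integral0_eq => x _; rewrite /sqn big_ord0 mulr0.
rewrite ge0_integral_rVS; [|by apply/measurable_EFinP; exact: ms|by move=> x; rewrite lee_fin s0].
have sqnC (t : R) (x : 'rV[R]_n) : sqn (rV_cons (t, x)) = t ^+ 2 + sqn x.
  by rewrite /sqn big_ord_recl rV_cons0; congr (_ + _); apply: eq_bigr => i _; rewrite rV_consS.
transitivity (\int[leb]_t ((gauss t * t ^+ 2)%:E + (n%:R * gauss t)%:E))%E.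
  apply: eq_integral => t _.
  transitivity (\int[lebesgue_rV R n]_x ((gauss t * t ^+ 2)%:E * (gauss_rV x)%:E +
     (gauss t)%:E * (gauss_rV x * sqn x)%:E))%E.
    by apply: eq_integral => x _; rewrite gauss_rV_cons sqnC -!EFinM -EFinD; congr EFin; ring.
  have g0 := gauss_ge0 t; have gt0 : 0 <= gauss t * t ^+ 2 by rewrite mulr_ge0// sqr_ge0.
  have mgE : measurable_fun setT (fun x : 'rV[R]_n => (gauss_rV x)%:E) by apply/measurable_EFinP; exact: mg.
  have msE : measurable_fun setT (fun x : 'rV[R]_n => (gauss_rV x * sqn x)%:E) by apply/measurable_EFinP; exact: ms.
  rewrite ge0_integralD//; last 4 first.
  - by move=> x _; rewrite -EFinM lee_fin mulr_ge0// gauss_rV_ge0.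
  - exact: measurable_funeM.
  - by move=> x _; rewrite -EFinM lee_fin mulr_ge0.
  - exact: measurable_funeM.
  rewrite !ge0_integralZl//; last 2 first.
  - by move=> x _; rewrite lee_fin ?s0 ?gauss_rV_ge0.
  - by move=> x _; rewrite lee_fin ?s0 ?gauss_rV_ge0.
  by rewrite integral_gauss_rV IH mule1 -EFinM; congr (_ + _%:E)%E; rewrite mulrC.
rewrite ge0_integralD//; last 4 first.
- by move=> t _; rewrite lee_fin mulr_ge0 ?gauss_ge0// sqr_ge0.
- apply/measurable_EFinP; apply: measurable_funM; [exact: measurable_gauss|exact: measurable_funX].
- by move=> t _; rewrite lee_fin mulr_ge0 ?gauss_ge0.
- by apply/measurable_EFinP; apply: measurable_funM => //; exact: measurable_gauss.
rewrite integral_gauss_sqr; under eq_integral do rewrite EFinM.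
rewrite ge0_integralZl//; last 2 first.
- by apply/measurable_EFinP; exact: measurable_gauss.
- by move=> t _; rewrite lee_fin gauss_ge0.
by rewrite integral_gauss mule1 -EFinD -natr1 addrC.
Qed.

End gauss_rV_def.

(** * The Gaussian Poincare inequality on R^n *)

Section gauss_poincare.
Context {R : realType}.
Local Notation leb := (@lebesgue_measure R).

(** Regularity along lines parallel to the axes, and only along those lying entirely in [A]: what an
    induction on coordinates uses. *)
Definition line_smooth n (A : set 'rV[R]_n) (h : 'rV[R]_n -> R) (D : 'I_n -> 'rV[R]_n -> R) :=
  forall x i, (forall t : R, A (x + t *: delta_mx 0 i)) ->
    (forall t : R, is_derive t 1 (fun s : R => h (x + s *: delta_mx 0 i)) (D i (x + t *: delta_mx 0 i))) /\
    continuous (fun t : R => D i (x + t *: delta_mx 0 i)).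

Lemma rV_consD_lift n (s t : R) (x : 'rV[R]_n) (i : 'I_n) :
  rV_cons (s, x) + t *: delta_mx 0 (lift 0 i) = rV_cons (s, x + t *: delta_mx 0 i).
Proof.
apply/rowP => k; case: (unliftP 0 k) => [j ->|->].
  by rewrite !mxE !liftK /= !mxE !eqxx/= (inj_eq lift_inj).
by rewrite !mxE unlift_none /= mulr0 addr0.
Qed.

Lemma rV_consD0 n (t : R) (x : 'rV[R]_n) : rV_cons (0, x) + t *: delta_mx 0 0 = rV_cons (t, x).
Proof.
apply/rowP => k; case: (unliftP 0 k) => [j ->|->].
  by rewrite !mxE !liftK /= mulr0 addr0.
by rewrite !mxE unlift_none /= mulr1 add0r.
Qed.

Lemma line_smooth_slice n (A : set 'rV[R]_n.+1) h D (s : R) : line_smooth A h D ->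
  (forall x, A (rV_cons (s, x))) ->
  line_smooth setT (fun x => h (rV_cons (s, x))) (fun i x => D (lift 0 i) (rV_cons (s, x))).
Proof.
move=> hD As x i _.
have [|D1 D2] := hD (rV_cons (s, x)) (lift 0 i); first by move=> t; rewrite rV_consD_lift.
split.
  move=> t; have := D1 t; rewrite rV_consD_lift.
  rewrite (_ : (fun u : R => h (rV_cons (s, x) + u *: delta_mx 0 (lift 0 i))) =
    (fun u : R => h (rV_cons (s, x + u *: delta_mx 0 i))))//.
  by apply/funext => u; rewrite rV_consD_lift.
rewrite (_ : (fun t : R => D (lift 0 i) _) = fun t : R => D (lift 0 i) (rV_cons (s, x) + t *: delta_mx 0 (lift 0 i)))//.
by apply/funext => u; rewrite rV_consD_lift.
Qed.

Lemma line_smooth_axis n (A : set 'rV[R]_n.+1) h D (x : 'rV[R]_n) : line_smooth A h D ->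
  (forall t, A (rV_cons (t, x))) ->
  (forall t : R, is_derive t 1 (fun s : R => h (rV_cons (s, x))) (D 0 (rV_cons (t, x)))) /\
  continuous (fun t : R => D 0 (rV_cons (t, x))).
Proof.
move=> hD As.
have [|D1 D2] := hD (rV_cons (0, x)) 0; first by move=> t; rewrite rV_consD0.
split.
  move=> t; have := D1 t; rewrite rV_consD0.
  rewrite (_ : (fun u : R => h (rV_cons (0, x) + u *: delta_mx 0 0)) = (fun u : R => h (rV_cons (u, x))))//.
  by apply/funext => u; rewrite rV_consD0.
rewrite (_ : (fun t : R => D 0 _) = fun t : R => D 0 (rV_cons (0, x) + t *: delta_mx 0 0))//.
by apply/funext => u; rewrite rV_consD0.
Qed.

(** Tensorization of the first coordinate against the others. The double integral over R^(n+1) nests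
    its variables as [s, x, t, y], so the integrals in [x] and [t] have to be exchanged. *)
Lemma pair_var_gauss_rVS n (h : 'rV[R]_n.+1 -> R) : measurable_fun setT h ->
  (pair_var (lebesgue_rV R n.+1) (@gauss_rV R n.+1) h <=
   \int[leb]_s ((gauss s)%:E * pair_var (lebesgue_rV R n) (@gauss_rV R n) (fun x => h (rV_cons (s, x)))) +
   \int[lebesgue_rV R n]_x ((gauss_rV x)%:E * pair_var leb gauss (fun s => h (rV_cons (s, x)))))%E.
Proof.
move=> mh.
have mhc : measurable_fun setT (fun p : measurableTypeR R * 'rV[R]_n => h (rV_cons p)).
  exact: (measurableT_comp mh (@measurable_rV_cons R n)).
have := @pair_var_tensor _ _ (measurableTypeR R) _ R leb (lebesgue_rV R n) gauss (@gauss_rV R n)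
  (fun p => h (rV_cons p)) measurable_gauss (@measurable_gauss_rV R n) mhc gauss_ge0
  (@gauss_rV_ge0 R n) integral_gauss (integral_gauss_rV n).
move/(le_trans _); apply; rewrite le_eqVlt; apply/orP; left; apply/eqP.
pose g (z : 'rV[R]_n.+1 * 'rV[R]_n.+1) : \bar R :=
  (gauss_rV z.1 * gauss_rV z.2 * (h z.1 - h z.2) ^+ 2)%:E.
have g0 z : (0 <= g z)%E by rewrite lee_fin; apply: mul_sqr_ge0; exact: gauss_rV_ge0.
have F : measurable_fun setT (fun z : 'rV[R]_n.+1 * 'rV[R]_n.+1 => z.1) by exact: measurable_fst.
have S : measurable_fun setT (fun z : 'rV[R]_n.+1 * 'rV[R]_n.+1 => z.2) by exact: measurable_snd.
have mg : measurable_fun setT g.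
  apply/measurable_EFinP; apply: measurable_funM.
    by apply: measurable_funM; [exact: (measurableT_comp (@measurable_gauss_rV R n.+1) F)|
      exact: (measurableT_comp (@measurable_gauss_rV R n.+1) S)].
  by apply: measurable_funX; apply: measurable_funB;
    [exact: (measurableT_comp mh F)|exact: (measurableT_comp mh S)].
pose G z : \bar R := (\int[lebesgue_rV R n.+1]_w g (z, w))%E.
have mG : measurable_fun setT G := measurable_fun_fubini_tonelli_F (m2 := lebesgue_rV R n.+1) g mg g0.
have G0 z : (0 <= G z)%E by apply: integral_ge0 => w _; exact: g0.
transitivity (\int[leb]_s \int[lebesgue_rV R n]_x G (rV_cons (s, x)))%E.
  exact: (ge0_integral_rVS mG G0).
apply: eq_integral => s _.
transitivity (\int[lebesgue_rV R n]_x \int[leb]_t \int[lebesgue_rV R n]_y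
    g (rV_cons (s, x), rV_cons (t, y)))%E.
  apply: eq_integral => x _; rewrite /G ge0_integral_rVS; [by []| |by move=> w; exact: g0].
  exact: (measurableT_comp mg (pair1_measurable _)).
pose k (z : ('rV[R]_n * measurableTypeR R) * 'rV[R]_n) := g (rV_cons (s, z.1.1), rV_cons (z.1.2, z.2)).
have mk : measurable_fun setT k.
  have f1 : measurable_fun setT (fun z : ('rV[R]_n * measurableTypeR R) * 'rV[R]_n => z.1) by exact: measurable_fst.
  have f2 : measurable_fun setT (fun z : ('rV[R]_n * measurableTypeR R) * 'rV[R]_n => z.2) by exact: measurable_snd.
  apply: (measurableT_comp mg); apply: measurable_fun_pair; apply: (measurableT_comp (@measurable_rV_cons R n)).
    by apply: measurable_fun_pair => //; exact: (measurableT_comp measurable_fst f1).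
  by apply: measurable_fun_pair => //; exact: (measurableT_comp measurable_snd f1).
have k0 z : (0 <= k z)%E by exact: g0.
have mK := measurable_fun_fubini_tonelli_F (m2 := lebesgue_rV R n) k mk k0.
have K0 p : (0 <= fubini_F (lebesgue_rV R n) k p)%E by apply: integral_ge0 => y _; exact: k0.
transitivity (\int[leb]_t \int[lebesgue_rV R n]_x fubini_F (lebesgue_rV R n) k (x, t))%E.
  exact: (fubini_tonelli (m1 := lebesgue_rV R n) (m2 := leb) _ mK K0).
apply: eq_integral => t _; apply: eq_integral => x _; apply: eq_integral => y _.
by rewrite /k /g /= !gauss_rV_cons; congr EFin; ring.
Qed.

End gauss_poincare.

Section gauss_poincare_inequality.
Context {R : realType}.
Local Notation leb := (@lebesgue_measure R).

(** The hypotheses on slices are required almost everywhere only, so that the step also serves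
    functions singular at the origin. *)
Lemma gauss_poincare_step n (h : 'rV[R]_n.+1 -> R) (D : 'I_n.+1 -> 'rV[R]_n.+1 -> R) :
  measurable_fun setT h -> (forall i, measurable_fun setT (D i)) ->
  {ae leb, forall s, (pair_var (lebesgue_rV R n) (@gauss_rV R n) (fun x => h (rV_cons (s, x))) <=
    2%:E * \int[lebesgue_rV R n]_x (gauss_rV x * \sum_i D (lift 0 i) (rV_cons (s, x)) ^+ 2)%:E)%E} ->
  {ae lebesgue_rV R n, forall x, (pair_var leb gauss (fun s => h (rV_cons (s, x))) <=
    2%:E * \int[leb]_s (gauss s * D 0 (rV_cons (s, x)) ^+ 2)%:E)%E} ->
  (pair_var (lebesgue_rV R n.+1) (@gauss_rV R n.+1) h <=
    2%:E * \int[lebesgue_rV R n.+1]_x (gauss_rV x * \sum_i D i x ^+ 2)%:E)%E.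
Proof.
move=> mh mD H1 H2; apply: (le_trans (pair_var_gauss_rVS mh)).
have mc := @measurable_rV_cons R n.
have mg := @measurable_gauss_rV R.
have mgE : measurable_fun setT (fun s : measurableTypeR R => (gauss s)%:E).
  by apply/measurable_EFinP; exact: measurable_gauss.
have mgrE : measurable_fun setT (fun x : 'rV[R]_n => (gauss_rV x)%:E).
  by apply/measurable_EFinP; exact: mg.
have mhc : measurable_fun setT (fun p : measurableTypeR R * 'rV[R]_n => h (rV_cons p)).
  exact: (measurableT_comp mh mc).
have swap : measurable_fun setT (fun p : 'rV[R]_n * measurableTypeR R => (p.2, p.1)).
  by apply: measurable_fun_pair; [exact: measurable_snd|exact: measurable_fst].
have mhc' : measurable_fun setT (fun p : 'rV[R]_n * measurableTypeR R => h (rV_cons (p.2, p.1))).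
  exact: (measurableT_comp mhc swap).
have mP1 : measurable_fun setT (fun s => pair_var (lebesgue_rV R n) (@gauss_rV R n) (fun x => h (rV_cons (s, x)))).
  exact: (measurable_pair_var (lebesgue_rV R n) (h := fun p => h (rV_cons p)) (@mg n) (@gauss_rV_ge0 R n) mhc).
have mP2 : measurable_fun setT (fun x => pair_var leb gauss (fun s => h (rV_cons (s, x)))).
  exact: (measurable_pair_var leb (h := fun p => h (rV_cons (p.2, p.1))) measurable_gauss gauss_ge0 mhc').
have pv0 d (T : measurableType d) (m : {measure set T -> \bar R}) (w u : T -> R) :
    (forall x, 0 <= w x) -> (0 <= pair_var m w u)%E.
  move=> w0; apply: integral_ge0 => x _; apply: integral_ge0 => y _; rewrite lee_fin; exact: mul_sqr_ge0.
pose G1 (p : measurableTypeR R * 'rV[R]_n) : \bar R := (gauss_rV p.2 * \sum_i D (lift 0 i) (rV_cons p) ^+ 2)%:E.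
pose G2 (p : measurableTypeR R * 'rV[R]_n) : \bar R := (gauss p.1 * D 0 (rV_cons p) ^+ 2)%:E.
have mG1 : measurable_fun setT G1.
  apply/measurable_EFinP; apply: measurable_funM; first exact: (measurableT_comp (mg n) measurable_snd).
  by apply: measurable_sum => i; apply: measurable_funX; exact: (measurableT_comp (mD _) mc).
have mG2 : measurable_fun setT G2.
  apply/measurable_EFinP; apply: measurable_funM; first exact: (measurableT_comp measurable_gauss measurable_fst).
  by apply: measurable_funX; exact: (measurableT_comp (mD _) mc).
have G10 p : (0 <= G1 p)%E.
  by rewrite lee_fin mulr_ge0 ?gauss_rV_ge0// sumr_ge0// => i _; exact: sqr_ge0.
have G20 p : (0 <= G2 p)%E by rewrite lee_fin mulr_ge0 ?gauss_ge0// sqr_ge0.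
have mF1 := measurable_fun_fubini_tonelli_F (m2 := lebesgue_rV R n) G1 mG1 G10.
have mF2 := measurable_fun_fubini_tonelli_G (m1 := leb) G2 mG2 G20.
have F10 s : (0 <= fubini_F (lebesgue_rV R n) G1 s)%E by apply: integral_ge0 => x _; exact: G10.
have F20 x : (0 <= fubini_G leb G2 x)%E by apply: integral_ge0 => s _; exact: G20.
have mDD i : measurable_fun setT (fun x => (gauss_rV x * D i x ^+ 2)%:E).
  by apply/measurable_EFinP; apply: measurable_funM; [exact: mg|exact: measurable_funX].
have mDL : measurable_fun setT (fun x => (gauss_rV x * \sum_i D (lift 0 i) x ^+ 2)%:E).
  apply/measurable_EFinP; apply: measurable_funM; first exact: mg.
  by apply: measurable_sum => i; exact: measurable_funX.
have D0 i x : (0 <= (gauss_rV x * D i x ^+ 2)%:E)%E by rewrite lee_fin mulr_ge0 ?gauss_rV_ge0// sqr_ge0.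
have DL0 x : (0 <= (gauss_rV x * \sum_i D (lift 0 i) x ^+ 2)%:E)%E.
  by rewrite lee_fin mulr_ge0 ?gauss_rV_ge0// sumr_ge0// => i _; exact: sqr_ge0.
have -> : (\int[lebesgue_rV R n.+1]_x (gauss_rV x * \sum_i D i x ^+ 2)%:E =
   \int[leb]_s ((gauss s)%:E * fubini_F (lebesgue_rV R n) G1 s) +
   \int[lebesgue_rV R n]_x ((gauss_rV x)%:E * fubini_G leb G2 x))%E.
  transitivity (\int[lebesgue_rV R n.+1]_x ((gauss_rV x * \sum_i D (lift 0 i) x ^+ 2)%:E + (gauss_rV x * D 0 x ^+ 2)%:E))%E.
    by apply: eq_integral => x _; rewrite -EFinD -mulrDr big_ord_recl addrC.
  rewrite ge0_integralD//; congr (_ + _)%E.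
    rewrite ge0_integral_rVS//; apply: eq_integral => s _; rewrite -ge0_integralZl//; last 2 first.
    - exact: (measurableT_comp mG1 (pair1_measurable s)).
    - by rewrite lee_fin gauss_ge0.
    by apply: eq_integral => x _; rewrite gauss_rV_cons -EFinM mulrA.
  rewrite ge0_integral_rVS2//; apply: eq_integral => x _; rewrite -ge0_integralZl//; last 2 first.
  - exact: (measurableT_comp mG2 (pair2_measurable x)).
  - by rewrite lee_fin gauss_rV_ge0.
  by apply: eq_integral => s _; rewrite gauss_rV_cons -EFinM; congr EFin; rewrite /=; ring.
rewrite ge0_muleDr; last 2 first.
- by apply: integral_ge0 => s _; rewrite mule_ge0// lee_fin gauss_ge0.
- by apply: integral_ge0 => x _; rewrite mule_ge0// lee_fin gauss_rV_ge0.
apply: leeD.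
  rewrite -ge0_integralZl//; last 2 first.
  - exact: emeasurable_funM.
  - by move=> s _; rewrite mule_ge0// lee_fin gauss_ge0.
  apply: ae_ge0_le_integral => //.
  - by move=> s _; rewrite mule_ge0 ?lee_fin ?gauss_ge0//; apply: pv0; exact: gauss_rV_ge0.
  - exact: (emeasurable_funM mgE mP1).
  - by move=> s _; rewrite mule_ge0 ?lee_fin// mule_ge0// lee_fin gauss_ge0.
  - by apply: measurable_funeM; exact: emeasurable_funM.
  apply: filterS H1 => s H _; rewrite muleCA; apply: lee_wpmul2l; first by rewrite lee_fin gauss_ge0.
  exact: H.
rewrite -ge0_integralZl//; last 2 first.
- exact: emeasurable_funM.
- by move=> x _; rewrite mule_ge0// lee_fin gauss_rV_ge0.
apply: ae_ge0_le_integral => //.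
- by move=> x _; rewrite mule_ge0 ?lee_fin ?gauss_rV_ge0//; apply: pv0; exact: gauss_ge0.
- exact: (emeasurable_funM mgrE mP2).
- by move=> x _; rewrite mule_ge0 ?lee_fin// mule_ge0// lee_fin gauss_rV_ge0.
- by apply: measurable_funeM; exact: emeasurable_funM.
apply: filterS H2 => x H _; rewrite muleCA; apply: lee_wpmul2l; first by rewrite lee_fin gauss_rV_ge0.
exact: H.
Qed.

Lemma gauss_poincare n (h : 'rV[R]_n -> R) (D : 'I_n -> 'rV[R]_n -> R) :
  measurable_fun setT h -> (forall i, measurable_fun setT (D i)) -> line_smooth setT h D ->
  (pair_var (lebesgue_rV R n) (@gauss_rV R n) h <=
    2%:E * \int[lebesgue_rV R n]_x (gauss_rV x * \sum_i D i x ^+ 2)%:E)%E.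
Proof.
elim: n h D => [|n IH] h D mh mD hD.
  rewrite /pair_var integral0_eq => [|x _]; last first.
    by apply: integral0_eq => y _; rewrite (_ : y = x) ?subrr ?expr0n ?mulr0//; apply/rowP => -[].
  apply: mule_ge0; first by rewrite lee_fin ler0n.
  by apply: integral_ge0 => x _; rewrite lee_fin mulr_ge0 ?gauss_rV_ge0// big_ord0.
have mc := @measurable_rV_cons R n.
apply: gauss_poincare_step => //; apply: aeW => s.
  apply: IH; last by apply: (line_smooth_slice hD) => x; exact: Logic.I.
    exact: (measurableT_comp mh (measurableT_comp mc (pair1_measurable s))).
  by move=> i; exact: (measurableT_comp (mD _) (measurableT_comp mc (pair1_measurable s))).
by have [D1 D2] := line_smooth_axis (x := s) hD (fun=> Logic.I); exact: pair_var_gauss.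
Qed.

(* In dimension at least 2 almost every line parallel to an axis avoids the
   origin, where h is allowed to be singular. *)
Lemma gauss_poincare0 n (h : 'rV[R]_n.+1 -> R) (D : 'I_n.+1 -> 'rV[R]_n.+1 -> R) : (0 < n)%N ->
  measurable_fun setT h -> (forall i, measurable_fun setT (D i)) ->
  line_smooth [set x | x != 0] h D ->
  (pair_var (lebesgue_rV R n.+1) (@gauss_rV R n.+1) h <=
    2%:E * \int[lebesgue_rV R n.+1]_x (gauss_rV x * \sum_i D i x ^+ 2)%:E)%E.
Proof.
move=> n0 mh mD hD; have mc := @measurable_rV_cons R n.
apply: gauss_poincare_step => //.
  exists [set 0]; split; [exact: measurable_set1|exact: lebesgue_measure_set1|].
  move=> s /=; apply: contra_notP => /eqP s0.
  apply: gauss_poincare.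
  - exact: (measurableT_comp mh (measurableT_comp mc (pair1_measurable s))).
  - by move=> i; exact: (measurableT_comp (mD _) (measurableT_comp mc (pair1_measurable s))).
  - apply: line_smooth_slice hD _ => x /=; apply: contra_neq s0 => /rowP/(_ 0).
    by rewrite rV_cons0 mxE.
exists [set 0]; split; [exact: measurable_rV0|exact: lebesgue_rV_set0|].
move=> x /=; apply: contra_notP => /eqP x0.
have [|D1 D2] := line_smooth_axis (x := x) hD; last exact: pair_var_gauss.
move=> t /=; apply: contra_neq x0 => tx; apply/rowP => i.
by rewrite -(rV_consS t) tx !mxE.
Qed.

End gauss_poincare_inequality.

(** * The Poincare inequality on spheres *)

Lemma cauchy_schwarz_sum (R : realType) m (a b : 'I_m -> R) :
  (\sum_i a i * b i) ^+ 2 <= (\sum_i a i ^+ 2) * \sum_i b i ^+ 2.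
Proof.
set p := \sum_i a i ^+ 2; set s := \sum_i a i * b i; set q := \sum_i b i ^+ 2.
have p0 : 0 <= p by apply: sumr_ge0 => i _; exact: sqr_ge0.
have H t : 0 <= t ^+ 2 * p - 2 * t * s + q.
  have -> : t ^+ 2 * p - 2 * t * s + q = \sum_i (t * a i - b i) ^+ 2.
    rewrite /p /s /q mulr_sumr mulr_sumr -sumrN -!big_split/=.
    by apply: eq_bigr => i _; ring.
  by apply: sumr_ge0 => i _; exact: sqr_ge0.
have [pp|pn] := ltP 0 p.
  have := H (s / p); rewrite -(ler_pM2l pp) mulr0.
  move=> K; rewrite -subr_ge0; apply: le_trans K _; rewrite le_eqVlt; apply/orP; left; apply/eqP.
  by field; exact: lt0r_neq0.
have pz : p = 0 by apply/eqP; rewrite eq_le pn.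
have -> : s = 0; last by rewrite expr0n/= pz mul0r.
rewrite /s big1// => i _; move/eqP: pz; rewrite psumr_eq0 => [/allP/(_ i)|j _]; last exact: sqr_ge0.
by rewrite mem_index_enum sqrf_eq0/= => /(_ isT)/eqP ->; rewrite mul0r.
Qed.

Section sphere_poincare.
Context {R : realType} (n : nat).
Hypothesis n0 : (0 < n)%N.
Local Notation mu := (lebesgue_rV R n.+1).
Local Notation sigma := (@sphere_measure R n.+1).
Local Notation S := (@sphere_area R n.+1).
Implicit Types (x y z w : 'rV[R]_n.+1) (i k : 'I_n.+1).

Let nS : (0 < n.+1)%N. Proof. by []. Qed.
Let dir x := @direction R n.+1 x.

Lemma direction_id x : direction (direction x) = direction x.
Proof.
have [->|x0] := eqVneq x 0; first by rewrite /direction !scaler0.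
by rewrite {1}/direction direction_enorm1// invr1 scale1r.
Qed.

Lemma coor_direction_le1 x i : `|direction x 0 i| <= 1.
Proof.
apply: le_trans (coor_le_enorm _ _) _; have [->|x0] := eqVneq x 0.
  by rewrite /direction scaler0 /enorm big1 ?sqrtr0// => j _; rewrite mxE expr0n.
by rewrite direction_enorm1.
Qed.

Lemma ae_sphere (F G : 'rV[R]_n.+1 -> \bar R) : measurable_fun setT F -> measurable_fun setT G ->
  (forall w, enorm w = 1 -> F w = G w) -> (\int[sigma]_w F w = \int[sigma]_w G w)%E.
Proof.
move=> mF mG FG; apply: ae_eq_integral => //.
exists (~` @esphere R n.+1); split.
- apply: measurableC; rewrite (_ : @esphere R n.+1 = @enorm R n.+1 @^-1` [set 1])//.
  by rewrite -[X in measurable X]setTI; apply: measurable_enorm => //; exact: measurable_set1.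
- exact: sphere_measureC.
- by move=> w /= H w1; apply: H => _; exact: FG.
Qed.

Variables (phi : 'rV[R]_n.+1 -> R) (D : 'I_n.+1 -> 'rV[R]_n.+1 -> R)
  (DD : 'I_n.+1 -> 'I_n.+1 -> 'rV[R]_n.+1 -> R) (r : R).
Hypotheses (Dphi : is_grad phi D) (DDphi : forall i, is_grad (D i) (DD i))
  (cphi : continuous phi) (cD : forall i, continuous (D i)) (r0 : 0 < r).

Let pt x := r *: dir x.
Let cone x := enorm x * phi (pt x).
Let cgrad i w := w 0 i * phi (r *: w) +
  r * (D i (r *: w) + (-1) * (w 0 i * \sum_k w 0 k * D k (r *: w))).

Section line.
Variables (x : 'rV[R]_n.+1) (i : 'I_n.+1).
Let z (t : R) := x + t *: delta_mx 0 i.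
Hypothesis z0 : forall t, z t != 0.

Let Dz (t : R) k : is_derive t 1 (fun s => z s 0 k) ((k == i)%:R).
Proof.
rewrite (_ : (fun s => _) = fun s : R => x 0 k + (k == i)%:R * s); last first.
  by apply/funext => s; rewrite /z !mxE eqxx/= mulrC.
apply: is_derive_eq (is_derive_add (is_derive_cst _ _ _) (is_derive_cst_mul _ (is_derive_id _ _))) _.
by rewrite add0r mulr1.
Qed.

Let e0 t : enorm (z t) != 0. Proof. by rewrite enorm_eq0. Qed.

Let De (t : R) : is_derive t 1 (fun s => enorm (z s)) (dir (z t) 0 i).
Proof.
have Dz' k : is_derive t 1 (fun s => z s 0 k) ((delta_mx 0 i : 'rV[R]_n.+1) 0 k).
  by rewrite mxE eqxx/=; exact: Dz.
have sp : 0 < sqn (z t) by rewrite -enorm_sqr exprn_gt0// enorm_gt0.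
apply: is_derive_eq (is_derive_comp1 (is_derive1_sqrt sp) (is_derive_sqn Dz')) _.
rewrite (bigD1 i)//= big1 => [|k ki]; last by rewrite mxE (negbTE ki) andbF mul0r.
rewrite addr0 !mxE !eqxx mul1r -[Num.sqrt _]/(enorm (z t)).
by have e := e0 t; field.
Qed.

(** The derivative of [x / |x|] along the i-th axis: the basis vector projected orthogonally to the
    direction, over the norm. *)
Let c' (t : R) k := (enorm (z t))^-1 * ((k == i)%:R - dir (z t) 0 k * dir (z t) 0 i).

Let Dw (t : R) k : is_derive t 1 (fun s => dir (z s) 0 k) (c' t k).
Proof.
rewrite (_ : (fun s => _) = fun s : R => (enorm (z s))^-1 * z s 0 k); last first.
  by apply/funext => s; rewrite /dir /direction mxE.
apply: is_derive_eq (is_derive_mul (@is_derive_inv R (fun s : R => enorm (z s)) t _ (e0 t) (De t)) (Dz t k)) _.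
rewrite /c'; set b := _%:R; set e := dir (z t) 0 i.
have -> : dir (z t) 0 k = (enorm (z t))^-1 * z t 0 k by rewrite /dir /direction mxE.
by have := e0 t => ?; field.
Qed.

Let DF F G (t : R) : is_grad F G ->
  is_derive t 1 (fun s => F (pt (z s))) (\sum_k r * c' t k * G k (pt (z t))).
Proof.
move=> FG; have := FG (fun s => pt (z s)) t (\row_k (r * c' t k)) _.
under eq_bigr do rewrite mxE.
apply=> k; rewrite mxE (_ : (fun s => _) = fun s : R => r * dir (z s) 0 k).
  exact: is_derive_cst_mul (Dw t k).
by apply/funext => s; rewrite /pt mxE.
Qed.

Let Dcone (t : R) : is_derive t 1 (fun s => cone (z s)) (cgrad i (dir (z t))).
Proof.
apply: is_derive_eq (is_derive_mul (De t) (DF t Dphi)) _; rewrite /cgrad -/(pt (z t)); congr (_ + _).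
set s := \sum_k dir _ 0 k * _.
have -> : \sum_k r * c' t k * D k (pt (z t)) = r * (enorm (z t))^-1 * (D i (pt (z t)) - dir (z t) 0 i * s).
  transitivity (\sum_k (r * (enorm (z t))^-1 * ((k == i)%:R * D k (pt (z t))) +
      (- (r * (enorm (z t))^-1 * dir (z t) 0 i)) * (dir (z t) 0 k * D k (pt (z t))))).
    by apply: eq_bigr => k _; rewrite /c'; ring.
  rewrite big_split/= -!mulr_sumr -/s (bigD1 i)//= eqxx mul1r big1 ?addr0; last first.
    by move=> k /negbTE ->; rewrite mul0r.
  by ring.
by have := e0 t => ?; field.
Qed.

(** Continuity is read off from differentiability along the line; this is where the second
    derivatives [DD] enter. *)
Let cont_cgrad : continuous (fun t : R => cgrad i (dir (z t))).
Proof.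
move=> t; apply: (is_derive_continuous (is_derive_add (is_derive_mul (Dw t i) (DF t Dphi))
  (is_derive_cst_mul r (is_derive_add (DF t (DDphi i)) (is_derive_cst_mul (-1) (is_derive_mul (Dw t i)
    (is_derive_sumr (fun k => is_derive_mul (Dw t k) (DF t (DDphi k)))))))))).
Qed.

Lemma cone_line : (forall t : R, is_derive t 1 (fun s : R => cone (x + s *: delta_mx 0 i))
    (cgrad i (dir (x + t *: delta_mx 0 i)))) /\
  continuous (fun t : R => cgrad i (dir (x + t *: delta_mx 0 i))).
Proof. by split; [exact: Dcone|exact: cont_cgrad]. Qed.

End line.

Let psi w := phi (pt w).

Let mdir : measurable_fun setT dir. Proof. exact: measurable_direction. Qed.
Let mscale : measurable_fun setT (fun w : 'rV[R]_n.+1 => r *: w). Proof. exact: measurable_scale_rV. Qed.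
Let mphi : measurable_fun setT phi. Proof. exact: continuous_rV_measurable. Qed.
Let mD i : measurable_fun setT (D i). Proof. exact: continuous_rV_measurable. Qed.
Let mpsi : measurable_fun setT psi. Proof. exact: (measurableT_comp mphi (measurableT_comp mscale mdir)). Qed.
Let men : measurable_fun setT (@enorm R n.+1). Proof. exact: measurable_enorm. Qed.
Let mcone : measurable_fun setT cone. Proof. exact: (measurable_funM men mpsi). Qed.

Let mcgrad i : measurable_fun setT (cgrad i).
Proof.
have mc k : measurable_fun setT (fun w : 'rV[R]_n.+1 => w 0 k) by exact: (@measurable_rV_coor R n.+1 k).
have mDr k : measurable_fun setT (fun w => D k (r *: w)) by exact: (measurableT_comp (mD k) mscale).
apply: measurable_funD; first by apply: measurable_funM => //; exact: (measurableT_comp mphi mscale).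
apply: measurable_funM => //; apply: measurable_funD => //; apply: measurable_funM => //.
apply: measurable_funM => //; apply: measurable_sum => k; exact: measurable_funM.
Qed.

Let psi_bounded : exists2 B, 0 <= B & forall w, `|psi w| <= B.
Proof.
have [B B0 HB] := @continuous_box_bounded R n.+1 phi r cphi; exists B => // w; apply: HB => i.
by rewrite /pt mxE normrM gtr0_norm// ler_piMr ?coor_direction_le1// ltW.
Qed.

(** [|w|^2] times the squared tangential gradient. This polynomial form has no division, and it is
    nonnegative by Cauchy-Schwarz. *)
Definition tangential w := sqn w * \sum_i D i w ^+ 2 - (\sum_i w 0 i * D i w) ^+ 2.

(** The radial and tangential parts of [cgrad] are orthogonal. *)
Lemma cgrad_sqr w : enorm w = 1 ->
  \sum_i cgrad i w ^+ 2 = phi (r *: w) ^+ 2 + tangential (r *: w).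
Proof.
move=> w1; have s1 : sqn w = 1 by rewrite -enorm_sqr w1 expr1n.
rewrite /tangential; set f := phi _; set s := \sum_i w 0 i * D i (r *: w).
have -> : sqn (r *: w) = r ^+ 2.
  by rewrite -enorm_sqr enormZ w1 mulr1 gtr0_norm.
have -> : \sum_i (r *: w) 0 i * D i (r *: w) = r * s.
  by rewrite mulr_sumr; apply: eq_bigr => i _; rewrite mxE mulrA.
set d := \sum_i D i _ ^+ 2.
transitivity (\sum_i ((f - r * s) ^+ 2 * w 0 i ^+ 2 + 2 * (f - r * s) * r * (w 0 i * D i (r *: w)) +
    r ^+ 2 * D i (r *: w) ^+ 2)).
  by apply: eq_bigr => i _; rewrite /cgrad -/f -/s; ring.
rewrite !big_split/= -!mulr_sumr -/s -/d -[\sum_i w 0 i ^+ 2]/(sqn w) s1; ring.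
Qed.

Let g := @gauss_rV R n.+1.
Let g0 x : 0 <= g x. Proof. exact: gauss_rV_ge0. Qed.
Let mg : measurable_fun setT g. Proof. exact: measurable_gauss_rV. Qed.
Let E (t : R) := normal_peak (1 : R) ^+ n * gauss t.
Let E0 t : 0 <= E t. Proof. by rewrite mulr_ge0 ?gauss_ge0// exprn_ge0// normal_peak_ge0. Qed.
Let mE : measurable_fun setT E. Proof. by apply: measurable_funM => //; exact: measurable_gauss. Qed.
Let gE x : g x = E (enorm x).
Proof. by rewrite /g gauss_rV_enorm /E gaussE exprSr mulrA. Qed.

Let ig : mu.-integrable setT (EFin \o g).
Proof. by apply: ge0_integrableR; [exact: mg|exact: g0|rewrite /g integral_gauss_rV ltry]. Qed.
Let igs : mu.-integrable setT (EFin \o (fun x => g x * sqn x)).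
Proof.
apply: ge0_integrableR; last by rewrite /g integral_gauss_rV_sqn ltry.
- apply: measurable_funM; first exact: mg.
  by apply: continuous_rV_measurable; exact: continuous_sqn.
- by move=> x; apply: mulr_ge0; [exact: g0|exact: sqn_ge0].
Qed.

Let i2 : mu.-integrable setT (EFin \o (fun x => g x * (cone x - 0) ^+ 2)).
Proof.
have [B B0 HB] := psi_bounded.
apply: le_integrableR (integrableRZ (B ^+ 2) igs).
  exact: (measurable_funM mg (measurable_funX 2 (measurable_funB mcone (measurable_cst _)))).
move=> x; rewrite subr0 ger0_norm; last by apply: mulr_ge0; [exact: g0|exact: sqr_ge0].
rewrite [leRHS]mulrCA; apply: ler_wpM2l; first exact: g0.
rewrite /cone exprMn enorm_sqr mulrC.
apply: ler_wpM2r; first exact: sqn_ge0.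
by rewrite -[leLHS]real_normK ?num_real// lerXn2r// ?nnegrE//; exact: HB.
Qed.

Let A := \int[mu]_x (g x * enorm x).

Let iA : mu.-integrable setT (EFin \o (fun x => g x * enorm x)).
Proof.
apply: le_integrableR (integrableRD ig igs); first exact: (measurable_funM mg men).
move=> x; rewrite ger0_norm; last by apply: mulr_ge0; [exact: g0|exact: enorm_ge0].
rewrite -[X in X + _]mulr1 -mulrDr; apply: ler_wpM2l; first exact: g0.
by rewrite -enorm_sqr; have := enorm_ge0 x; nra.
Qed.

Let isig : sigma.-integrable setT (EFin \o psi).
Proof. by have [B B0 HB] := psi_bounded; apply: (sphere_integrable_bounded (B := B)); [exact: mpsi|exact: HB]. Qed.

(** The polar formula is for nonnegative functions: hence the shift of [psi] by its bound [B],
    subtracted at the end, and the absolute value in the radial weight. *)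
Let mean : S * \int[mu]_x (g x * cone x) = A * \int[sigma]_w psi w.
Proof.
have [B B0 HB] := psi_bounded; have S0 := @sphere_area_gt0 R n.+1 nS.
have mW : measurable_fun setT (fun t : R => E t * `|t|).
  by apply: measurable_funM; [exact: mE|apply: continuous_measurable_fun; exact: norm_continuous].
have W0 t : 0 <= E t * `|t| by apply: mulr_ge0; [exact: E0|exact: normr_ge0].
have mpB : measurable_fun setT (fun w => (psi w + B)%:E).
  by apply/measurable_EFinP; exact: (measurable_funD mpsi (measurable_cst _)).
have pB w : (0 <= (psi w + B)%:E)%E by rewrite lee_fin; have := HB w; rewrite ler_norml; lra.
have igc : mu.-integrable setT (EFin \o (fun x => g x * cone x)).
  apply: le_integrableR (integrableRZ B iA); first exact: (measurable_funM mg mcone).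
  have ge x : 0 <= g x * enorm x by apply: mulr_ge0; [exact: g0|exact: enorm_ge0].
  move=> x; rewrite /cone mulrA normrM (ger0_norm (ge x)) mulrC.
  by apply: ler_wpM2r; [exact: ge|exact: HB].
have := polar_prod nS mW W0 mpB pB.
have -> : (\int[mu]_x ((E (enorm x) * `|enorm x|)%:E * (psi (direction x) + B)%:E) =
   (\int[mu]_x (g x * cone x) + B * A)%:E)%E.
  have iAB := integrableRZ B iA.
  transitivity ((\int[mu]_x (g x * cone x + B * (g x * enorm x)))%:E)%E; last first.
    by rewrite RintegralD; [rewrite RintegralZl; [by []|exact: measurableT|exact: iA]|exact: measurableT|exact: igc|exact: iAB].
  rewrite -(integral_Rintegral (integrableRD igc iAB)).
  apply: eq_integral => x _; rewrite -EFinM -gE ger0_norm ?enorm_ge0// /psi /cone /pt /dir direction_id.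
  by congr EFin; ring.
have -> : (\int[mu]_x ((E (enorm x) * `|enorm x|)%:E) = A%:E)%E.
  rewrite -(integral_Rintegral iA); apply: eq_integral => x _.
  by rewrite -gE ger0_norm ?enorm_ge0.
have -> : (\int[sigma]_w (psi w + B)%:E = (\int[sigma]_w psi w + B * S)%:E)%E.
  have iB : sigma.-integrable setT (EFin \o (fun=> B)).
    by apply: (sphere_integrable_bounded (B := B)) => // w; rewrite ger0_norm.
  rewrite (integral_Rintegral (integrableRD isig iB)).
  by rewrite RintegralD; [rewrite Rintegral_cst//|exact: measurableT|exact: isig|exact: iB].
rewrite -!EFinM => -[] H; move: H; rewrite !mulrDr => H.
by apply: (addIr (S * (B * A))); rewrite H; ring.
Qed.

Let second : (S%:E * \int[mu]_x (g x * (cone x) ^+ 2)%:E = n.+1%:R%:E * \int[sigma]_w (psi w ^+ 2)%:E)%E.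
Proof.
have mW : measurable_fun setT (fun t : R => E t * t ^+ 2).
  exact: (measurable_funM mE (measurable_funX 2 (@measurable_id _ _ setT))).
have W0 t : 0 <= E t * t ^+ 2 by apply: mulr_ge0; [exact: E0|exact: sqr_ge0].
have m2 : measurable_fun setT (fun w => (psi w ^+ 2)%:E).
  by apply/measurable_EFinP; exact: (measurable_funX 2 mpsi).
have p2 w : (0 <= (psi w ^+ 2)%:E)%E by rewrite lee_fin sqr_ge0.
have := polar_prod nS mW W0 m2 p2.
have -> : (\int[mu]_x ((E (enorm x) * enorm x ^+ 2)%:E * (psi (direction x) ^+ 2)%:E) =
   \int[mu]_x (g x * (cone x) ^+ 2)%:E)%E.
  apply: eq_integral => x _; rewrite -EFinM -gE /psi /cone /pt /dir direction_id.
  by congr EFin; ring.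
move=> ->; congr (_ * _)%E; rewrite -integral_gauss_rV_sqn; apply: eq_integral => x _.
by rewrite -gE enorm_sqr.
Qed.

Let gradient : (S%:E * \int[mu]_x (g x * \sum_i cgrad i (dir x) ^+ 2)%:E =
  \int[sigma]_w (\sum_i cgrad i w ^+ 2)%:E)%E.
Proof.
have m2 : measurable_fun setT (fun w => (\sum_i cgrad i w ^+ 2)%:E).
  by apply/measurable_EFinP; apply: measurable_sum => i; exact: (measurable_funX 2 (mcgrad i)).
have p2 w : (0 <= (\sum_i cgrad i w ^+ 2)%:E)%E by rewrite lee_fin sumr_ge0// => i _; exact: sqr_ge0.
have := polar_prod nS mE E0 m2 p2.
have -> : (\int[mu]_x (E (enorm x))%:E = 1)%E.
  by rewrite -(integral_gauss_rV n.+1); apply: eq_integral => x _; rewrite -gE.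
by rewrite mul1e => <-; congr (_ * _)%E; apply: eq_integral => x _; rewrite -EFinM -gE.
Qed.

(* The Gaussian Poincare inequality applied to the 1-homogeneous extension of
   the restriction of phi to the sphere of radius r. *)
Lemma sphere_poincare :
  (n%:R%:E * \int[sigma]_w (phi (r *: w) ^+ 2)%:E <= \int[sigma]_w (tangential (r *: w))%:E +
   ((\int[mu]_x (gauss_rV x * enorm x)) ^+ 2 / S)%:E * ((\int[sigma]_w phi (r *: w)) ^+ 2)%:E)%E.
Proof.
have S0 := @sphere_area_gt0 R n.+1 nS.
have dw w : enorm w = 1 -> dir w = w by move=> w1; rewrite /dir /direction w1 invr1 scale1r.
have mpr : measurable_fun setT (fun w => phi (r *: w)) by exact: (measurableT_comp mphi mscale).
have mt : measurable_fun setT (fun w => tangential (r *: w)).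
  have mc k : measurable_fun setT (fun w : 'rV[R]_n.+1 => w 0 k) by exact: (@measurable_rV_coor R n.+1 k).
  apply: (measurableT_comp (f := tangential)) mscale; apply: measurable_funB.
    apply: measurable_funM; first by apply: continuous_rV_measurable; exact: continuous_sqn.
    by apply: measurable_sum => i; exact: (measurable_funX 2 (mD i)).
  by apply: measurable_funX; apply: measurable_sum => i; exact: (measurable_funM (mc i) (mD i)).
have t0 w : 0 <= tangential w.
  rewrite subr_ge0 /sqn; exact: cauchy_schwarz_sum.
have -> : (\int[sigma]_w (phi (r *: w) ^+ 2)%:E = \int[sigma]_w (psi w ^+ 2)%:E)%E.
  apply: ae_sphere; [by apply/measurable_EFinP; exact: (measurable_funX 2 mpr)|by apply/measurable_EFinP; exact: (measurable_funX 2 mpsi)|].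
  by move=> w /dw; rewrite /psi /pt => ->.
have -> : \int[sigma]_w phi (r *: w) = \int[sigma]_w psi w.
  rewrite /Rintegral; congr fine; apply: ae_sphere; [by apply/measurable_EFinP; exact: mpr|by apply/measurable_EFinP; exact: mpsi|].
  by move=> w /dw; rewrite /psi /pt => ->.
have G : (\int[sigma]_w (\sum_i cgrad i w ^+ 2)%:E =
    \int[sigma]_w (psi w ^+ 2)%:E + \int[sigma]_w (tangential (r *: w))%:E)%E.
  rewrite -ge0_integralD//; [|by move=> w _; rewrite lee_fin sqr_ge0
    |by apply/measurable_EFinP; exact: (measurable_funX 2 mpsi)|by move=> w _; rewrite lee_fin; exact: t0
    |by apply/measurable_EFinP; exact: mt].
  apply: ae_sphere.
  - by apply/measurable_EFinP; apply: measurable_sum => i; exact: (measurable_funX 2 (mcgrad i)).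
  - by apply: emeasurable_funD; apply/measurable_EFinP; [exact: (measurable_funX 2 mpsi)|exact: mt].
  by move=> w w1; rewrite cgrad_sqr// -EFinD /psi /pt dw.
have Y0 : (0 <= \int[sigma]_w (tangential (r *: w))%:E)%E.
  by apply: integral_ge0 => w _; rewrite lee_fin; exact: t0.
have V := pair_varE mg mcone g0 (integral_gauss_rV n.+1) i2.
have LS : line_smooth [set x | x != 0] cone (fun i x => cgrad i (dir x)).
  by move=> x i z0; exact: cone_line.
have := gauss_poincare0 n0 mcone (fun i => measurableT_comp (mcgrad i) mdir) LS.
rewrite V => H.
have S0E : (0 <= S%:E)%E by rewrite lee_fin ltW.
have := lee_wpmul2l S0E H.
rewrite muleCA gradient G.
have e1 : \int[mu]_x (g x * (cone x - 0)) = \int[mu]_x (g x * cone x).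
  by apply: eq_Rintegral => x _; rewrite subr0.
have sec : S * \int[mu]_x (g x * (cone x - 0) ^+ 2) = n.+1%:R * \int[sigma]_w (psi w ^+ 2).
  apply: EFin_inj; rewrite !EFinM -(integral_Rintegral i2).
  have [B B0 HB] := psi_bounded.
  rewrite -integral_Rintegral; last first.
    apply: (sphere_integrable_bounded (B := B ^+ 2)); first exact: (measurable_funX 2 mpsi).
    by move=> w; rewrite normrX lerXn2r ?nnegrE//; exact: HB.
  by rewrite -second; congr (_ * _)%E; apply: eq_integral => x _; rewrite subr0.
have -> : (\int[sigma]_w (psi w ^+ 2)%:E = (\int[sigma]_w (psi w ^+ 2))%:E)%E.
  have [B B0 HB] := psi_bounded.
  apply: integral_Rintegral; apply: (sphere_integrable_bounded (B := B ^+ 2)).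
    exact: (measurable_funX 2 mpsi).
  by move=> w; rewrite normrX lerXn2r ?nnegrE//; exact: HB.
rewrite e1 -EFinM mulrBr mulrCA sec.
have -> : S * (2 * (\int[mu]_x (g x * cone x)) ^+ 2) = 2 * (A ^+ 2 / S * (\int[sigma]_w psi w) ^+ 2).
  rewrite (_ : \int[mu]_x (g x * cone x) = A * \int[sigma]_w psi w / S); first by field; exact: lt0r_neq0.
  by rewrite -mean mulrAC divff ?mul1r// lt0r_neq0.
rewrite -/A; move: Y0; set X := \int[sigma]_w _; set C := A ^+ 2 / S * _; clearbody X.
(* An infinite tangential integral makes the claim trivial. Otherwise the integral of [psi^2]
   produced by the radial part of the gradient moves to the left and turns [n.+1] into [n]. *)
case: (\int[sigma]_w (tangential _)%:E)%E => [y| |]//; last by rewrite addye ?leey.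
move=> y0; rewrite -!EFinD -!EFinM -?EFinD.
rewrite -/C -natr1 !lee_fin.
by clearbody C; lra.
Qed.

End sphere_poincare.

(** * Integration by parts along lines *)

Section line_calculus.
Context {R : realType}.
Local Notation leb := (@lebesgue_measure R).

Lemma line_integral_eq0 (F f : R -> R) (M : R) : (forall t : R, is_derive t 1 F (f t)) ->
  continuous f -> (forall t, M < `|t| -> F t = 0 /\ f t = 0) -> (\int[leb]_t (f t)%:E = 0)%E.
Proof.
move=> DF cf H; set b := `|M| + 1.
have Mb : M < b by rewrite /b; have := ler_norm M; lra.
have b0 : 0 < b by rewrite /b; have := normr_ge0 M; lra.
have Nb : - b < b by lra.
have := integral_FTC Nb (fun t _ => DF t) (fun t _ => cf t).
have -> : F b = 0 by apply: (H _ _).1; rewrite gtr0_norm.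
have -> : F (- b) = 0 by apply: (H _ _).1; rewrite normrN gtr0_norm.
rewrite subrr => I0; apply: (etrans _ I0); rewrite [in RHS]integral_mkcond; apply: eq_integral => t _.
rewrite patchE; case: ifPn => // tn.
have tb : ~~ (`|t| <= b) by apply: contra tn => tb; rewrite inE/= in_itv/= -ler_norml.
by rewrite (H t _).2//; apply: lt_trans Mb _; rewrite ltNge.
Qed.

(** The weights contain powers of [q^-1] and are differentiated for [q > 0]. As the cutoff makes
    them 0 below [e], the formulas extend to the whole line. *)
Lemma is_derive_cut (F f : R -> R) (e : R) : 0 < e ->
  (forall q : R, 0 < q -> is_derive q 1 F (f q)) ->
  (forall q, q < e -> F q = 0 /\ f q = 0) -> forall q : R, is_derive q 1 F (f q).
Proof.
move=> e0 DF Z q; have [q0|q0] := ltP 0 q; first exact: DF.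
have qe : q < e by exact: le_lt_trans q0 e0.
have [Fq fq] := Z q qe; rewrite fq; apply/is_deriveP.
have E : {near 0^', (fun=> 0 : R) =1 (fun h : R => h^-1 *: (F (h *: (1 : R) + q) - F q))}.
  near=> h; have he : `|h| < e - q by near: h; apply: dnbhs0_lt; lra.
  rewrite Fq (Z (h *: (1 : R) + q) _).1 ?subrr ?scaler0//.
  by rewrite /GRing.scale/= mulr1; move: he; rewrite ltr_norml; lra.
exact: cvg_trans (near_eq_cvg E) (cvg_cst _).
Unshelve. all: end_near. Qed.

Lemma continuous_cut (f : R -> R) (e : R) : 0 < e ->
  (forall q, 0 < q -> {for q, continuous f}) -> (forall q, q < e -> f q = 0) -> continuous f.
Proof.
move=> e0 cf Z q; have [q0|q0] := ltP 0 q; first exact: cf.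
have qe : q < e by exact: le_lt_trans q0 e0.
have ci : t @[t --> q] --> q by exact: cvg_id.
have E : {near q, (fun=> 0 : R) =1 f}.
  by near=> t; rewrite Z//; near: t; exact: (cvgr_lt _ ci _ qe).
rewrite /continuous_at (Z q qe); exact: cvg_trans (near_eq_cvg E) (cvg_cst _).
Unshelve. all: end_near. Qed.

(** For expressions whose only factor not known to be differentiable is [g]: below, the second
    derivative of the cutoff. *)
Lemma continuous_affine (P Q g : R -> R) (q dp dq : R) : is_derive q 1 P dp -> is_derive q 1 Q dq ->
  {for q, continuous g} -> {for q, continuous (fun t => P t + Q t * g t)}.
Proof.
move=> DP DQ cg; apply: (@continuousD _ _ _ P (fun t => Q t * g t)).
  exact: is_derive_continuous DP.
by apply: (@continuousM _ _ Q g) => //; exact: is_derive_continuous DQ.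
Qed.

Lemma continuous_line n (G : 'rV[R]_n -> R) x i : continuous G ->
  continuous (fun t : R => G (x + t *: delta_mx 0 i)).
Proof.
move=> /rV_continuousP cG t; apply/cvgrPdist_lt => e e0.
have [d d0 H] := cG (x + t *: delta_mx 0 i) e e0.
have ci : s @[s --> t] --> t by exact: cvg_id.
move/cvgrPdist_lt: ci => /(_ _ d0) ci.
near=> s; apply: H => k; rewrite !mxE eqxx/= opprD addrACA subrr add0r -mulrBl.
have : `|t - s| < d by near: s; exact: ci.
apply: le_lt_trans; rewrite normrM.
by case: (k == i) => /=; rewrite ?normr0 ?mulr0 ?normr1 ?mulr1.
Unshelve. all: end_near. Qed.

Lemma is_derive_coor_line n (x : 'rV[R]_n) i k (t : R) :
  is_derive t 1 (fun s : R => (x + s *: delta_mx 0 i) 0 k) ((delta_mx 0 i : 'rV[R]_n) 0 k).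
Proof.
rewrite (_ : (fun s => _) = fun s : R => x 0 k + (delta_mx 0 i : 'rV[R]_n) 0 k * s); last first.
  by apply/funext => s; rewrite !mxE mulrC.
apply: is_derive_eq (is_derive_add (is_derive_cst _ _ _) (is_derive_cst_mul _ (is_derive_id _ _))) _.
by rewrite add0r mulr1.
Qed.

Lemma is_grad_line n (F : 'rV[R]_n -> R) G x i (t : R) : is_grad F G ->
  is_derive t 1 (fun s : R => F (x + s *: delta_mx 0 i)) (G i (x + t *: delta_mx 0 i)).
Proof.
move=> FG; have := FG (fun s : R => x + s *: delta_mx 0 i) t (delta_mx 0 i) (fun k => is_derive_coor_line x i k t).
rewrite (bigD1 i)//= mxE !eqxx mul1r big1 ?addr0// => k ki.
by rewrite mxE (negbTE ki) andbF mul0r.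
Qed.

Lemma is_gradN n (F : 'rV[R]_n -> R) G : is_grad F G -> is_grad (fun x => - F x) (fun i x => - G i x).
Proof.
move=> FG c s c' H; apply: is_derive_eq (is_deriveN (FG c s c' H)) _.
by rewrite -sumrN; apply: eq_bigr => i _; rewrite mulrN.
Qed.

(** By Fubini, the coordinate [i] is integrated first if it is the leading one; otherwise the
    leading coordinate is frozen and the dimension drops. *)
Lemma integral_partial_eq0 n (i : 'I_n) (F dF : 'rV[R]_n -> R) (M C : R) : boxfun M C dF ->
  (forall x, ~ rV_box n M x -> F x = 0) ->
  (forall x, (forall t : R, is_derive t 1 (fun s : R => F (x + s *: delta_mx 0 i)) (dF (x + t *: delta_mx 0 i))) /\
    continuous (fun t : R => dF (x + t *: delta_mx 0 i))) ->
  (\int[lebesgue_rV R n]_x (dF x)%:E = 0)%E.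
Proof.
elim: n i F dF => [[]//|n IH] i F dF [mF bF sF] F0 line.
have dF0 x : ~ rV_box n.+1 M x -> dF x = 0.
  by move=> xM; apply/eqP; apply: contra_notT xM => /sF.
have iF : (lebesgue_rV R n.+1).-integrable setT (EFin \o dF) by apply: (@boxfun_integrable _ _ M C).
have mc := @measurable_rV_cons R n.
case: (unliftP 0 i) line => [k ->|->] line.
  rewrite (integral_rVS iF) integral0_eq// => t _.
  apply: (IH k (fun x => F (rV_cons (t, x))) (fun x => dF (rV_cons (t, x)))).
  - split; first exact: (measurableT_comp mF (measurableT_comp mc (pair1_measurable t))).
      by move=> z; exact: bF.
    by move=> z /sF H l; have := H (lift 0 l); rewrite rV_consS.
  - by move=> x xM; apply: F0 => H; apply: xM => l; have := H (lift 0 l); rewrite rV_consS.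
  - move=> x; have [L1 L2] := line (rV_cons (t, x)); split.
      move=> s; have := L1 s; rewrite rV_consD_lift.
      rewrite (_ : (fun u : R => F (rV_cons (t, x) + u *: delta_mx 0 (lift 0 k))) =
        (fun u : R => F (rV_cons (t, x + u *: delta_mx 0 k))))//.
      by apply/funext => u; rewrite rV_consD_lift.
    rewrite (_ : (fun u : R => dF _) = fun u : R => dF (rV_cons (t, x) + u *: delta_mx 0 (lift 0 k)))//.
    by apply/funext => u; rewrite rV_consD_lift.
rewrite (integral_rVS2 iF) integral0_eq// => x _.
have [L1 L2] := line (rV_cons (0, x)).
apply: (@line_integral_eq0 (fun t => F (rV_cons (t, x))) (fun t => dF (rV_cons (t, x))) M).
- move=> s; have := L1 s; rewrite rV_consD0.
  rewrite (_ : (fun u : R => F (rV_cons (0, x) + u *: delta_mx 0 0)) = (fun u : R => F (rV_cons (u, x))))//.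
  by apply/funext => u; rewrite rV_consD0.
- rewrite (_ : (fun u : R => dF _) = fun u : R => dF (rV_cons (0, x) + u *: delta_mx 0 0))//.
  by apply/funext => u; rewrite rV_consD0.
- move=> t tM; have nb : ~ rV_box n.+1 M (rV_cons (t, x)).
    by move=> /(_ 0); rewrite rV_cons0 leNgt tM.
  by rewrite F0// dF0.
Qed.

Lemma continuous_boxfun n (h : 'rV[R]_n -> R) (M : R) : continuous h ->
  (forall x, ~ rV_box n M x -> h x = 0) -> exists2 C, 0 <= C & boxfun M C h.
Proof.
move=> ch h0; have [C C0 HC] := continuous_box_bounded M ch; exists C => //; split.
- exact: continuous_rV_measurable.
- by move=> z; have [/HC//|/h0 ->] := pselect (rV_box n M z); rewrite normr0.
- by move=> z hz; apply: contrapT => /h0 z0; rewrite z0 eqxx in hz.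
Qed.

End line_calculus.

(** * The weighted inequality for smooth functions *)

Record cutoff (R : realType) (e M : R) (th th1 th2 : R -> R) : Prop := Cutoff {
  cutoff_gt0 : 0 < e;
  cutoff_derive : forall q : R, 0 < q -> is_derive q 1 th (th1 q);
  cutoff_derive1 : forall q : R, 0 < q -> is_derive q 1 th1 (th2 q);
  cutoff_continuous2 : forall q, 0 < q -> {for q, continuous th2};
  cutoff_support : forall q, q < e \/ M < q -> [/\ th q = 0, th1 q = 0 & th2 q = 0];
  cutoff_ge0 : forall q, 0 <= th q }.

Section core.
Context {R : realType} (n : nat).
Local Notation mu := (lebesgue_rV R n.+1).
Variables (th th1 th2 : R -> R) (e M lam : R).
Hypothesis thP : cutoff e M th th1 th2.

Let a : R := (n.+1%:R - 4) / 2.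
(** The non-constant part of [b], as a function of [q = |x|^2]. Two properties matter: it stays
    between 0 and [lam], and its derivative [damp1] is positive when [lam] is. *)
Definition damp (q : R) := lam * (q * (1 + q)^-1).
Definition damp1 (q : R) := lam * ((1 + q)^-1 * (1 + q)^-1).
Let kap := damp.
Let kap1 := damp1.

Definition weightV q := th q * q^-1.
Definition weightW q := th q * (q^-1 * q^-1).
(** The coefficient of [phi^2] left by completing the square. No term [damp * weightW] of first
    order appears, because [(n.+1 - 4) / 2] is the stationary point; the gain is [2 damp1 weightV],
    and terms with [th1], [th2] disappear with the cutoff. *)
Definition potential q := weightW q * ((n.+1%:R - 4 + ((n.+1%:R - 4) / 2) ^+ 2) + (-1) * (damp q * damp q)) +
  2 * (damp1 q * weightV q) + 2 * (damp q * (th1 q * q^-1)) + (-2) * th2 q.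

Let V := weightV.
Let W := weightW.
Let V1 q := th1 q * q^-1 + (-1) * W q.
Let W1 q := th1 q * (q^-1 * q^-1) + th q * (-2 * (q^-1 * q^-1 * q^-1)).
(** This is [b V / q - V'] for [b = a + kap]: here [V / q = W], and the 1 comes from the term [- W]
    in [V']. *)
Let U q := (a + 1 + kap q) * W q + (-1) * (th1 q * q^-1).
Let U1 q := (kap1 q * W q + (a + 1 + kap q) * W1 q + th1 q * (q^-1 * q^-1)) + ((-1) * q^-1) * th2 q.

Section derivatives.
Variable q : R.
Hypothesis q0 : 0 < q.

Let qn0 : q != 0. Proof. exact: lt0r_neq0. Qed.
Let q1n0 : 1 + q != 0. Proof. by rewrite lt0r_neq0// addr_gt0. Qed.
Let Di : is_derive q 1 (id : R -> R) 1. Proof. exact: is_derive_id. Qed.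
Let DI : is_derive q 1 (fun t : R => t^-1) (- (q^-1 * q^-1)).
Proof. by apply: is_derive_eq (@is_derive_inv R id q 1 qn0 Di) _; field; exact: qn0. Qed.
Let DII := is_derive_mul DI DI.
Let Dth := cutoff_derive thP q0.
Let Dth1 := cutoff_derive1 thP q0.
Let Da (b : R) : is_derive q 1 (fun=> b) 0. Proof. exact: is_derive_cst. Qed.
Let D1q := @is_derive_inv R (fun t : R => 1 + t) q (0 + 1) q1n0 (is_derive_add (Da 1) Di).
Let Dkap : is_derive q 1 kap (kap1 q).
Proof.
apply: is_derive_eq (is_derive_cst_mul lam (is_derive_mul Di D1q)) _.
by rewrite /kap1 /damp1; field; exact: q1n0.
Qed.
Let Dkap1 := is_derive_cst_mul lam (is_derive_mul D1q D1q).
Let DW : is_derive q 1 W (W1 q).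
Proof. by apply: is_derive_eq (is_derive_mul Dth DII) _; rewrite /W1; ring. Qed.
Let DW1 := is_derive_add (is_derive_mul Dth1 DII) (is_derive_mul Dth (is_derive_cst_mul (-2) (is_derive_mul DII DI))).

Let DV_pos : is_derive q 1 V (V1 q).
Proof. by apply: is_derive_eq (is_derive_mul Dth DI) _; rewrite /V1 /W /weightW; ring. Qed.

Let DU_pos : is_derive q 1 U (U1 q).
Proof.
apply: is_derive_eq (is_derive_add (is_derive_mul (is_derive_add (Da (a + 1)) Dkap) DW)
  (is_derive_cst_mul (-1) (is_derive_mul Dth1 DI))) _.
by rewrite /U1; ring.
Qed.

Let cV1_pos : {for q, continuous V1}.
Proof. exact: is_derive_continuous (is_derive_add (is_derive_mul Dth1 DI) (is_derive_cst_mul (-1) DW)). Qed.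

Let cU1_pos : {for q, continuous U1}.
Proof.
apply: (continuous_affine (is_derive_add (is_derive_add (is_derive_mul Dkap1 DW)
  (is_derive_mul (is_derive_add (Da (a + 1)) Dkap) DW1)) (is_derive_mul Dth1 DII))
  (is_derive_cst_mul (-1) DI) (cutoff_continuous2 thP q0)).
Qed.

Let cpot_pos : {for q, continuous potential}.
Proof.
apply: (continuous_affine (is_derive_add (is_derive_add
  (is_derive_mul DW (is_derive_add (Da (n.+1%:R - 4 + ((n.+1%:R - 4) / 2) ^+ 2)) (is_derive_cst_mul (-1) (is_derive_mul Dkap Dkap))))
  (is_derive_cst_mul 2 (is_derive_mul Dkap1 DV_pos)))
  (is_derive_cst_mul 2 (is_derive_mul Dkap (is_derive_mul Dth1 DI)))) (Da (-2)) (cutoff_continuous2 thP q0)).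
Qed.

Lemma weight_derivatives : [/\ is_derive q 1 V (V1 q), is_derive q 1 U (U1 q),
  {for q, continuous W}, {for q, continuous V1} & {for q, continuous U1} /\ {for q, continuous potential}].
Proof. split; [exact: DV_pos|exact: DU_pos|exact: is_derive_continuous DW|exact: cV1_pos|].
by split; [exact: cU1_pos|exact: cpot_pos]. Qed.

End derivatives.

Let zeros q : q < e \/ M < q -> [/\ V q = 0, W q = 0, V1 q = 0, U q = 0 & U1 q = 0 /\ potential q = 0].
Proof.
move=> /(cutoff_support thP)[z z1 z2].
have z3 : V q = 0 by rewrite /V /weightV z mul0r.
have z4 : W q = 0 by rewrite /W /weightW z mul0r.
have z5 : V1 q = 0 by rewrite /V1 z4 z1; ring.
have z6 : U q = 0 by rewrite /U z4 z1; ring.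
split => //; split; first by rewrite /U1 /W1 z4 z z1 z2; ring.
by rewrite /potential -/(W q) -/(V q) z3 z4 z1 z2; ring.
Qed.

Let e0 := cutoff_gt0 thP.

Let DV : forall q : R, is_derive q 1 V (V1 q).
Proof.
apply: (is_derive_cut e0); first by move=> q q0; have [] := weight_derivatives q0.
by move=> q qe; have [? ? ? ? []] := zeros (or_introl qe).
Qed.

Let DU : forall q : R, is_derive q 1 U (U1 q).
Proof.
apply: (is_derive_cut e0); first by move=> q q0; have [] := weight_derivatives q0.
by move=> q qe; have [? ? ? ? []] := zeros (or_introl qe).
Qed.

Let cV1 : continuous V1.
Proof.
apply: (continuous_cut e0); first by move=> q q0; have [] := weight_derivatives q0.
by move=> q qe; have [? ? ? ? []] := zeros (or_introl qe).
Qed.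

Let cU1 : continuous U1.
Proof.
apply: (continuous_cut e0); first by move=> q q0; have [? ? ? ? []] := weight_derivatives q0.
by move=> q qe; have [? ? ? ? []] := zeros (or_introl qe).
Qed.

Lemma continuous_weightV : continuous weightV.
Proof. by move=> q; exact: is_derive_continuous (DV q). Qed.

Lemma continuous_weightW : continuous weightW.
Proof.
apply: (continuous_cut e0); first by move=> q q0; have [] := weight_derivatives q0.
by move=> q qe; have [? ? ? ? []] := zeros (or_introl qe).
Qed.

Lemma continuous_potential : continuous potential.
Proof.
apply: (continuous_cut e0); first by move=> q q0; have [? ? ? ? []] := weight_derivatives q0.
by move=> q qe; have [? ? ? ? []] := zeros (or_introl qe).
Qed.

Let cU : continuous U. Proof. by move=> q; exact: is_derive_continuous (DU q). Qed.

Definition cutoff_box : R := `|M| + 1.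

Lemma sqn_out_box (x : 'rV[R]_n.+1) : ~ rV_box n.+1 cutoff_box x -> M < sqn x.
Proof.
move=> xM; rewrite ltNge; apply/negP => sM; apply: xM => i; rewrite /cutoff_box.
have := le_trans (coor_sqr_le_sqn x i) sM; rewrite -[x 0 i ^+ 2]real_normK ?num_real//.
have := normr_ge0 (x 0 i); have := ler_norm M; have := normr_ge0 M.
by set t := `|x 0 i|; set m := `|M| => m0 Mm t0 tM; rewrite leNgt; apply/negP => mt; nra.
Qed.

Lemma weights_out_box x : ~ rV_box n.+1 cutoff_box x ->
  [/\ weightV (sqn x) = 0, weightW (sqn x) = 0 & potential (sqn x) = 0].
Proof. by move=> /sqn_out_box qM; have [? ? ? ? []] := zeros (or_intror qM). Qed.

Variables (phi : 'rV[R]_n.+1 -> R) (D : 'I_n.+1 -> 'rV[R]_n.+1 -> R)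
  (DD : 'I_n.+1 -> 'I_n.+1 -> 'rV[R]_n.+1 -> R).
Hypotheses (Dphi : is_grad phi D) (DDphi : forall i, is_grad (D i) (DD i))
  (cphi : continuous phi) (cD : forall i, continuous (D i)) (cDD : forall i, continuous (DD i i)).

Let Phi i (x : 'rV[R]_n.+1) := (D i x * phi x) * V (sqn x) + (x 0 i * (phi x * phi x)) * U (sqn x).
Let dPhi i (x : 'rV[R]_n.+1) :=
  (DD i i x * phi x + D i x * D i x) * V (sqn x) + (D i x * phi x) * (V1 (sqn x) * (2 * x 0 i)) +
  ((phi x * phi x + x 0 i * (2 * (phi x * D i x))) * U (sqn x) +
   (x 0 i * (phi x * phi x)) * (U1 (sqn x) * (2 * x 0 i))).

Let is_grad_sqn : is_grad (@sqn R n.+1) (fun i x => 2 * x 0 i).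
Proof. by move=> c s c' H; exact: is_derive_sqn. Qed.

Let Phi_line i x (t : R) : is_derive t 1 (fun s : R => Phi i (x + s *: delta_mx 0 i)) (dPhi i (x + t *: delta_mx 0 i)).
Proof.
have Dq := is_grad_line x i t is_grad_sqn; have Df := is_grad_line x i t Dphi.
have Dd := is_grad_line x i t (DDphi i); have Dx := is_derive_coor_line x i i t.
have DVq := is_derive_comp1 (DV (sqn (x + t *: delta_mx 0 i))) Dq.
have DUq := is_derive_comp1 (DU (sqn (x + t *: delta_mx 0 i))) Dq.
apply: is_derive_eq (is_derive_add (is_derive_mul (is_derive_mul Dd Df) DVq)
  (is_derive_mul (is_derive_mul Dx (is_derive_mul Df Df)) DUq)) _.
rewrite /dPhi; set z := x + t *: delta_mx 0 i.
have -> : (delta_mx 0 i : 'rV[R]_n.+1) 0 i = 1 by rewrite mxE !eqxx.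
by ring.
Qed.

Let comp_sqn (f : R -> R) : continuous f -> continuous (fun x : 'rV[R]_n.+1 => f (sqn x)).
Proof. by move=> cf; apply: rV_continuous_comp => //; exact: continuous_sqn. Qed.

Let cVs := comp_sqn continuous_weightV.
Let cUs := comp_sqn cU.
Let cV1s := comp_sqn cV1.
Let cU1s := comp_sqn cU1.
Let cWs := comp_sqn continuous_weightW.
Let cps := comp_sqn continuous_potential.

Let cdPhi i : continuous (dPhi i).
Proof.
have cx : continuous (fun x : 'rV[R]_n.+1 => x 0 i) by exact: rV_coor_continuous.
have c2 : continuous (fun _ : 'rV[R]_n.+1 => 2 : R) by exact: rV_continuous_cst.
have c2x := rV_continuousM c2 cx; have cff := rV_continuousM cphi cphi.
have cDf := rV_continuousM (@cD i) cphi; have cfD := rV_continuousM cphi (@cD i).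
apply: rV_continuousD.
  apply: rV_continuousD; last exact: rV_continuousM cDf (rV_continuousM cV1s c2x).
  exact: (rV_continuousM (rV_continuousD (rV_continuousM (@cDD i) cphi) (rV_continuousM (@cD i) (@cD i))) cVs).
apply: rV_continuousD; last exact: (rV_continuousM (rV_continuousM cx cff) (rV_continuousM cU1s c2x)).
exact: (rV_continuousM (rV_continuousD cff (rV_continuousM cx (rV_continuousM c2 cfD))) cUs).
Qed.

Let int_dPhi i : mu.-integrable setT (EFin \o dPhi i) /\ (\int[mu]_x (dPhi i x)%:E = 0)%E.
Proof.
have [|C _ bC] := continuous_boxfun (M := cutoff_box) (@cdPhi i).
  move=> x /sqn_out_box qM; have [v w v1 u [u1 p]] := zeros (or_intror qM).
  by rewrite /dPhi v v1 u u1; ring.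
split; first exact: boxfun_integrable bC.
apply: (integral_partial_eq0 (i := i) (F := Phi i) bC).
  by move=> x /sqn_out_box qM; have [v w v1 u [u1 p]] := zeros (or_intror qM); rewrite /Phi v u; ring.
by move=> x; split; [exact: Phi_line|apply: continuous_line; exact: cdPhi].
Qed.

Let L x := \sum_i DD i i x.
Let f1 x := L x * phi x * V (sqn x).
Let f2 x := tangential D x * W (sqn x).
Let f3 x := phi x ^+ 2 * potential (sqn x).

Let pointwise x : f1 x + f2 x + f3 x <= \sum_i dPhi i x.
Proof.
(* Below [e] all weights are 0; from there on [q > 0] and the divisions in the weights are
   genuine. *)
have [qe|qe] := ltP (sqn x) e.
  have [v w v1 u [u1 p]] := zeros (or_introl qe).
  rewrite /f1 /f2 /f3 v w p !mulr0 !addr0 sumr_ge0// => i _.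
  by rewrite /dPhi v v1 u u1 !(mulr0, mul0r, addr0).
have q0 : 0 < sqn x by exact: lt_le_trans e0 qe.
have -> : \sum_i dPhi i x = (phi x * V (sqn x)) * L x + V (sqn x) * \sum_i D i x ^+ 2 +
    (2 * phi x * (V1 (sqn x) + U (sqn x))) * (\sum_i x 0 i * D i x) + n.+1%:R * (phi x ^+ 2 * U (sqn x)) +
    2 * phi x ^+ 2 * U1 (sqn x) * sqn x.
  have e5 : n.+1%:R * (phi x ^+ 2 * U (sqn x)) = \sum_(i < n.+1) phi x ^+ 2 * U (sqn x).
    by rewrite sumr_const card_ord mulr_natl.
  have e6 : 2 * phi x ^+ 2 * U1 (sqn x) * sqn x = \sum_i 2 * phi x ^+ 2 * U1 (sqn x) * x 0 i ^+ 2.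
    by rewrite -mulr_sumr.
  rewrite e5 e6 /L !mulr_sumr -!big_split/=; apply: eq_bigr => i _; rewrite /dPhi; ring.
rewrite /f1 /f2 /f3 /tangential; set q := sqn x in q0 *; set d := \sum_i D i x ^+ 2; set E := \sum_i _ * _.
have W0 : 0 <= W q by rewrite /W /weightW mulr_ge0 ?(cutoff_ge0 thP)// -expr2 sqr_ge0.
have q1 : 1 + q != 0 by rewrite lt0r_neq0// addr_gt0.
have q1' : q != 0 by exact: lt0r_neq0.
rewrite -subr_ge0 (_ : _ - _ = (E + (a + kap q) * phi x) ^+ 2 * W q); first by rewrite mulr_ge0// sqr_ge0.
rewrite /potential /U1 /U /V1 /W1 /V /W /weightV /weightW /kap1 /kap /damp /damp1 /a.
set N : R := n.+1%:R; field; exact/andP.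
Qed.

Let out0 x : ~ rV_box n.+1 cutoff_box x -> [/\ f1 x = 0, f2 x = 0 & f3 x = 0].
Proof. by move=> /weights_out_box[v w p]; rewrite /f1 /f2 /f3 /V /W v w p !mulr0. Qed.

Let cx i : continuous (fun x : 'rV[R]_n.+1 => x 0 i). Proof. exact: rV_coor_continuous. Qed.

Let ctang : continuous (tangential D).
Proof.
have cs := rV_continuous_sum (fun i => rV_continuousM (@cx i) (@cD i)).
have cd := rV_continuous_sum (fun i => rV_continuousM (@cD i) (@cD i)).
have c1 : continuous (fun _ : 'rV[R]_n.+1 => -1 : R) by exact: rV_continuous_cst.
have := rV_continuousD (rV_continuousM (@continuous_sqn R n.+1) cd) (rV_continuousM c1 (rV_continuousM cs cs)).
rewrite (_ : (fun x => _) = tangential D)//; apply/funext => x; rewrite /tangential mulN1r expr2.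
by congr (_ * _ - _); apply: eq_bigr => i _; rewrite expr2.
Qed.

Lemma integrable_core : [/\ mu.-integrable setT (EFin \o f1), mu.-integrable setT (EFin \o f2) &
  mu.-integrable setT (EFin \o f3)].
Proof.
have cL : continuous L by apply: rV_continuous_sum => i; exact: cDD.
have c1 : continuous f1 by exact: (rV_continuousM (rV_continuousM cL cphi) cVs).
have c2 : continuous f2 by exact: (rV_continuousM ctang cWs).
have c3 : continuous f3.
  have := rV_continuousM (rV_continuousM cphi cphi) cps.
  by rewrite (_ : (fun x => _) = f3)//; apply/funext => x; rewrite /f3 expr2.
split.
- by have [|C _ bC] := continuous_boxfun (M := cutoff_box) c1; [by move=> x /out0[]|exact: boxfun_integrable bC].
- by have [|C _ bC] := continuous_boxfun (M := cutoff_box) c2; [by move=> x /out0[]|exact: boxfun_integrable bC].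
- by have [|C _ bC] := continuous_boxfun (M := cutoff_box) c3; [by move=> x /out0[]|exact: boxfun_integrable bC].
Qed.

(* The divergence of D_i phi phi V + x_i phi^2 U integrates to zero, and exceeds the
   sum of the three integrands by a square. *)
Lemma core_inequality : \int[mu]_x f1 x + \int[mu]_x f2 x + \int[mu]_x f3 x <= 0.
Proof.
have [i1 i2 i3] := integrable_core.
have i12 := integrableRD i1 i2; have i123 := integrableRD i12 i3.
rewrite -RintegralD; [|exact: measurableT|exact: i1|exact: i2].
rewrite -RintegralD; [|exact: measurableT|exact: i12|exact: i3].
have id := integrableR_sum (fun i => (int_dPhi i).1).
have <- : \int[mu]_x (\sum_i dPhi i x) = 0.
  rewrite (Rintegral_sum (fun i => (int_dPhi i).1)) big1// => i _.
  by rewrite /Rintegral (int_dPhi i).2.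
by apply: le_Rintegral; [exact: measurableT|exact: i123|exact: id|move=> x _; exact: pointwise].
Qed.

Lemma measurable_tangential : measurable_fun setT (tangential D).
Proof. exact: (continuous_rV_measurable ctang). Qed.

End core.

(** * Limits of products of mollifications *)

Section square_integrable.
Context {R : realType} {n : nat}.
Local Notation mu := (lebesgue_rV R n).
Implicit Types (f g h u w : 'rV[R]_n -> R).
Local Notation T j f := (mollify (mollifier (inv1 j)) f).

(** A small multiple of [p^2], a fixed L^2 quantity, against a large multiple of [b^2], a
    mollification error. *)
Lemma amgm_scale (s C p b : R) : 0 < s -> C * p * b <= s * p ^+ 2 + C ^+ 2 / s * b ^+ 2.
Proof.
move=> s0; rewrite -subr_ge0.
rewrite (_ : _ - _ = s^-1 * ((s * p - C * b / 2) ^+ 2 + 3 / 4 * (C * b) ^+ 2)).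
  apply: mulr_ge0; first by rewrite invr_ge0 ltW.
  apply: addr_ge0; first exact: sqr_ge0.
  by apply: mulr_ge0; [lra|exact: sqr_ge0].
by field; exact: lt0r_neq0.
Qed.

Lemma sqintD f h : sqint f -> sqint h -> sqint (fun x => f x + h x).
Proof.
move=> [mf fi] [mh hi]; have m := measurable_funD mf mh; split; first exact: m.
apply: le_integrableR (integrableRD (integrableRZ 2 fi) (integrableRZ 2 hi)).
  exact: (measurable_funX 2 m).
move=> x; rewrite ger0_norm ?sqr_ge0//; have := sqr_ge0 (f x - h x); rewrite !expr2; lra.
Qed.

Lemma integrable_mul_bounded f h w (C : R) : sqint f -> sqint h -> measurable_fun setT w ->
  (forall x, `|w x| <= C) -> mu.-integrable setT (EFin \o (fun x => f x * h x * w x)).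
Proof.
move=> sf sh mw wC; have [mf fi] := sf; have [mh hi] := sh.
apply: le_integrableR (integrableRZ C (integrableRD fi hi)).
  exact: (measurable_funM (measurable_funM mf mh) mw).
move=> x; rewrite normrM mulrC; apply: ler_pM => //.
rewrite normrM -[f x ^+ 2]real_normK ?num_real// -[h x ^+ 2]real_normK ?num_real//.
by have := sqr_ge0 (`|f x| - `|h x|); have := normr_ge0 (f x); have := normr_ge0 (h x); nra.
Qed.

Lemma mollify_tail f (e : R) : sqint f -> 0 < e -> exists N, forall j, (N <= j)%N ->
  sqint (fun x => T j f x - f x) /\ \int[mu]_x ((T j f x - f x) ^+ 2) <= e.
Proof.
move=> sf e0; have [N H] := mollify_cvg sf e0; exists N => j /H h.
have m := measurable_funB (@measurable_mollify R n f j sf) sf.1.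
have i : mu.-integrable setT (EFin \o (fun x => (T j f x - f x) ^+ 2)).
  apply: ge0_integrableR; [exact: (measurable_funX 2 m)|by move=> x; exact: sqr_ge0|].
  by apply: le_lt_trans h _; rewrite ltry.
split; first by split; [exact: m|exact: i].
by rewrite -lee_fin -(integral_Rintegral i).
Qed.

Lemma mollify_mul_cvg u g w (C : R) : sqint u -> sqint g -> measurable_fun setT w -> 0 <= C ->
  (forall x, `|w x| <= C) -> forall e : R, 0 < e -> exists N, forall j, (N <= j)%N ->
  `|\int[mu]_x (T j g x * T j u x * w x) - \int[mu]_x (g x * u x * w x)| <= e.
Proof.
move=> su sg mw C0 wC e e0.
set G := \int[mu]_x (g x ^+ 2) + \int[mu]_x (u x ^+ 2).
have G0 : 0 <= G by rewrite addr_ge0//; apply: Rintegral_ge0 => x _; exact: sqr_ge0.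
(* The fixed norms contribute [s G <= e / 2]; the two mollification errors, each at most
   [e / (4 (K + 1))], contribute at most [e / 2] after multiplication by [K]. *)
pose s := e / (2 * (G + 1)); have s0 : 0 < s by rewrite divr_gt0// mulr_gt0// ltr_wpDl.
pose K := C ^+ 2 / s + C.
have K0 : 0 <= K by rewrite addr_ge0// divr_ge0 ?sqr_ge0// ltW.
have y0 : 0 < e / (4 * (K + 1)) by rewrite divr_gt0// mulr_gt0// ltr_wpDl.
have [N1 H1] := mollify_tail su y0; have [N2 H2] := mollify_tail sg y0.
exists (maxn N1 N2) => j; rewrite geq_max => /andP[/H1[sb ib] /H2[sa ia]].
have sTu : sqint (T j u).
  have := sqintD sb su; rewrite (_ : (fun x => _) = T j u)//.
  by apply/funext => x; rewrite subrK.
have sTg : sqint (T j g).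
  have := sqintD sa sg; rewrite (_ : (fun x => _) = T j g)//.
  by apply/funext => x; rewrite subrK.
have i1 := integrable_mul_bounded sTg sTu mw wC; have i2 := integrable_mul_bounded sg su mw wC.
have igu := integrableRD sg.2 su.2; have iab := integrableRD sa.2 sb.2.
have ib2 := integrableRD (integrableRZ s igu) (integrableRZ K iab).
rewrite -RintegralB; [|exact: measurableT|exact: i1|exact: i2].
have iB := integrableRB i1 i2.
apply: le_trans (le_normr_Rintegral measurableT iB) _.
have pw x : `|T j g x * T j u x * w x - g x * u x * w x| <=
    s * (g x ^+ 2 + u x ^+ 2) + K * ((T j g x - g x) ^+ 2 + (T j u x - u x) ^+ 2).
  set p := g x; set q := u x; set a := T j g x - p; set b := T j u x - q.
  have -> : T j g x * T j u x * w x - p * q * w x = (p * b + q * a + a * b) * w x.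
    by rewrite /a /b /p /q; ring.
  have n1 : `|p * b + q * a + a * b| <= `|p| * `|b| + `|q| * `|a| + `|a| * `|b|.
    by rewrite -!normrM; apply: le_trans (ler_normD _ _) _; rewrite lerD2r; exact: ler_normD.
  rewrite normrM; apply: (le_trans (ler_pM (normr_ge0 _) (normr_ge0 _) n1 (wC x))).
  rewrite -(real_normK (num_real p)) -(real_normK (num_real q)) -(real_normK (num_real a)) -(real_normK (num_real b)).
  have A1 := amgm_scale C `|p| `|b| s0; have A2 := amgm_scale C `|q| `|a| s0.
  have A3 : C * `|a| * `|b| <= C * (`|a| ^+ 2 + `|b| ^+ 2).
    by rewrite -mulrA ler_wpM2l//; have := sqr_ge0 (`|a| - `|b|); have := normr_ge0 a; have := normr_ge0 b; nra.
  move: A1 A2 A3; rewrite /K; move: `|p| `|q| `|a| `|b| (C ^+ 2 / s) => P Q A B Z A1 A2 A3.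
  have -> : (P * B + Q * A + A * B) * C = C * P * B + C * Q * A + C * A * B by ring.
  by rewrite mulrDl !mulrDr in A1 A2 A3 *; lra.
have inorm : mu.-integrable setT (EFin \o (fun x => `|T j g x * T j u x * w x - g x * u x * w x|)).
  apply: (le_integrableR _ _ ib2); first by apply: measurableT_comp => //;
    exact: (measurable_funB (measurable_funM (measurable_funM sTg.1 sTu.1) mw) (measurable_funM (measurable_funM sg.1 su.1) mw)).
  by move=> x; rewrite normr_id; exact: pw.
apply: (le_trans (le_Rintegral measurableT inorm ib2 (fun x _ => pw x))).
rewrite RintegralD; [|exact: measurableT|exact: integrableRZ igu|exact: integrableRZ iab].
rewrite RintegralZl; [|exact: measurableT|exact: igu].
rewrite RintegralZl; [|exact: measurableT|exact: iab].
rewrite RintegralD; [|exact: measurableT|exact: sg.2|exact: su.2].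
rewrite RintegralD; [|exact: measurableT|exact: sa.2|exact: sb.2].
rewrite -/G; set y := e / (4 * (K + 1)) in ia ib *.
have k1 : s * G <= e / 2.
  by rewrite /s mulrAC ler_pdivrMr ?mulr_gt0 ?ltr_wpDl//; nra.
have k2 : K * y <= e / 4.
  by rewrite /y mulrA ler_pdivrMr ?mulr_gt0 ?ltr_wpDl//; nra.
have k3 := ler_wpM2l K0 (lerD ia ib).
by move: k3; rewrite [K * (y + y)]mulrDr; lra.
Qed.

End square_integrable.

(** * The weighted inequality for L^2 functions with vanishing spherical means *)

Section weak_stage.
Context {R : realType} (n : nat).
Hypothesis n0 : (0 < n)%N.
Local Notation mu := (lebesgue_rV R n.+1).
Local Notation sigma := (@sphere_measure R n.+1).
Local Notation S := (@sphere_area R n.+1).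
Local Notation T j f := (mollify (mollifier (inv1 j)) f).
Variables (u g : 'rV[R]_n.+1 -> R).
Hypotheses (su : sqint u) (sg : sqint g)
  (weak : forall psi, test_function psi ->
    \int[mu]_x (u x * laplacian psi x) = \int[mu]_x (g x * psi x))
  (mean0 : {ae mu, forall x, \int[sigma]_(w in @esphere R n.+1) u (enorm x *: w) = 0}).

Let nS : (0 < n.+1)%N. Proof. by []. Qed.

(** Two derivatives in [x] bring two minus signs, so the Laplacian of the mollification is [u]
    tested against the Laplacian of a translated kernel, and the weak equation replaces it by [g]
    tested against the kernel. *)
Lemma mollify_laplacian j : exists D DD, [/\ is_grad (T j u) D, (forall i, is_grad (D i) (DD i)),
  continuous (T j u) /\ (forall i, continuous (D i)), (forall i, continuous (DD i i)) &
  forall x, \sum_i DD i i x = T j g x].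
Proof.
set k := mollifier _; have bk : bump_kernel (inv1 j) k := @bump_kernel_mollifier R n.+1 (inv1 j).
have [dk bdk Dk] := bump_kernel_grad bk.
have /choice[ddk H] i : exists d, (forall l, bump_kernel (inv1 j) (d l)) /\ is_grad (dk i) d.
  by have [d b1 b2] := bump_kernel_grad (bdk i); exists d.
have bdd i := (H i).1; have Ddd i := (H i).2.
have G i := mollify_has_grad su (bdk i) (Ddd i) (bdd i).
exists (fun i x => - mollify (dk i) u x), (fun i l x => - - mollify (ddk i l) u x); split.
- exact: has_grad_is_grad (mollify_has_grad su bk Dk bdk).
- by move=> i; apply: is_gradN; exact: has_grad_is_grad (G i).
- split; first exact: has_grad_continuous (mollify_has_grad su bk Dk bdk).
  move=> i; rewrite (_ : (fun x => _) = fun x => (-1) * mollify (dk i) u x); last first.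
    by apply/funext => x; rewrite mulN1r.
  have c1 : continuous (fun _ : 'rV[R]_n.+1 => -1 : R) by exact: rV_continuous_cst.
  exact: (rV_continuousM c1 (has_grad_continuous (G i))).
- move=> i; rewrite (_ : (fun x => _) = mollify (ddk i i) u); last by apply/funext => x; rewrite opprK.
  have [dd b1 b2] := bump_kernel_grad (bdd i i).
  exact: has_grad_continuous (mollify_has_grad su (bdd i i) b2 b1).
- move=> x; rewrite (eq_bigr (fun i => mollify (ddk i i) u x)) => [|i _]; last by rewrite opprK.
  rewrite /mollify -Rintegral_sum; last first.
    by move=> i; have [C _ bC] := bump_kernel_boxfun (bdd i i); exact: mollify_integrable su bC.
  rewrite -(weak (bump_kernel_test x bk)); apply: eq_Rintegral => y _.
  by rewrite (is_grad_laplacian x y Dk Ddd) mulr_sumr.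
Qed.

Lemma measurable_sphere_mean (F : 'rV[R]_n.+1 -> R) (B : R) : measurable_fun setT F ->
  (forall x, `|F x| <= B) -> measurable_fun setT (fun x : 'rV[R]_n.+1 => \int[sigma]_w F (enorm x *: w)).
Proof.
move=> mF FB.
pose G (p : measurableTypeR R * 'rV[R]_n.+1) : \bar R := (F (p.1 *: p.2) + B)%:E.
have mG : measurable_fun setT G.
  apply/measurable_EFinP; apply: measurable_funD; last exact: measurable_cst.
  exact: (measurableT_comp mF measurable_polar_scale).
have G0 p : (0 <= G p)%E by rewrite lee_fin; have := FB (p.1 *: p.2); rewrite ler_norml; lra.
have B0 : 0 <= B by exact: le_trans (normr_ge0 _) (FB 0).
have mI := measurable_sphere_integral mG G0.
have -> : (fun x : 'rV[R]_n.+1 => \int[sigma]_w F (enorm x *: w)) =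
    (fun x : 'rV[R]_n.+1 => fine (\int[sigma]_w G (enorm x, w))%E - B * S).
  apply/funext => x.
  have iF : sigma.-integrable setT (EFin \o (fun w => F (enorm x *: w))).
    apply: (sphere_integrable_bounded (B := B)); last by move=> w; exact: FB.
    exact: (measurableT_comp mF (measurable_scale_rV _)).
  have iB : sigma.-integrable setT (EFin \o (fun=> B)).
    by apply: (sphere_integrable_bounded (B := B)) => // w; rewrite ger0_norm.
  rewrite /G /= (integral_Rintegral (integrableRD iF iB)) /=.
  rewrite RintegralD; [|exact: measurableT|exact: iF|exact: iB].
  by rewrite Rintegral_cst// -[X in _ + B * X - _]/S addrK.
apply: measurable_funB; last exact: measurable_cst.
exact: (measurableT_comp (measurable_realfun.fine_measurable measurableT) mI).
Qed.

Variables (th th1 th2 : R -> R) (e M lam : R).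
Hypothesis thP : cutoff e M th th1 th2.

Let V (x : 'rV[R]_n.+1) := weightV th (sqn x).
Let W (x : 'rV[R]_n.+1) := weightW th (sqn x).
(** The term [n%:R * W] is what the inequality on spheres extracts from the tangential gradient in
    dimension [n.+1]. *)
Let Q (x : 'rV[R]_n.+1) := potential n th th1 th2 lam (sqn x) + n%:R * W x.
Let A2 : R := (\int[mu]_x (gauss_rV x * enorm x)) ^+ 2.

Let W0 q : 0 <= weightW th q.
Proof. by rewrite /weightW mulr_ge0 ?(cutoff_ge0 thP)// -expr2 sqr_ge0. Qed.

Let comp_sqn (f : R -> R) : continuous f -> continuous (fun x : 'rV[R]_n.+1 => f (sqn x)).
Proof. by move=> cf; apply: rV_continuous_comp => //; exact: continuous_sqn. Qed.

Lemma weights_boxfun : exists2 C, 0 <= C &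
  [/\ boxfun (cutoff_box M) C V, boxfun (cutoff_box M) C W & boxfun (cutoff_box M) C Q].
Proof.
have cV := comp_sqn (continuous_weightV n lam thP).
have cW := comp_sqn (continuous_weightW n lam thP).
have cn : continuous (fun _ : 'rV[R]_n.+1 => n%:R : R) by exact: rV_continuous_cst.
have cQ := rV_continuousD (comp_sqn (continuous_potential (n := n) (lam := lam) thP)) (rV_continuousM cn cW).
have [|C1 C10 b1] := continuous_boxfun (M := cutoff_box M) cV.
  by move=> x /(weights_out_box lam thP)[].
have [|C2 C20 b2] := continuous_boxfun (M := cutoff_box M) cW.
  by move=> x /(weights_out_box lam thP)[].
have [|C3 C30 b3] := continuous_boxfun (M := cutoff_box M) cQ.
  by move=> x /(weights_out_box lam thP)[_ w p]; rewrite w p mulr0 addr0.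
exists (C1 + C2 + C3); first by rewrite !addr_ge0.
have widen C h : C <= C1 + C2 + C3 -> boxfun (cutoff_box M) C h -> boxfun (cutoff_box M) (C1 + C2 + C3) h.
  by move=> CC [m1 m2 m3]; split => // z; exact: le_trans (m2 z) CC.
by split; [apply: widen b1|apply: widen b2|apply: widen b3]; lra.
Qed.

Let pos_mul_int (h : 'rV[R]_n.+1 -> R) (C : R) : boxfun (cutoff_box M) C W -> sqint h ->
  mu.-integrable setT (EFin \o (fun x => W x * h x ^+ 2)).
Proof.
move=> [mW WC _] [mh hi]; apply: le_integrableR (integrableRZ C hi).
  exact: (measurable_funM mW (measurable_funX 2 mh)).
move=> x; rewrite normrM [`|h x ^+ 2|]ger0_norm ?sqr_ge0// ler_wpM2r ?sqr_ge0//; exact: WC.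
Qed.

(** The tangential integral of the smooth inequality is bounded below sphere by sphere. The
    right-hand side is the price of the spherical means of the mollification. *)
Lemma stage_inequality j (C : R) : boxfun (cutoff_box M) C W -> boxfun (cutoff_box M) C Q ->
  sqint (fun x => T j u x - u x) ->
  \int[mu]_x (T j g x * T j u x * V x) + \int[mu]_x (T j u x * T j u x * Q x) <=
  A2 * \int[mu]_x (W x * (T j u x - u x) ^+ 2).
Proof.
move=> bW bQ sb; have S0 := @sphere_area_gt0 R n.+1 nS.
have [D [DD [G1 G2 [c0 cD] cDD L]]] := mollify_laplacian j.
have sTu : sqint (T j u).
  have := sqintD sb su; rewrite (_ : (fun x => _) = T j u)//.
  by apply/funext => x; rewrite subrK.
have [C' _ bC'] := bump_kernel_boxfun (@bump_kernel_mollifier R n.+1 (inv1 j)).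
have [B B0 HB] := mollify_bounded su bC'.
have core := core_inequality lam thP G1 G2 c0 cD cDD.
have [i1 i2 i3] := integrable_core lam thP c0 cD cDD.
have iW1 := pos_mul_int bW sTu; have iW2 := pos_mul_int bW sb.
have mD := measurable_tangential cD.
have t0 x : 0 <= tangential D x by rewrite subr_ge0 /sqn; exact: cauchy_schwarz_sum.
have mW' : measurable_fun setT (fun t : R => weightW th (t ^+ 2)).
  apply: (measurableT_comp (f := weightW th)); last exact: (measurable_funX 2 (@measurable_id _ _ setT)).
  by apply: continuous_measurable_fun; exact: (continuous_weightW n lam thP).
have W00 : weightW th (0 ^+ 2) = 0.
  have [z _ _] := cutoff_support thP (or_introl (cutoff_gt0 thP)).
  by rewrite /weightW expr0n/= z mul0r.
have A0 : 0 <= A2 / S by rewrite divr_ge0 ?sqr_ge0// ltW.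
have I := integrate_spheres nS (u1 := fun x => T j u x ^+ 2) (u2 := tangential D) (u := T j u)
  (W := fun t => weightW th (t ^+ 2)) (ler0n R n) A0 (measurable_funX 2 sTu.1) mD
  (fun x => sqr_ge0 _) t0 (measurable_sphere_mean sTu.1 HB) mW' (fun t => W0 _) W00
  (fun r r0 => sphere_poincare n0 G1 G2 c0 cD r0).
have J := radial_mean_bound nS sTu.1 HB su mean0 mW' (fun t => W0 _).
have E1 : (\int[mu]_x (weightW th (enorm x ^+ 2) * T j u x ^+ 2)%:E =
    (\int[mu]_x (W x * T j u x ^+ 2))%:E)%E.
  by rewrite -(integral_Rintegral iW1); apply: eq_integral => x _; rewrite enorm_sqr.
have E2 : (\int[mu]_x (weightW th (enorm x ^+ 2) * tangential D x)%:E =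
    (\int[mu]_x (tangential D x * W x))%:E)%E.
  by rewrite -(integral_Rintegral i2); apply: eq_integral => x _; rewrite enorm_sqr mulrC.
have E3 : (\int[mu]_x (weightW th (enorm x ^+ 2) * (T j u x - u x) ^+ 2)%:E =
    (\int[mu]_x (W x * (T j u x - u x) ^+ 2))%:E)%E.
  by rewrite -(integral_Rintegral iW2); apply: eq_integral => x _; rewrite enorm_sqr.
rewrite E1 E2 in I; rewrite E3 in J.
have A0E : (0 <= (A2 / S)%:E)%E by rewrite lee_fin.
have := le_trans I (leeD (lexx _) (lee_wpmul2l A0E J)).
rewrite -!EFinM -!EFinD lee_fin.
set X1 := \int[mu]_x (W x * T j u x ^+ 2); set X2 := \int[mu]_x (tangential D x * W x).
set X3 := \int[mu]_x (W x * _) => H.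
have {}H : n%:R * X1 <= X2 + A2 * X3.
  rewrite -(ler_pM2l S0); apply: le_trans (_ : n%:R * (S * X1) <= _); first by rewrite mulrCA.
  apply: (le_trans H); rewrite mulrDr lerD2l le_eqVlt; apply/orP; left; apply/eqP.
  by field; exact: lt0r_neq0.
have F1 : \int[mu]_x (T j g x * T j u x * V x) = \int[mu]_x ((\sum_i DD i i x) * T j u x * weightV th (sqn x)).
  by apply: eq_Rintegral => x _; rewrite L.
have F2 : \int[mu]_x (T j u x * T j u x * Q x) =
    \int[mu]_x (T j u x ^+ 2 * potential n th th1 th2 lam (sqn x)) + n%:R * X1.
  rewrite -RintegralZl; [|exact: measurableT|exact: iW1].
  rewrite -RintegralD; [|exact: measurableT|exact: i3|exact: (integrableRZ _ iW1)].
  by apply: eq_Rintegral => x _; rewrite /Q; ring.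
rewrite F1 F2.
have core' : \int[mu]_x ((\sum_i DD i i x) * T j u x * weightV th (sqn x)) + X2 +
  \int[mu]_x (T j u x ^+ 2 * potential n th th1 th2 lam (sqn x)) <= 0 by exact: core.
by move: core' H; set a := \int[mu]_x (_ * weightV _ _); set b := \int[mu]_x (_ * potential _ _ _ _ _ _); lra.
Qed.

(** For a fixed cutoff the weights are bounded, so as [j] grows both left-hand integrals converge
    and the price of the spherical means tends to 0. *)
Lemma weak_stage : \int[mu]_x (g x * u x * V x) + \int[mu]_x (u x * u x * Q x) <= 0.
Proof.
have [C C0 [bV bW bQ]] := weights_boxfun; have [mV VC _] := bV; have [mQ QC _] := bQ; have [mW WC _] := bW.
apply/ler_addgt0Pr => d d0; rewrite add0r.
have d3 : 0 < d / 3 by rewrite divr_gt0.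
have A20 : 0 <= A2 by exact: sqr_ge0.
have AC0 : 0 <= A2 * C by exact: mulr_ge0.
have y0 : 0 < d / (3 * (A2 * C + 1)) by rewrite divr_gt0// mulr_gt0// ltr_wpDl.
have [N1 H1] := mollify_mul_cvg su sg mV C0 VC d3.
have [N2 H2] := mollify_mul_cvg su su mQ C0 QC d3.
have [N3 H3] := mollify_tail su y0.
pose j := maxn N1 (maxn N2 N3).
have h1 := H1 j (leq_maxl _ _).
have h2 := H2 j (leq_trans (leq_maxl N2 N3) (leq_maxr _ _)).
have [sb h3] := H3 j (leq_trans (leq_maxr N2 N3) (leq_maxr _ _)).
have st := stage_inequality bW bQ sb.
have h4 : \int[mu]_x (W x * (T j u x - u x) ^+ 2) <= C * \int[mu]_x ((T j u x - u x) ^+ 2).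
  rewrite -RintegralZl; [|exact: measurableT|exact: sb.2].
  apply: le_Rintegral; [exact: measurableT|exact: (pos_mul_int bW sb)|exact: (integrableRZ _ sb.2)|].
  by move=> x _; rewrite ler_wpM2r ?sqr_ge0//; exact: le_trans (ler_norm _) (WC x).
have h5 : A2 * \int[mu]_x (W x * (T j u x - u x) ^+ 2) <= d / 3.
  apply: le_trans (ler_wpM2l A20 h4) _; rewrite mulrA; apply: le_trans (ler_wpM2l AC0 h3) _.
  by rewrite mulrA ler_pdivrMr ?mulr_gt0 ?ltr_wpDl//; nra.
by move: h1 h2; rewrite !ler_norml => /andP[? ?] /andP[? ?]; lra.
Qed.

End weak_stage.

(** * An explicit family of cutoffs *)

Section bump_cutoff.
Context {R : realType}.
Local Notation P0 := (1 : {poly R}).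
Local Notation P1 := (bump_deriv (1 : {poly R})).
Local Notation P2 := (bump_deriv (bump_deriv (1 : {poly R}))).

Lemma bump_poly_le0 (Q : {poly R}) t : t <= 0 -> bump_poly Q t = 0.
Proof. by rewrite /bump_poly; case: ltP. Qed.

Lemma bump_poly_bounded (Q : {poly R}) : exists2 C, 0 <= C & forall t, t <= 1 -> `|bump_poly Q t| <= C.
Proof.
have cQ : continuous (fun z : 'rV[R]_1 => bump_poly Q (z 0 0)).
  by apply: rV_continuous_comp; [exact: continuous_bump_poly|exact: rV_coor_continuous].
have [C C0 H] := continuous_box_bounded 1 cQ; exists C => // t t1.
have [t0|t0] := leP t 0; first by rewrite bump_poly_le0// normr0.
have := H (\row_(i < 1) t); rewrite mxE; apply => i; by rewrite mxE gtr0_norm.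
Qed.

Lemma bump_poly1_gt0 : 0 < bump_poly P0 1.
Proof. by rewrite /bump_poly ltr01 hornerC mul1r expR_gt0. Qed.

Lemma bump_poly1_ge0 t : 0 <= bump_poly P0 t.
Proof. by rewrite /bump_poly; case: ifPn => // _; rewrite hornerC mul1r expR_ge0. Qed.

(** On the support one has [s <= 1], so the factors [s] and [s^2] do no harm. With [s = v q] or
    [s = v / q] this makes bounds uniform in [v]. *)
Lemma scaled_bump_bounded (Q : {poly R}) C : (forall t, t <= 1 -> `|bump_poly Q t| <= C) ->
  forall s, 0 <= s -> [/\ `|bump_poly Q (1 - s)| <= C, `|s * bump_poly Q (1 - s)| <= C &
    `|s ^+ 2 * bump_poly Q (1 - s)| <= C].
Proof.
move=> HC s s0; have h : `|bump_poly Q (1 - s)| <= C by apply: HC; lra.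
have C0 : 0 <= C by exact: le_trans (normr_ge0 _) h.
have [s1|s1] := leP s 1; last by rewrite bump_poly_le0 ?mulr0 ?normr0//; lra.
split => //; rewrite normrM ger0_norm ?sqr_ge0//; apply: le_trans h.
  by rewrite ler_piMl.
by rewrite ler_piMl// expr_le1.
Qed.

(** [cutl] is 0 for [q >= 1 / v] and [cutr] for [0 < q <= v]; the product of the two cuts off both
    infinity and the origin. *)
Definition cutl (Q : {poly R}) (v q : R) := bump_poly Q (1 + (- v) * q).
Definition cutr (Q : {poly R}) (v q : R) := bump_poly Q (1 + (- v) * q^-1).

(** As [v] tends to 0 both factors of the cutoff tend to the value of the bump at 1; this constant
    normalizes the limit to 1. *)
Let c : R := (bump_poly P0 1)^-1 ^+ 2.
Let T0 v q := c * (cutl P0 v q * cutr P0 v q).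
Let T1 v q := c * (((- v) * cutl P1 v q) * cutr P0 v q + cutl P0 v q * (cutr P1 v q * (v * (q^-1 * q^-1)))).
Let T2 v q := c * ((v * v) * (cutl P2 v q * cutr P0 v q) +
  (-2 * v * v) * (cutl P1 v q * (cutr P1 v q * (q^-1 * q^-1))) +
  cutl P0 v q * (cutr P2 v q * ((v * v) * ((q^-1 * q^-1) * (q^-1 * q^-1))) +
    cutr P1 v q * ((-2 * v) * (q^-1 * q^-1 * q^-1)))).

Definition cut0 v q := if 0 < q then T0 v q else 0.
Definition cut1 v q := if 0 < q then T1 v q else 0.
Definition cut2 v q := if 0 < q then T2 v q else 0.

Lemma is_derive_if (F : R -> R) (q d : R) : 0 < q -> is_derive q 1 F d ->
  is_derive q 1 (fun t => if 0 < t then F t else 0) d.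
Proof.
move=> q0 /is_deriveP H; apply/is_deriveP.
have E : {near 0^', (fun h : R => h^-1 *: (F (h *: (1 : R) + q) - F q)) =1
    (fun h : R => h^-1 *: ((if 0 < h *: (1 : R) + q then F (h *: (1 : R) + q) else 0) -
      (if 0 < q then F q else 0)))}.
  near=> h; have hq : `|h| < q by near: h; exact: dnbhs0_lt.
  have -> : 0 < h *: (1 : R) + q by rewrite /GRing.scale/= mulr1; move: hq; rewrite ltr_norml; lra.
  by rewrite q0.
exact: cvg_trans (near_eq_cvg E) H.
Unshelve. all: end_near. Qed.

Lemma bump_cutoff v : 0 < v -> cutoff v v^-1 (cut0 v) (cut1 v) (cut2 v).
Proof.
move=> v0.
have Di (q : R) : is_derive q 1 (id : R -> R) 1 by exact: is_derive_id.
have Dc (q : R) : is_derive q 1 (fun=> 1 : R) 0 by exact: is_derive_cst.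
have DI (q : R) : 0 < q -> is_derive q 1 (fun t : R => t^-1) (- (q^-1 * q^-1)).
  move=> q0; have qn0 : q != 0 by exact: lt0r_neq0.
  by apply: is_derive_eq (@is_derive_inv R id q 1 qn0 (Di q)) _; field; exact: qn0.
have Dl Q (q : R) := @is_derive_comp1 R (bump_poly Q) (fun t : R => 1 + (- v) * t) q _ _ (is_derive_bump_poly Q (1 + (- v) * q))
  (is_derive_add (Dc q) (is_derive_cst_mul (- v) (Di q))).
have Dr Q (q : R) (q0 : 0 < q) := @is_derive_comp1 R (bump_poly Q) (fun t : R => 1 + (- v) * t^-1) q _ _ (is_derive_bump_poly Q (1 + (- v) * q^-1))
  (is_derive_add (Dc q) (is_derive_cst_mul (- v) (DI q q0))).
have D1 (q : R) : 0 < q -> is_derive q 1 (T0 v) (T1 v q).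
  move=> q0; apply: is_derive_eq (is_derive_cst_mul c (is_derive_mul (Dl P0 q) (Dr P0 q q0))) _.
  by rewrite /T1 /cutl /cutr; ring.
have D2 (q : R) : 0 < q -> is_derive q 1 (T1 v) (T2 v q).
  move=> q0; have DII := is_derive_mul (DI q q0) (DI q q0).
  apply: is_derive_eq (is_derive_cst_mul c (is_derive_add
    (is_derive_mul (is_derive_cst_mul (- v) (Dl P1 q)) (Dr P0 q q0))
    (is_derive_mul (Dl P0 q) (is_derive_mul (Dr P1 q q0) (is_derive_cst_mul v DII))))) _.
  by rewrite /T2 /cutl /cutr; ring.
have D3 (q : R) (q0 : 0 < q) := let DII := is_derive_mul (DI q q0) (DI q q0) in
  is_derive_cst_mul c (is_derive_add (is_derive_add
    (is_derive_cst_mul (v * v) (is_derive_mul (Dl P2 q) (Dr P0 q q0)))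
    (is_derive_cst_mul (-2 * v * v) (is_derive_mul (Dl P1 q) (is_derive_mul (Dr P1 q q0) DII))))
    (is_derive_mul (Dl P0 q) (is_derive_add
      (is_derive_mul (Dr P2 q q0) (is_derive_cst_mul (v * v) (is_derive_mul DII DII)))
      (is_derive_mul (Dr P1 q q0) (is_derive_cst_mul (-2 * v) (is_derive_mul DII (DI q q0))))))).
split => //.
- by move=> q q0; rewrite /cut1 q0; exact: is_derive_if q0 (D1 q q0).
- by move=> q q0; rewrite /cut2 q0; exact: is_derive_if q0 (D2 q q0).
- move=> q q0; exact: is_derive_continuous (is_derive_if (F := T2 v) q0 (D3 q q0)).
- move=> q H; rewrite /cut0 /cut1 /cut2; case: ifPn => // q0.
  have vi : v * v^-1 = 1 by rewrite divff// lt0r_neq0.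
  have qi : q * q^-1 = 1 by rewrite divff// lt0r_neq0.
  have qi0 : 0 < q^-1 by rewrite invr_gt0.
  case: H => [qv|qv].
    have z Q : cutr Q v q = 0 by apply: bump_poly_le0; nra.
    by rewrite /T0 /T1 /T2 !z; split; ring.
  have z Q : cutl Q v q = 0 by apply: bump_poly_le0; nra.
  by rewrite /T0 /T1 /T2 !z; split; ring.
- move=> q; rewrite /cut0; case: ifPn => // q0.
  rewrite /T0; apply: mulr_ge0; first exact: sqr_ge0.
  by apply: mulr_ge0; exact: bump_poly1_ge0.
Qed.

(** The cutoff depends on [q] through [v q] and [v / q] only, so the scale-invariant derivatives
    [q th'] and [q^2 th''] are bounded uniformly in [v]. They are what multiplies [(u / q)^2] in the
    limit below. *)
Lemma bump_cutoff_bounded : exists2 K, 0 <= K & forall v q, 0 < v -> 0 < q ->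
  [/\ `|cut0 v q| <= K, `|q * cut1 v q| <= K & `|q ^+ 2 * cut2 v q| <= K].
Proof.
have [C0 C00 H0] := bump_poly_bounded P0; have [C1 C10 H1] := bump_poly_bounded P1.
have [C2 C20 H2] := bump_poly_bounded P2; pose C := C0 + C1 + C2.
have C'0 : 0 <= C by rewrite !addr_ge0.
have c0 : 0 <= c by exact: sqr_ge0.
have CC : 0 <= C * C by exact: mulr_ge0.
have B0 t : t <= 1 -> `|bump_poly P0 t| <= C by move=> /H0; rewrite /C; lra.
have B1 t : t <= 1 -> `|bump_poly P1 t| <= C by move=> /H1; rewrite /C; lra.
have B2 t : t <= 1 -> `|bump_poly P2 t| <= C by move=> /H2; rewrite /C; lra.
have pb x y : `|x| <= C -> `|y| <= C -> `|x * y| <= C * C by move=> hx hy; rewrite normrM ler_pM.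
(* 6 is the sum [1 + 2 + 1 + 2] of the absolute coefficients in the expansion of [q^2 th'']. *)
exists (6 * (c * (C * C))); first by apply: mulr_ge0; [lra|apply: mulr_ge0; [exact: c0|exact: CC]].
move=> v q v0 q0; have qn0 : q != 0 by exact: lt0r_neq0.
rewrite /cut0 /cut1 /cut2 q0 /T0 /T1 /T2.
pose s := v * q; pose t := v * q^-1.
have s0 : 0 <= s by rewrite mulr_ge0// ltW.
have t0 : 0 <= t by rewrite mulr_ge0 ?invr_ge0// ltW.
have el Q : cutl Q v q = bump_poly Q (1 - s) by rewrite /cutl mulNr.
have er Q : cutr Q v q = bump_poly Q (1 - t) by rewrite /cutr mulNr.
have [l0 _ _] := scaled_bump_bounded B0 s0; have [_ l1 _] := scaled_bump_bounded B1 s0.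
have [_ _ l2] := scaled_bump_bounded B2 s0; have [r0 _ _] := scaled_bump_bounded B0 t0.
have [_ r1 _] := scaled_bump_bounded B1 t0; have [_ _ r2] := scaled_bump_bounded B2 t0.
rewrite !el !er.
move: l0 l1 l2 r0 r1 r2; set a0 := bump_poly P0 (1 - s); set a1 := bump_poly P1 (1 - s).
set a2 := bump_poly P2 (1 - s); set b0 := bump_poly P0 (1 - t); set b1 := bump_poly P1 (1 - t).
set b2 := bump_poly P2 (1 - t) => l0 l1 l2 r0 r1 r2.
have k X : `|X| <= 6 * (C * C) -> `|c * X| <= 6 * (c * (C * C)).
  by move=> hX; rewrite normrM ger0_norm// mulrCA ler_wpM2l.
split.
- by apply: k; apply: le_trans (pb _ _ l0 r0) _; lra.
- have -> : q * (c * (((- v) * a1) * b0 + a0 * (b1 * (v * (q^-1 * q^-1))))) =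
      c * (- ((s * a1) * b0) + a0 * (t * b1)) by rewrite /s /t; field.
  apply: k; have := pb _ _ l1 r0; have := pb _ _ l0 r1; rewrite !ler_norml => /andP[? ?] /andP[? ?]; lra.
- have -> : q ^+ 2 * (c * ((v * v) * (a2 * b0) + (-2 * v * v) * (a1 * (b1 * (q^-1 * q^-1))) +
      a0 * (b2 * ((v * v) * ((q^-1 * q^-1) * (q^-1 * q^-1))) + b1 * ((-2 * v) * (q^-1 * q^-1 * q^-1))))) =
      c * ((s ^+ 2 * a2) * b0 - 2 * ((s * a1) * (t * b1)) + a0 * (t ^+ 2 * b2) - 2 * (a0 * (t * b1))).
    by rewrite /s /t; field.
  apply: k; have := pb _ _ l2 r0; have := pb _ _ l1 r1; have := pb _ _ l0 r2; have := pb _ _ l0 r1.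
  by rewrite !ler_norml => /andP[? ?] /andP[? ?] /andP[? ?] /andP[? ?]; lra.
Qed.

Lemma bump_cutoff_cvg q : 0 < q -> [/\ cut0 (inv1 N) q @[N --> \oo] --> (1 : R),
  cut1 (inv1 N) q @[N --> \oo] --> (0 : R) & cut2 (inv1 N) q @[N --> \oo] --> (0 : R)].
Proof.
move=> q0; have qn0 : q != 0 by exact: lt0r_neq0.
have cv : (inv1 N : R) @[N --> \oo] --> (0 : R) by exact: cvg_harmonic.
have cN : (- (inv1 N : R)) @[N --> \oo] --> (0 : R) by rewrite -oppr0; exact: cvgN cv.
have arg (y : R) : (1 + (- inv1 N) * y) @[N --> \oo] --> (1 : R).
  have H : (1 + (- inv1 N) * y) @[N --> \oo] --> (1 + 0 * y : R).
    exact: (cvgD (cvg_cst _) (cvgM cN (cvg_cst _))).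
  by rewrite mul0r addr0 in H.
have cl Q : cutl Q (inv1 N) q @[N --> \oo] --> bump_poly Q 1.
  exact: (cvg_comp _ _ (arg q) (@continuous_bump_poly R Q 1)).
have cr Q : cutr Q (inv1 N) q @[N --> \oo] --> bump_poly Q 1.
  exact: (cvg_comp _ _ (arg q^-1) (@continuous_bump_poly R Q 1)).
have c1 : c * (bump_poly P0 1 * bump_poly P0 1) = 1.
  by rewrite /c; field; exact: lt0r_neq0 bump_poly1_gt0.
have e0 : (fun N => cut0 (inv1 N) q) = (fun N => T0 (inv1 N) q) by apply/funext => N; rewrite /cut0 q0.
have e1 : (fun N => cut1 (inv1 N) q) = (fun N => T1 (inv1 N) q) by apply/funext => N; rewrite /cut1 q0.
have e2 : (fun N => cut2 (inv1 N) q) = (fun N => T2 (inv1 N) q) by apply/funext => N; rewrite /cut2 q0.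
have cvv : ((inv1 N : R) * inv1 N) @[N --> \oo] --> (0 * 0 : R) by exact: (cvgM cv cv).
have c2v : (-2 * (inv1 N : R)) @[N --> \oo] --> (-2 * 0 : R) by exact: (cvgM (cvg_cst _) cv).
have c2vv : (-2 * (inv1 N : R) * inv1 N) @[N --> \oo] --> (-2 * 0 * 0 : R) by exact: (cvgM c2v cv).
rewrite e0 e1 e2; split.
- have H : T0 (inv1 N) q @[N --> \oo] --> c * (bump_poly P0 1 * bump_poly P0 1).
    exact: (cvgM (cvg_cst _) (cvgM (cl P0) (cr P0))).
  by rewrite c1 in H.
- have H : T1 (inv1 N) q @[N --> \oo] --> c * ((0 * bump_poly P1 1) * bump_poly P0 1 +
      bump_poly P0 1 * (bump_poly P1 1 * (0 * (q^-1 * q^-1)))).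
    exact: (cvgM (cvg_cst _) (cvgD (cvgM (cvgM cN (cl P1)) (cr P0))
      (cvgM (cl P0) (cvgM (cr P1) (cvgM cv (cvg_cst _)))))).
  by rewrite !(mul0r, mulr0, addr0) in H.
- have H : T2 (inv1 N) q @[N --> \oo] --> c * ((0 * 0) * (bump_poly P2 1 * bump_poly P0 1) +
      (-2 * 0 * 0) * (bump_poly P1 1 * (bump_poly P1 1 * (q^-1 * q^-1))) +
      bump_poly P0 1 * (bump_poly P2 1 * ((0 * 0) * ((q^-1 * q^-1) * (q^-1 * q^-1))) +
        bump_poly P1 1 * ((-2 * 0) * (q^-1 * q^-1 * q^-1)))).
    exact: (cvgM (cvg_cst _) (cvgD (cvgD (cvgM cvv (cvgM (cl P2) (cr P0)))
      (cvgM c2vv (cvgM (cl P1) (cvgM (cr P1) (cvg_cst _)))))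
      (cvgM (cl P0) (cvgD (cvgM (cr P2) (cvgM cvv (cvg_cst _))) (cvgM (cr P1) (cvgM c2v (cvg_cst _))))))).
  by rewrite !(mul0r, mulr0, addr0) in H.
Qed.

End bump_cutoff.

(** * Removing the cutoff *)

Section hardy_limit.
Context {R : realType} (n : nat).
Hypothesis n0 : (0 < n)%N.
Local Notation mu := (lebesgue_rV R n.+1).
Local Notation sigma := (@sphere_measure R n.+1).
Variables (u g : 'rV[R]_n.+1 -> R).
Hypotheses (su : sqint u) (sg : sqint g)
  (weak : forall psi, test_function psi ->
    \int[mu]_x (u x * laplacian psi x) = \int[mu]_x (g x * psi x))
  (mean0 : {ae mu, forall x, \int[sigma]_(w in @esphere R n.+1) u (enorm x *: w) = 0})
  (iw : mu.-integrable setT (EFin \o (fun x => (u x * (sqn x)^-1) ^+ 2))).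

(** With [N = n.+1] this is [R_N + N - 1 = N^2 / 4 - 1], written as it arises: the last summand
    comes from the spheres, the others from [potential]. *)
Definition hardy_cst : R := n.+1%:R - 4 + ((n.+1%:R - 4) / 2) ^+ 2 + n%:R.

Section limit.
Variable lam : R.
Hypothesis lam0 : 0 <= lam.

Let F N (x : 'rV[R]_n.+1) := g x * u x * weightV (cut0 (inv1 N)) (sqn x) +
  u x * u x * (potential n (cut0 (inv1 N)) (cut1 (inv1 N)) (cut2 (inv1 N)) lam (sqn x) +
    n%:R * weightW (cut0 (inv1 N)) (sqn x)).

Let G (x : 'rV[R]_n.+1) := g x * u x * (sqn x)^-1 + u x * u x *
  ((sqn x)^-1 * (sqn x)^-1 * (hardy_cst - damp lam (sqn x) * damp lam (sqn x)) +
   2 * (damp1 lam (sqn x) * (sqn x)^-1)).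

Let thP N := bump_cutoff (@inv1_gt0 R N).

Let F_zero N x : sqn x = 0 -> F N x = 0.
Proof.
move=> q0; rewrite /F /weightV /potential /weightV /weightW q0 /cut0 /cut1 /cut2 ltxx.
by ring.
Qed.

Let F_int N : mu.-integrable setT (EFin \o F N) /\ \int[mu]_x F N x <= 0.
Proof.
have [C C0 [[mV VC _] [mW WC _] [mQ QC _]]] := weights_boxfun n lam (thP N).
have i1 := integrable_mul_bounded sg su mV VC; have i2 := integrable_mul_bounded su su mQ QC.
split; first exact: (integrableRD i1 i2).
rewrite RintegralD; [|exact: measurableT|exact: i1|exact: i2].
exact: (weak_stage n0 su sg weak mean0 lam (thP N)).
Qed.

Let F_cvg x : F N x @[N --> \oo] --> G x.
Proof.
(* At the origin both sides are 0: the cutoffs are 0 there, and in [G] the convention [0^-1 = 0]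
   applies. *)
have [q0|qn0] := eqVneq (sqn x) 0.
  rewrite (_ : (fun N => F N x) = fun=> 0); last by apply/funext => N; rewrite F_zero.
  rewrite (_ : G x = 0); first exact: cvg_cst.
  by rewrite /G q0 invr0; ring.
have q0 : 0 < sqn x by rewrite lt_neqAle eq_sym qn0 sqn_ge0.
have [a0 a1 a2] := bump_cutoff_cvg q0.
pose b := u x * u x * (2 * (damp lam (sqn x) * (sqn x)^-1)); pose d := u x * u x * (-2).
rewrite (_ : (fun N => F N x) = (fun N => G x * cut0 (inv1 N) (sqn x) + b * cut1 (inv1 N) (sqn x) +
    d * cut2 (inv1 N) (sqn x))); last first.
  by apply/funext => N; rewrite /F /G /b /d /weightV /potential /weightV /weightW /hardy_cst; ring.
have H0 : (G x * cut0 (inv1 N) (sqn x)) @[N --> \oo] --> G x * 1 by apply: cvgMl_tmp.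
have H1 : (b * cut1 (inv1 N) (sqn x)) @[N --> \oo] --> b * 0 by apply: cvgMl_tmp.
have H2 : (d * cut2 (inv1 N) (sqn x)) @[N --> \oo] --> d * 0 by apply: cvgMl_tmp.
have H : (G x * cut0 (inv1 N) (sqn x) + b * cut1 (inv1 N) (sqn x) + d * cut2 (inv1 N) (sqn x)) @[N --> \oo] -->
    G x * 1 + b * 0 + d * 0 by exact: (cvgD (cvgD H0 H1) H2).
by rewrite mulr1 !mulr0 !addr0 in H.
Qed.

Lemma damp_bound q : 0 < q -> 0 <= damp lam q <= lam /\ 0 <= q * damp1 lam q <= lam.
Proof.
move=> q0; have q1 : 0 < 1 + q by rewrite addr_gt0.
have i1 : 0 < (1 + q)^-1 by rewrite invr_gt0.
have e1 : (1 + q) * (1 + q)^-1 = 1 by rewrite divff// lt0r_neq0.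
rewrite /damp /damp1; set i := (1 + q)^-1 in i1 e1 *.
have h0 : 0 <= q * i <= 1 by apply/andP; split; nra.
have h1 : 0 <= q * i * i <= 1 by apply/andP; split; nra.
move: h0 h1 => /andP[h0 h0'] /andP[h1 h1'].
have -> : q * (lam * (i * i)) = lam * (q * i * i) by ring.
by split; rewrite mulr_ge0//= ler_piMr.
Qed.

(** Once [(u / q)^2] is factored out, the bracket contains only [th], [q th'], [q^2 th''], [damp]
    and [q damp1], all bounded uniformly in [N]. The resulting majorant is integrable by hypothesis
    [iw]. *)
Let F_bound : exists2 K, 0 <= K & forall N x, `|F N x| <= K * (g x ^+ 2 + (u x * (sqn x)^-1) ^+ 2).
Proof.
have [K K0 HK] := @bump_cutoff_bounded R.
pose K2 := K * (`|hardy_cst| + lam * lam) + 2 * (lam * K) + 2 * (lam * K) + 2 * K.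
have K20 : 0 <= K2 by rewrite /K2 !addr_ge0 ?mulr_ge0 ?addr_ge0 ?mulr_ge0.
exists (K + K2); first exact: addr_ge0.
move=> N x; have [q0|qn0] := eqVneq (sqn x) 0.
  rewrite F_zero// normr0; apply: mulr_ge0; first exact: addr_ge0.
  by apply: addr_ge0; exact: sqr_ge0.
have q0 : 0 < sqn x by rewrite lt_neqAle eq_sym qn0 sqn_ge0.
have [t0 t1 t2] := HK (inv1 N) (sqn x) (@inv1_gt0 R N) q0.
have [/andP[k0 k1] /andP[m0 m1]] := damp_bound q0.
set w := u x * (sqn x)^-1; set q := sqn x in q0 qn0 t0 t1 t2 k0 k1 m0 m1 w *.
set th := cut0 (inv1 N) q in t0 *; set th1 := q * cut1 (inv1 N) q in t1 *.
set th2 := q ^+ 2 * cut2 (inv1 N) q in t2 *; set k := damp lam q in k0 k1 *.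
set m := q * damp1 lam q in m0 m1 *.
pose Br := th * (hardy_cst - k * k) + 2 * (m * th) + 2 * (k * th1) - 2 * th2.
have -> : F N x = g x * w * th + w ^+ 2 * Br.
  rewrite /F /weightV /potential /weightV /weightW -/q -/th -/k /Br /w /th1 /th2 /m /hardy_cst.
  by field.
have p1 : `|th * (hardy_cst - k * k)| <= K * (`|hardy_cst| + lam * lam).
  rewrite normrM ler_pM//; apply: le_trans (ler_normB _ _) _.
  by rewrite lerD2l normrM; apply: ler_pM => //; rewrite ger0_norm.
have p2 : `|m * th| <= lam * K by rewrite normrM ler_pM// ger0_norm.
have p3 : `|k * th1| <= lam * K by rewrite normrM ler_pM// ger0_norm.
have bB : `|Br| <= K2.
  by move: p1 p2 p3 t2; rewrite /Br /K2 !ler_norml => /andP[? ?] /andP[? ?] /andP[? ?] /andP[? ?]; lra.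
have b1 : `|g x * w * th| <= (g x ^+ 2 + w ^+ 2) * K.
  rewrite normrM ler_pM// normrM -[g x ^+ 2]real_normK ?num_real// -[w ^+ 2]real_normK ?num_real//.
  by have := sqr_ge0 (`|g x| - `|w|); have := normr_ge0 (g x); have := normr_ge0 w; nra.
have b2 : `|w ^+ 2 * Br| <= w ^+ 2 * K2.
  by rewrite normrM ger0_norm ?sqr_ge0// ler_wpM2l ?sqr_ge0.
apply: le_trans (ler_normD _ _) _; apply: le_trans (lerD b1 b2) _.
by have := mulr_ge0 K20 (sqr_ge0 (g x)); lra.
Qed.

Lemma hardy_limit : mu.-integrable setT (EFin \o G) /\ \int[mu]_x G x <= 0.
Proof.
have [K K0 HK] := F_bound.
have iK := integrableRZ K (integrableRD sg.2 iw).
have mF N : measurable_fun setT (F N) by apply/measurable_EFinP; exact: (measurable_int _ (F_int N).1).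
have mG : measurable_fun setT G.
  by apply: (@measurable_fun_cvg _ _ _ _ F) => [N|x _]; [exact: mF|exact: F_cvg].
have cE x : (F N x)%:E @[N --> \oo] --> (G x)%:E.
  by apply: cvg_EFin; [exact: nearW|exact: F_cvg].
have [] := @dominated_convergence _ _ _ mu setT measurableT (fun N => EFin \o F N) (EFin \o G)
  (EFin \o (fun x => K * (g x ^+ 2 + (u x * (sqn x)^-1) ^+ 2))).
- by move=> N; apply/measurable_EFinP; exact: mF.
- by apply/measurable_EFinP; exact: mG.
- by apply: aeW => x _; exact: cE.
- exact: iK.
- by apply: aeW => x N _; rewrite lee_fin; exact: HK.
move=> iG _ C; split; first exact: iG.
rewrite -lee_fin -(integral_Rintegral iG) -(cvg_lim _ C)//.
apply: lime_le; first by apply/cvg_ex; eexists; exact: C.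
apply: nearW => N; rewrite [X in (X <= _)%E](integral_Rintegral (F_int N).1) lee_fin.
exact: (F_int N).2.
Qed.

End limit.

(** The integrand of the gain of first order in [lam]. Away from the origin it is positive wherever
    [u] is nonzero, so a zero integral forces [u = 0] almost everywhere. *)
Definition hardy_gap x := (u x * (sqn x)^-1) ^+ 2 * (sqn x * ((1 + sqn x)^-1 * (1 + sqn x)^-1)).


Lemma hardy_gap_bound (lam : R) : 0 < hardy_cst -> 0 < lam -> 
  mu.-integrable setT (EFin \o hardy_gap) /\
  2 * lam * \int[mu]_x hardy_gap x <= lam ^+ 2 * \int[mu]_x ((u x * (sqn x)^-1) ^+ 2) +
   (2 * hardy_cst)^-1 * (\int[mu]_x (g x ^+ 2) - hardy_cst ^+ 2 * \int[mu]_x ((u x * (sqn x)^-1) ^+ 2)).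
Proof.
move=> c0 lam0; have [iG G0] := hardy_limit (ltW lam0).
have ig : mu.-integrable setT (EFin \o hardy_gap).
  have m1 : measurable_fun setT (fun x : 'rV[R]_n.+1 => sqn x * (1 + sqn x) `^ (-2)).
    apply: measurable_funM; first by apply: continuous_rV_measurable; exact: continuous_sqn.
    apply: (measurableT_comp (f := fun y : R => y `^ (-2))); first exact: measurable_powR.
    apply: continuous_rV_measurable; apply: rV_continuousD; last exact: continuous_sqn.
    exact: rV_continuous_cst.
  have e1 (x : 'rV[R]_n.+1) : sqn x * ((1 + sqn x)^-1 * (1 + sqn x)^-1) = sqn x * (1 + sqn x) `^ (-2).
    have p : 0 <= 1 + sqn x by have := @sqn_ge0 R n.+1 x; lra.
    by rewrite powRN powR_mulrn// -exprVn expr2.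
  have mh : measurable_fun setT hardy_gap.
    have mw : measurable_fun setT (fun x => (u x * (sqn x)^-1) ^+ 2).
      by apply/measurable_EFinP; exact: (measurable_int _ iw).
    have := measurable_funM mw m1; rewrite (_ : _ \* _ = hardy_gap)//.
    by apply/funext => x; rewrite /hardy_gap e1.
  apply: (le_integrableR mh _ iw) => x.
  have q0 := @sqn_ge0 R n.+1 x; have q1 : 0 < 1 + sqn x by lra.
  have i1 : 0 < (1 + sqn x)^-1 by rewrite invr_gt0.
  have ee : (1 + sqn x) * (1 + sqn x)^-1 = 1 by rewrite divff// lt0r_neq0.
  rewrite /hardy_gap; set i := (1 + sqn x)^-1 in i1 ee *.
  have r0 : 0 <= sqn x * (i * i) by rewrite !mulr_ge0// ltW.
  rewrite ger0_norm; last by rewrite mulr_ge0// sqr_ge0.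
  by rewrite ler_piMr ?sqr_ge0//; nra.
split=> //; have c20 : 0 < (2 * hardy_cst)^-1 by rewrite invr_gt0 mulr_gt0.
set J := \int[mu]_x ((u x * (sqn x)^-1) ^+ 2); set A := \int[mu]_x (g x ^+ 2); set I := \int[mu]_x _.
have j1 := integrableRZ (2 * lam) ig; have j2 := integrableRZ (hardy_cst / 2 - lam ^+ 2) iw.
have j3 := integrableRZ (- (2 * hardy_cst)^-1) sg.2; have j12 := integrableRD j1 j2.
have j := integrableRD j12 j3.
have H : 2 * lam * I + (hardy_cst / 2 - lam ^+ 2) * J + - (2 * hardy_cst)^-1 * A <= 0.
  apply: le_trans G0; rewrite /I /J /A.
  rewrite -RintegralZl; [|exact: measurableT|exact: ig].
  rewrite -RintegralZl; [|exact: measurableT|exact: iw].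
  rewrite -RintegralZl; [|exact: measurableT|exact: sg.2].
  rewrite -RintegralD; [|exact: measurableT|exact: j1|exact: j2].
  rewrite -RintegralD; [|exact: measurableT|exact: j12|exact: j3].
  apply: le_Rintegral; [exact: measurableT|exact: j|exact: iG|] => x _.
  have [q0|qn0] := eqVneq (sqn x) 0.
    have h0 : hardy_gap x = 0 by rewrite /hardy_gap q0 invr0 mulr0 expr0n/= mul0r.
    have p := mulr_ge0 (ltW c20) (sqr_ge0 (g x)).
    rewrite h0 q0 invr0.
    have -> : g x * u x * 0 + u x * u x * (0 * 0 * (hardy_cst - damp lam 0 * damp lam 0) +
      2 * (damp1 lam 0 * 0)) = 0 by ring.
    have -> : (u x * 0) ^+ 2 = 0 by rewrite mulr0 expr0n.
    by rewrite !mulr0 !add0r mulNr oppr_le0.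
  have q0 : 0 < sqn x by rewrite lt_neqAle eq_sym qn0 sqn_ge0.
  have [/andP[k0 k1] _] := damp_bound (ltW lam0) q0.
  have q1 : 1 + sqn x != 0 by rewrite lt0r_neq0// addr_gt0.
  set q := sqn x in q0 qn0 k0 k1 q1 *; set w := u x * q^-1; set k := damp lam q in k0 k1 *.
  have -> : hardy_gap x = w ^+ 2 * (q * ((1 + q)^-1 * (1 + q)^-1)) by [].
  set rho := q * ((1 + q)^-1 * (1 + q)^-1).
  have -> : u x * u x * (q^-1 * q^-1 * (hardy_cst - k * k) + 2 * (damp1 lam q * q^-1)) =
      w ^+ 2 * (hardy_cst - k * k) + 2 * lam * (w ^+ 2 * rho).
    by rewrite /w /rho /damp1; field; exact/andP.
  have -> : g x * u x * q^-1 = g x * w by rewrite /w mulrA.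
  have kk : w ^+ 2 * (k * k) <= w ^+ 2 * lam ^+ 2 by rewrite ler_wpM2l ?sqr_ge0// expr2 ler_pM.
  (* Young's inequality with the weights fitted to the sharp inequality: the defect is a square that
     vanishes exactly when [g = - c w]. *)
  have am : - (g x * w) <= (2 * hardy_cst)^-1 * g x ^+ 2 + hardy_cst / 2 * w ^+ 2.
    rewrite -subr_ge0 (_ : _ - _ = (2 * hardy_cst)^-1 * (g x + hardy_cst * w) ^+ 2).
      by rewrite mulr_ge0 ?sqr_ge0// ltW.
    by field; exact: lt0r_neq0.
  move: kk am; set X := g x ^+ 2; set Y := w ^+ 2; set Z := Y * rho; set gw := g x * w.
  by rewrite mulrBr => kk am; lra.
have e : (2 * hardy_cst)^-1 * (A - hardy_cst ^+ 2 * J) = (2 * hardy_cst)^-1 * A - hardy_cst / 2 * J.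
  by field; exact: lt0r_neq0.
by rewrite e; lra.
Qed.

End hardy_limit.

(** * Real and imaginary parts *)

Section complex_parts.
Context {R : realType} (n : nat).
Local Notation mu := (lebesgue_rV R n).
Implicit Types (f g : 'rV[R]_n -> R[i]).

Lemma Re_mulC (z : R[i]) (r : R) : complex.Re (z * r%:C%C) = complex.Re z * r.
Proof. by case: z => a b /=; rewrite mulr0 subr0. Qed.

Lemma Im_mulC (z : R[i]) (r : R) : complex.Im (z * r%:C%C) = complex.Im z * r.
Proof. by case: z => a b /=; rewrite mulr0 add0r. Qed.

Let invC (r : R) : (r%:C%C)^-1 = Complex r^-1 0.
Proof. exact: (esym (fmorphV (real_complex R) r)). Qed.

Lemma Re_divC (z : R[i]) (r : R) : complex.Re (z / r%:C%C) = complex.Re z * r^-1.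
Proof. by rewrite invC; case: z => a b /=; rewrite mulr0 subr0. Qed.

Lemma Im_divC (z : R[i]) (r : R) : complex.Im (z / r%:C%C) = complex.Im z * r^-1.
Proof. by rewrite invC; case: z => a b /=; rewrite mulr0 add0r. Qed.

Lemma L2norm_sqr f : (L2norm f ^+ 2 =
  \int[mu]_x (complex.Re (f x) ^+ 2 + complex.Im (f x) ^+ 2)%:E)%E.
Proof.
have N0 : (0 <= L2norm f)%E by exact: Lnorm_ge0.
have -> : (L2norm f ^+ 2 = L2norm f `^ 2)%E.
  move: N0; case: (L2norm f) => [r| |]// r0.
    by rewrite poweR_EFin powR_mulrn// expr2 EFinM.
  first [by rewrite expe2 mulyy poweRyr ?pnatr_eq0|by rewrite expe2 mulyy /= pnatr_eq0|
    by rewrite expe2 mulyy /poweR (gt_eqF (ltr0n R 2))].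
rewrite /L2norm poweR_Lnorm ?pnatr_eq0//; apply: eq_integral => x _.
transitivity ((`|Normc.normc (f x)| `^ 2)%R%:E); first exact: poweR_EFin.
congr EFin; rewrite powR_mulrn ?normr_ge0// real_normK ?num_real//.
by case: (f x) => a b /=; rewrite sqr_sqrtr// addr_ge0// sqr_ge0.
Qed.

Lemma inL2_sqint f : inL2 f -> sqint (fun x => complex.Re (f x)) /\ sqint (fun x => complex.Im (f x)).
Proof.
move=> [mR mI foo].
have L : (\int[mu]_x (complex.Re (f x) ^+ 2 + complex.Im (f x) ^+ 2)%:E < +oo)%E.
  rewrite -L2norm_sqr; have N0 : (0 <= L2norm f)%E by exact: Lnorm_ge0.
  by move: N0 foo; case: (L2norm f) => [r| |]// _ _; rewrite expe2 -EFinM ltry.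
have i : mu.-integrable setT (EFin \o (fun x => complex.Re (f x) ^+ 2 + complex.Im (f x) ^+ 2)).
  apply: ge0_integrableR L; last by move=> x; rewrite addr_ge0// sqr_ge0.
  exact: (measurable_funD (measurable_funX 2 mR) (measurable_funX 2 mI)).
split; split.
- exact: mR.
- apply: (le_integrableR (measurable_funX 2 mR) _ i) => x.
  by rewrite ger0_norm ?sqr_ge0// lerDl sqr_ge0.
- exact: mI.
- apply: (le_integrableR (measurable_funX 2 mI) _ i) => x.
  by rewrite ger0_norm ?sqr_ge0// lerDr sqr_ge0.
Qed.

(** Test functions are real-valued, so the weak equation decouples. *)
Lemma is_laplacian_parts f g : is_laplacian f g -> forall psi, test_function psi ->
  \int[mu]_x (complex.Re (f x) * laplacian psi x) = \int[mu]_x (complex.Re (g x) * psi x) /\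
  \int[mu]_x (complex.Im (f x) * laplacian psi x) = \int[mu]_x (complex.Im (g x) * psi x).
Proof.
move=> [_ H] psi /H [h1 h2]; split.
  transitivity (\int[mu]_x complex.Re (f x * (laplacian psi x)%:C%C)).
    by apply: eq_Rintegral => x _; rewrite Re_mulC.
  by rewrite h1; apply: eq_Rintegral => x _; rewrite Re_mulC.
transitivity (\int[mu]_x complex.Im (f x * (laplacian psi x)%:C%C)).
  by apply: eq_Rintegral => x _; rewrite Im_mulC.
by rewrite h2; apply: eq_Rintegral => x _; rewrite Im_mulC.
Qed.

(** The normalizing factor is the inverse of a positive finite area, so it can be cancelled. *)
Lemma radial_proj_eq0 f x : (0 < n)%N -> radial_proj f x = 0 ->
  \int[@sphere_measure R n]_(w in @esphere R n) complex.Re (f (enorm x *: w)) = 0 /\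
  \int[@sphere_measure R n]_(w in @esphere R n) complex.Im (f (enorm x *: w)) = 0.
Proof.
move=> n0.
have me : measurable (@esphere R n).
  rewrite (_ : @esphere R n = @enorm R n @^-1` [set 1])//.
  by rewrite -[X in measurable X]setTI; apply: measurable_enorm => //; exact: measurable_set1.
have S0 := @sphere_area_gt0 R n n0.
have i1 : (@sphere_measure R n).-integrable setT (EFin \o (fun=> 1 : R)).
  by apply: (sphere_integrable_bounded (B := 1)) => // w; rewrite normr1.
have e1 : fine (@sphere_measure R n (@esphere R n)) = @sphere_area R n.
  have := sphere_Rintegral_esphere (measurable_cst (1 : R)) i1.
  by rewrite !Rintegral_cst// !mul1r.
rewrite /radial_proj e1 => /eqP; rewrite mulf_eq0 => /orP[|/eqP].
  by rewrite (fmorph_eq0 (real_complex R)) invr_eq0 (gt_eqF S0).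
by rewrite /cintegral => -[].
Qed.

End complex_parts.

(** * The equality case *)

Lemma quadratic_vanish (R : realFieldType) (I J : R) : 0 <= J ->
  (forall l, 0 < l -> 2 * l * I <= l ^+ 2 * J) -> I <= 0.
Proof.
move=> J0 H; rewrite leNgt; apply/negP => I0.
have J1 : 0 < J + 1 by lra.
(* One value of [l] is enough for the limit argument: here [I = l (J + 1)], so the hypothesis would
   give [2 l^2 (J + 1) <= l^2 J]. *)
have l0 : 0 < I / (J + 1) by rewrite divr_gt0.
have := H _ l0; set l := I / (J + 1) in l0 *.
have e : I = l * (J + 1) by rewrite /l divfK// lt0r_neq0.
by rewrite [X in 2 * l * X]e expr2; nra.
Qed.

Theorem mainTheorem8 (R : realType) (n : nat) (f Df : 'rV[R]_n -> R[i]) :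
  (3 <= n)%N ->
  inH2 f ->
  is_laplacian f Df ->
  {ae lebesgue_rV R n, forall x, radial_proj f x = 0} ->
  (((R_const R n + n%:R - 1) ^+ 2)%:E *
     L2norm (fun x => f x / (enorm x ^+ 2)%:C%C)%R ^+ 2 = L2norm Df ^+ 2)%E ->
  {ae lebesgue_rV R n, forall x, f x = 0}.
Proof.
case: n f Df => [//|m] f Df m3 [fL2 _] lap proj0 eq_case.
have m0 : (0 < m)%N by case: m m3 {f Df fL2 lap proj0 eq_case}.
set mu := lebesgue_rV R m.+1.
have [su1 su2] := inL2_sqint fL2; have [sg1 sg2] := inL2_sqint lap.1.
have wk := is_laplacian_parts lap.
have c_eq : R_const R m.+1 + m.+1%:R - 1 = hardy_cst m :> R.
  by rewrite /R_const /hardy_cst -[in RHS](natr1 m) -[in LHS](natr1 m); field.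
(* [N^2 / 4 - 1] is positive in dimension [N >= 3]. *)
have c0 : 0 < hardy_cst m :> R.
  have : 3 <= m.+1%:R :> R by rewrite ler_nat.
  by rewrite -c_eq /R_const => h; nra.
set c : R := hardy_cst m in c_eq c0; rewrite c_eq !L2norm_sqr in eq_case.
pose u1 x := complex.Re (f x); pose u2 x := complex.Im (f x).
pose g1 x := complex.Re (Df x); pose g2 x := complex.Im (Df x).
pose w1 x := (u1 x * (sqn x)^-1) ^+ 2; pose w2 x := (u2 x * (sqn x)^-1) ^+ 2.
have ew : (\int[mu]_x (complex.Re (f x / (enorm x ^+ 2)%:C%C)%R ^+ 2 +
    complex.Im (f x / (enorm x ^+ 2)%:C%C)%R ^+ 2)%:E = \int[mu]_x (w1 x + w2 x)%:E)%E.
  apply: eq_integral => x _; rewrite /w1 /w2 -enorm_sqr.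
  by congr (_ ^+ 2 + _ ^+ 2)%:E; [exact: Re_divC|exact: Im_divC].
rewrite ew in eq_case.
have mV : measurable_fun setT (fun x : 'rV[R]_m.+1 => (sqn x)^-1).
  rewrite (_ : (fun x => _) = fun x : 'rV[R]_m.+1 => (sqn x) `^ (-1)); last first.
    by apply/funext => x; rewrite powR_inv1// sqn_ge0.
  apply: (measurableT_comp (f := fun y : R => y `^ (-1))); first exact: measurable_powR.
  by apply: continuous_rV_measurable; exact: continuous_sqn.
have mw1 : measurable_fun setT w1 := measurable_funX 2 (measurable_funM su1.1 mV).
have mw2 : measurable_fun setT w2 := measurable_funX 2 (measurable_funM su2.1 mV).
have ig12 := integrableRD sg1.2 sg2.2.
have w0 x : 0 <= w1 x + w2 x by rewrite addr_ge0// sqr_ge0.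
(* If [f / |x|^2] were not in L^2, the left-hand side of the equality would be infinite, as [c > 0],
   while [Df] is in L^2. *)
have iw12 : mu.-integrable setT (EFin \o (fun x => w1 x + w2 x)).
  apply: ge0_integrableR; [exact: measurable_funD|exact: w0|].
  have c2 : 0 < c ^+ 2 by rewrite exprn_gt0.
  rewrite ltNge leye_eq; apply/negP => /eqP W.
  move: eq_case; rewrite W gt0_muley ?lte_fin// => E.
  by have := integral_Rintegral ig12; rewrite /= -E.
have iw1 : mu.-integrable setT (EFin \o w1).
  by apply: (le_integrableR mw1 _ iw12) => x; rewrite ger0_norm ?sqr_ge0// lerDl sqr_ge0.
have iw2 : mu.-integrable setT (EFin \o w2).
  by apply: (le_integrableR mw2 _ iw12) => x; rewrite ger0_norm ?sqr_ge0// lerDr sqr_ge0.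
have eqR : c ^+ 2 * (\int[mu]_x w1 x + \int[mu]_x w2 x) = \int[mu]_x (g1 x ^+ 2) + \int[mu]_x (g2 x ^+ 2).
  move: eq_case; rewrite (integral_Rintegral iw12) (integral_Rintegral ig12) -EFinM => -[].
  rewrite RintegralD; [|exact: measurableT|exact: iw1|exact: iw2].
  by rewrite RintegralD; [|exact: measurableT|exact: sg1.2|exact: sg2.2].
have mean1 : {ae mu, forall x, \int[@sphere_measure R m.+1]_(w in @esphere R m.+1) u1 (enorm x *: w) = 0}.
  by apply: filterS proj0 => x /(radial_proj_eq0 (ltn0Sn m))[].
have mean2 : {ae mu, forall x, \int[@sphere_measure R m.+1]_(w in @esphere R m.+1) u2 (enorm x *: w) = 0}.
  by apply: filterS proj0 => x /(radial_proj_eq0 (ltn0Sn m))[].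
have H1 l (l0 : 0 < l) := hardy_gap_bound m0 su1 sg1 (fun psi t => (wk psi t).1) mean1 iw1 c0 l0.
have H2 l (l0 : 0 < l) := hardy_gap_bound m0 su2 sg2 (fun psi t => (wk psi t).2) mean2 iw2 c0 l0.
(* Integrability of the gap does not involve [lam], so the value 1 is arbitrary. *)
have i1 := (H1 1 ltr01).1; have i2 := (H2 1 ltr01).1.
have gap0 (u : 'rV[R]_m.+1 -> R) x : 0 <= hardy_gap u x.
  have q0 := @sqn_ge0 R m.+1 x; have q1 : 0 <= (1 + sqn x)^-1 by rewrite invr_ge0; lra.
  by rewrite /hardy_gap mulr_ge0 ?sqr_ge0// mulr_ge0// mulr_ge0.
have I1 : 0 <= \int[mu]_x hardy_gap u1 x by apply: Rintegral_ge0 => x _; exact: gap0.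
have I2 : 0 <= \int[mu]_x hardy_gap u2 x by apply: Rintegral_ge0 => x _; exact: gap0.
have J1 : 0 <= \int[mu]_x w1 x by apply: Rintegral_ge0 => x _; exact: sqr_ge0.
have J2 : 0 <= \int[mu]_x w2 x by apply: Rintegral_ge0 => x _; exact: sqr_ge0.
have S : \int[mu]_x hardy_gap u1 x + \int[mu]_x hardy_gap u2 x <= 0.
  apply: (quadratic_vanish (addr_ge0 J1 J2)) => l l0.
  have h1 := (H1 l l0).2; have h2 := (H2 l l0).2.
  have := lerD h1 h2; rewrite -/c.
  set a1 := \int[mu]_x hardy_gap u1 x; set a2 := \int[mu]_x hardy_gap u2 x.
  rewrite -[\int[mu]_x ((u1 x * _) ^+ 2)]/(\int[mu]_x w1 x) -[\int[mu]_x ((u2 x * _) ^+ 2)]/(\int[mu]_x w2 x).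
  set b1 := \int[mu]_x w1 x in eqR *; set b2 := \int[mu]_x w2 x in eqR *.
  rewrite -[\int[mu]_x (complex.Re (Df x) ^+ 2)]/(\int[mu]_x (g1 x ^+ 2)).
  rewrite -[\int[mu]_x (complex.Im (Df x) ^+ 2)]/(\int[mu]_x (g2 x ^+ 2)).
  set d1 := \int[mu]_x (g1 x ^+ 2) in eqR *; set d2 := \int[mu]_x (g2 x ^+ 2) in eqR *.
  have -> : l ^+ 2 * b1 + (2 * c)^-1 * (d1 - c ^+ 2 * b1) + (l ^+ 2 * b2 + (2 * c)^-1 * (d2 - c ^+ 2 * b2)) =
    l ^+ 2 * (b1 + b2) + (2 * c)^-1 * (d1 + d2 - c ^+ 2 * (b1 + b2)) by ring.
  by rewrite -eqR subrr mulr0 addr0 -mulrDr.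
have vanish (u : 'rV[R]_m.+1 -> R) : mu.-integrable setT (EFin \o hardy_gap u) ->
    \int[mu]_x hardy_gap u x = 0 -> {ae mu, forall x, hardy_gap u x = 0}.
  move=> iu u0; have mu' := measurable_int _ iu.
  have /(ae_eq_integral_abs mu measurableT mu') : (\int[mu]_x `|(EFin \o hardy_gap u) x| = 0)%E.
    rewrite (eq_integral (EFin \o hardy_gap u)); first by rewrite (integral_Rintegral iu) u0.
    by move=> x _; rewrite gee0_abs// lee_fin.
  by apply: filterS => x /(_ Logic.I)[].
have v1 := vanish u1 i1 (_ : _ = 0); have v2 := vanish u2 i2 (_ : _ = 0).
have {v1}v1 : {ae mu, forall x, hardy_gap u1 x = 0} by apply: v1; lra.
have {v2}v2 : {ae mu, forall x, hardy_gap u2 x = 0} by apply: v2; lra.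
(* At the origin the gap is 0 whatever the value of [u], so this null set is set aside. *)
have vz : {ae mu, forall x, x != 0}.
  exists [set 0]; split; [exact: measurable_rV0|exact: lebesgue_rV_set0|].
  by move=> x /= /negP; rewrite negbK => /eqP.
have zero (u : 'rV[R]_m.+1 -> R) x : x != 0 -> hardy_gap u x = 0 -> u x = 0.
  move=> x0 /eqP; have q0 : 0 < sqn x by rewrite lt_neqAle eq_sym sqn_eq0 x0 sqn_ge0.
  have q1 : 1 + sqn x != 0 by rewrite lt0r_neq0// addr_gt0.
  rewrite /hardy_gap mulf_eq0 sqrf_eq0 !mulf_eq0 !invr_eq0 (negbTE q1) (gt_eqF q0) !orbF.
  by move/eqP.
apply: filterS3 v1 v2 vz => x h1 h2 x0.
have := zero u1 x x0 h1; have := zero u2 x x0 h2; rewrite /u1 /u2.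
by case: (f x) => a b /= -> ->.
Qed.
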